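(* For every real $A>0$ there is a constant $\delta(A)>0$, depending only on $A$, such that the following holds. Let $q\ge 3$ be a fixed prime and let $g\ge 2$ be a fixed integer not divisible by $q$. Then there is a constant $c(g,q,A)$, depending only on $g$, $q$ and $A$, such that for every positive integer $\gamma$, every real $X\ge 2$ with $X\le q^{A\gamma}$, and every integer $a$ with $\gcd(a,q)=1$, $$ \left|S_{q^{\gamma}}(a;X)\right| \le c(g,q,A)\left(X^{1-\delta(A)\rho^2}\log X + Xq^{-\delta(A)\gamma}\right), \qquad\text{where}\quad \rho=\frac{\log X}{\log q^\gamma}. $$
   Context: For a positive integer $m$ and $t\in\mathbb{R}$, $\mathbf{e}_m(t)=\exp(2\pi i t/m)$. $\Lambda$ is the von Mangoldt function: $\Lambda(n)=\log p$ if $n$ is a power of the prime $p$ (with positive exponent), and $\Lambda(n)=0$ otherwise. For the given integer $g$, an integer $a$ and a modulus $m$, $$S_m(a;X)=\sum_{n\le X}\Lambda(n)\,\mathbf{e}_m(ag^n),$$ the sum running over positive integers $n\le X$. *)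

(* Defs.v *)
From HB Require Import structures.
From mathcomp Require Import all_boot all_order all_algebra.
From mathcomp Require Import all_classical all_reals all_analysis.
From mathcomp Require Import complex.

Set Implicit Arguments.
Unset Strict Implicit.
Unset Printing Implicit Defensive.

Import Order.TTheory GRing.Theory Num.Theory.
Import numFieldNormedType.Exports.
Import ComplexField.Normc.

Local Open Scope ring_scope.
Local Open Scope complex_scope.

Section Definitions.
Variable R : realType.

Definition em (m : nat) (t : R) : R[i] :=
  cos (2 * pi * t / m%:R) +i* sin (2 * pi * t / m%:R).

(* Both searches are bounded by n: n = p ^ k with k > 0 and p prime
   forces p <= n and k <= n. *)
Definition vonMangoldt (n : nat) : R :=
  if [pick p : 'I_n.+1 |
      prime p && [exists k : 'I_n.+1, (0 < k)%N && (n == p ^ k :> nat)%N]]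
  is Some p then ln p%:R else 0.

Lemma vonMangoldt_pow (p k : nat) :
  prime p -> (0 < k)%N -> vonMangoldt (p ^ k) = ln p%:R.
Proof.
move=> pp k0; rewrite /vonMangoldt; case: pickP => [p' /andP[pp']|nex].
  case/existsP=> k' /andP[k'0 /eqP e]; congr (ln _%:R).
  have /eqP : primes (p ^ k) = primes (p' ^ k') by rewrite {1}e.
  by rewrite !primesX // !primes_prime // => /eqP[].
have le1 : (p < (p ^ k).+1)%N.
  by rewrite ltnS -{1}(expn1 p) leq_pexp2l // prime_gt0.
have le2 : (k < (p ^ k).+1)%N by rewrite ltnS ltnW // ltn_expl // prime_gt1.
have /negP[] := negbT (nex (Ordinal le1)).
by rewrite /= pp; apply/existsP; exists (Ordinal le2); rewrite /= k0 eqxx.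
Qed.

Lemma vonMangoldt_eq0 (n : nat) :
  (forall p k : nat, prime p -> (0 < k)%N -> n <> (p ^ k)%N) ->
  vonMangoldt n = 0.
Proof.
move=> H; rewrite /vonMangoldt; case: pickP => // p /andP[pp].
by case/existsP=> k /andP[k0 /eqP e]; case: (H p k pp k0).
Qed.

Definition expsum (g m : nat) (a : int) (X : R) : R[i] :=
  \sum_(1 <= n < (Num.truncn X).+1)
    (vonMangoldt n)%:C * em m (a%:~R * g%:R ^+ n).

End Definitions.

(* Main.v *)
Require Import Defs.
From HB Require Import structures.
From mathcomp Require Import all_boot all_order all_algebra.
From mathcomp Require Import all_classical all_reals all_analysis.
From mathcomp Require Import complex.
From mathcomp Require Import zify ring lra.

(** Vaughan's identity reduces [S] to sums of [e(a g^(d x) / q^gamma)] and of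
    [e(a (g^(n1 x) - g^(n2 x)) / q^gamma)] over intervals of [x]. In such a sum
    replace [x] by [x + h y z] and average over [y, z < q^b], where [h] is a
    multiple of [k! (q - 1) q^s]. Since [g^((q - 1) q^s) = 1 + q^b u] with [u]
    prime to [q], the binomial theorem turns the phase, modulo [q^gamma], into
    a polynomial of degree [k] in [y z] whose [i]-th coefficient has [q]-adic
    valuation close to [i b]. Hoelder's inequality bounds the double sum by the
    number of solutions of Vinogradov's system below [q^b], and that number is
    bounded by induction on the number of variables through congruences modulo
    powers of the single prime [q]: in a solution whose [k] variables lie in
    distinct classes modulo [q^k], Newton's identities determine these variables
    modulo a high power of [q]. With [k] of order [1 / rho] the saving is
    [q^(- c gamma / k^3)], that is [X^(- c' rho^2)]. *)

Set Implicit Arguments.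
Unset Strict Implicit.
Unset Printing Implicit Defensive.

Import Order.TTheory GRing.Theory Num.Theory.
Import numFieldNormedType.Exports.
Import ComplexField.Normc.

Local Open Scope ring_scope.
Local Open Scope complex_scope.

(** * Power sums modulo prime powers *)

(** Averaging over products [y z] makes the phase bilinear in the power sums of two tuples, so
    Hoelder's inequality needs only the denominators of the coefficients, which are powers of [q].
    The obstacle is the phase with two exponents [n1], [n2]: its coefficients may be highly
    divisible by [q]. Eliminating the second term from two consecutive degrees leaves
    [n1^i (n1 - n2)] times a unit, so at least every second degree is usable when [n1], [n2] are
    prime to [q] and incongruent modulo a small power of [q]; hence the terms with [q | n] are
    removed beforehand, at the cost of a logarithm. The factor [k!] in [h] clears the denominators
    of binomial coefficients. With [k = 8 m] and [b] about [gamma / (8 m)], the shifts stay below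
    [q^(4 b + 1)], while [m >= 2 / rho] puts [X] near or above [q^(16 b)]; this gap leaves room for
    Vaughan's parameters. The method yields a factor [(1 + ln X)^3]; the surplus logarithms are paid
    for by proving a saving several times larger than the one stated. If [b] is small in terms of
    [m] or of the valuation of [g^(q-1) - 1], the trivial bound suffices and [c] absorbs the
    loss. *)

Lemma fact_dvdn (m n : nat) : (m <= n)%N -> (m`! %| n`!)%N.
Proof. by move=> mn; rewrite -(bin_fact mn) dvdn_mull ?dvdn_mulr. Qed.

Section Newton.
Variables (A : comNzRingType) (k : nat) (x : 'I_k -> A).

Let F : {poly A} := \prod_i ('X - (x i)%:P).
Let H i : {poly A} := \prod_(j | j != i) ('X - (x j)%:P).

Lemma deriv_prod_XsubC (I : eqType) (r : seq I) (y : I -> A) : uniq r ->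
  (\prod_(i <- r) ('X - (y i)%:P))^`() =
  \sum_(i <- r) \prod_(j <- r | j != i) ('X - (y j)%:P).
Proof.
elim: r => [|a r IH] /=; first by rewrite !big_nil -polyC1 derivC.
case/andP=> ar /IH{}IH; rewrite !big_cons derivM IH derivXsubC mul1r eqxx /=.
congr (_ + _).
  rewrite big_seq_cond [RHS]big_seq_cond; apply: eq_bigl => j.
  by case jr: (j \in r) => //=; apply/esym; apply: contraNneq ar => <-.
rewrite big_distrr /= big_seq [RHS]big_seq; apply: eq_bigr => i ir.
by rewrite big_cons ifT //; apply: contraNneq ar => ->.
Qed.

(** Newton's identities, with the power sum of degree 0 included. The derivative of [F] is the sum
    of the quotients [H i], whose coefficients come from those of [F] by synthetic division. *)
Lemma newton_coef m :
  F`_m *+ m = \sum_(d < k.+1) (\sum_i x i ^+ d) * F`_(m + d).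
Proof.
have szF : size F = k.+1 by rewrite size_prod_XsubC [index_enum _]unlock -enumT size_enum_ord.
have FH i : F = ('X - (x i)%:P) * H i by rewrite /F (bigD1 i).
case: m => [|m].
  rewrite mulr0n; under eq_bigr do rewrite big_distrl /=.
  rewrite exchange_big big1 //= => i _.
  have: F.[x i] = 0 by rewrite (FH i) !hornerE subrr mul0r.
  rewrite horner_coef szF => E; rewrite -[RHS]E.
  by apply: eq_bigr => d _; rewrite mulrC add0n.
have szH i : (size (H i) <= k)%N.
  have : size F = (size (H i)).+1.
    have H0 : H i != 0.
      by apply: contra_eqN szF => /eqP H0; rewrite (FH i) H0 mulr0 size_poly0.
    by rewrite (FH i) size_monicM ?monicXsubC // size_XsubC.
  by rewrite szF => -[->].
have Hc i n : (H i)`_m = \sum_(d < n) x i ^+ d * F`_(m.+1 + d) + x i ^+ n * (H i)`_(m + n).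
  elim: n => [|n IH]; first by rewrite big_ord0 add0r expr0 mul1r addn0.
  rewrite IH big_ord_recr /= -addrA; congr (_ + _).
  rewrite (FH i) mulrBl coefB coefXM coefCM addSn /= exprS addnS; ring.
rewrite -coef_deriv /F deriv_prod_XsubC ?index_enum_uniq // coef_sum.
under [RHS]eq_bigr do rewrite big_distrl /=.
rewrite exchange_big /=; apply: eq_bigr => i _.
rewrite -/(H i) (Hc i k.+1) [X in _ + _ * X]nth_default ?mulr0 ?addr0 //.
by apply: leq_trans (szH i) _; lia.
Qed.

End Newton.

(** By Newton's identities [N] divides [j!] times the difference of the coefficients of degree
    [k - j] of the monic polynomials with roots [x] and [y]. Evaluating this difference at the root
    [x i] of the first leaves the product; [k!] makes up for the divisions by [j] in the
    identities. *)
Lemma psum_dvdz_prod (k : nat) (x y : 'I_k -> int) (N : int) :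
  (forall j, (0 < j <= k)%N ->
     (N %| \sum_i x i ^+ j - \sum_i y i ^+ j)%Z) ->
  forall i, (N %| (k`!)%:Z * \prod_l (x i - y l))%Z.
Proof.
move=> Hp i.
pose F (z : 'I_k -> int) : {poly int} := \prod_i ('X - (z i)%:P).
have szF z : size (F z) = k.+1 by rewrite size_prod_XsubC [index_enum _]unlock -enumT size_enum_ord.
have lF z : (F z)`_k = 1.
  have /monicP : F z \is monic by exact: monic_prod_XsubC.
  by rewrite lead_coefE szF.
have hF z m : (k < m)%N -> (F z)`_m = 0 by move=> h; rewrite nth_default // szF.
have claim j : forall m, (m + j = k)%N -> (N %| (j`!)%:Z * ((F x)`_m - (F y)`_m))%Z.
  elim/ltn_ind: j => -[|j] IH m mj.
    by rewrite addn0 in mj; rewrite mj !lF subrr mulr0 dvdz0.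
  have E : ((j.+1)%:Z) * ((F x)`_m - (F y)`_m) =
     - \sum_(d < k) ((\sum_i x i ^+ d.+1) * ((F x)`_(m + d.+1) - (F y)`_(m + d.+1))
        + (\sum_i x i ^+ d.+1 - \sum_i y i ^+ d.+1) * (F y)`_(m + d.+1)).
    have Ex := newton_coef x m; rewrite -/(F x) big_ord_recl /= in Ex.
    have Ey := newton_coef y m; rewrite -/(F y) big_ord_recl /= in Ey.
    rewrite addn0 in Ex; rewrite addn0 in Ey.
    have S0 (z : 'I_k -> int) : \sum_i z i ^+ 0 = (m + j.+1)%:Z.
      by under eq_bigr do rewrite expr0; rewrite sumr_const card_ord mj natz.
    rewrite !S0 in Ex Ey.
    have -> : (j.+1)%:Z * ((F x)`_m - (F y)`_m) =
       ((m + j.+1)%:Z * (F x)`_m - (F x)`_m *+ m) - ((m + j.+1)%:Z * (F y)`_m - (F y)`_m *+ m).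
      move: ((F x)`_m) ((F y)`_m) => u v.
      by rewrite -(mulr_natr u m) -(mulr_natr v m) natz PoszD; ring.
    rewrite Ex Ey; move: ((F x)`_m) ((F y)`_m) => u v.
    have R (w s1 s2 : int) : w * u - (w * u + s1) - (w * v - (w * v + s2)) = - (s1 - s2).
      by ring.
    rewrite R -sumrB; congr (- _); apply: eq_bigr => d _.
    by rewrite /bump /= add1n; ring.
  rewrite factS mulnC PoszM -mulrA E mulrN rpredN big_distrr /=; apply: rpred_sum => d _.
  rewrite mulrDr; apply: rpredD; last first.
    by apply: dvdz_mull; apply: dvdz_mulr; apply: Hp; rewrite /= ltn_ord.
  have [dj|dj] := leqP d j; last first.
    by rewrite !hF ?subrr ?mulr0 ?mul0r ?dvdz0 //; lia.
  rewrite mulrCA; apply: dvdz_mull.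
  have /dvdnP[c ->] : ((j - d)`! %| j`!)%N.
    exact/fact_dvdn/leq_subr.
  rewrite PoszM -mulrA; apply: dvdz_mull; apply: IH; lia.
have -> : (k`!)%:Z * \prod_l (x i - y l) = \sum_(m < k.+1) (k`!)%:Z * ((F y)`_m - (F x)`_m) * x i ^+ m.
  have -> : \prod_l (x i - y l) = (F y).[x i] - (F x).[x i].
    rewrite !horner_prod [X in _ - X](bigD1 i) //= !hornerE subrr mul0r subr0.
    by apply: eq_bigr => l _; rewrite !hornerE.
  rewrite !horner_coef !szF -sumrB big_distrr /=; apply: eq_bigr => m _; ring.
apply: rpred_sum => m _; apply: dvdz_mulr.
have mk : (m <= k)%N by rewrite -ltnS.
have := claim (k - m)%N m (subnKC mk).
have /dvdnP[c ->] : ((k - m)`! %| k`!)%N.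
  exact/fact_dvdn/leq_subr.
rewrite PoszM -opprB mulrN rpredN -mulrA => h; exact: dvdz_mull.
Qed.

Lemma logn_fact_leq (q n : nat) : prime q -> (logn q n`! <= n ^ 2)%N.
Proof.
move=> qp; rewrite logn_fact //.
apply: (@leq_trans (\sum_(1 <= j < n.+1) n)); first by apply: leq_sum => j _; exact: leq_div.
by rewrite sum_nat_const_nat subn1 mulnn.
Qed.

Lemma dvdn_pfactorM (q N A a b : nat) : prime q -> (0 < a)%N ->
  (logn q a <= A)%N -> (q ^ N %| a * b)%N -> (q ^ (N - A) %| b)%N.
Proof.
move=> qp a0 aA; case: (posnP b) => [->|b0]; first by rewrite dvdn0.
by rewrite !pfactor_dvdn ?muln_gt0 ?a0 // lognM // leq_subLR => /leq_trans-> //; rewrite leq_add2r.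
Qed.

Lemma logn_prod_leq (I : finType) (P : pred I) (F : I -> nat) (q A : nat) :
  (forall i, P i -> (0 < F i)%N /\ (logn q (F i) <= A)%N) ->
  (0 < \prod_(i | P i) F i)%N /\ (logn q (\prod_(i | P i) F i) <= #|P| * A)%N.
Proof.
move=> H; have F0 i : P i -> (0 < F i)%N by case/H.
split; first exact: prodn_cond_gt0.
rewrite -sum_nat_const.
apply: (big_rec2 (fun a b => (logn q a <= b)%N)) => [|i y1 y2 Pi IH].
  by rewrite logn1.
case: (posnP y1) => [->|y10]; first by rewrite muln0 logn0.
by rewrite lognM ?F0 // leq_add //; case/H: Pi.
Qed.

Section CountCongruences.
Variables (q k t h : nat) (a : int) (c : 'I_k -> nat) (lam : 'I_k -> int).
Hypotheses (qp : prime q) (k0 : (0 < k)%N) (kt : (k <= t)%N) (thk : (t <= h * k)%N).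
Hypothesis c_inj : forall i j, i != j -> c i != c j %[mod q ^ k].

Let X (x : {ffun 'I_k -> 'I_(q ^ (t - k))}) i : int := (c i + q ^ k * x i)%N%:Z - a.
Let S x (j : nat) : int := \sum_i X x i ^+ j.

Let qn0 n : (0 < q ^ n)%N. Proof. by rewrite expn_gt0 prime_gt0. Qed.

(* The factors [X x i - X y l] with [l != i] carry only small powers of [q],
   because the classes [c] are distinct modulo [q ^ k]. *)
Lemma psum_cong_close x y i :
  (forall j, (0 < j <= k)%N -> ((q ^ (h * k))%N%:Z %| S x j - S y j)%Z) ->
  x i = y i %[mod q ^ (h * k - 2 * k ^ 2 - k)].
Proof.
move=> /psum_dvdz_prod /(_ i).
rewrite (bigD1 i) //= dvdzE !abszM !absz_nat (big_morph absz abszM (erefl _)).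
have Bd l : l != i -> (0 < `|X x i - X y l|)%N /\ (logn q `|X x i - X y l| <= k.-1)%N.
  move=> li; have nd : ~~ (q ^ k %| `|X x i - X y l|)%N.
    apply: contra (c_inj li); rewrite eq_sym => hd0.
    have {hd0}hd : ((q ^ k)%N %| X x i - X y l)%Z by rewrite dvdzE.
    rewrite /X in hd.
    apply/eqP; case/dvdzP: hd => z E.
    have : ((c i + q ^ k * x i)%N%:Z = (c l + q ^ k * y l)%N%:Z %[mod (q ^ k)%N])%Z.
      have -> : (c i + q ^ k * x i)%N%:Z = z * (q ^ k)%N%:Z + (c l + q ^ k * y l)%N%:Z.
        by rewrite -E; ring.
      exact: modzMDl.
    by rewrite !modz_nat => -[]; rewrite ![(_ + q ^ k * _)%N]addnC ![(q ^ k * _)%N]mulnC !modnMDl.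
  have Z0 : (0 < `|X x i - X y l|)%N.
    by rewrite lt0n; apply: contraNneq nd => ->; rewrite dvdn0.
  by split=> //; move: nd; rewrite pfactor_dvdn // -ltnNge; lia.
have [] := @logn_prod_leq _ (fun l => l != i) (fun l => `|X x i - X y l|%N) q k.-1 Bd.
rewrite -[#|_|]/#|predC1 i| cardC1 card_ord => P0 Pl.
rewrite mulnCA [X in (_ %| X)%N]mulnC [X in (_ %| X * _)%N]mulnC => hN.
have a0 : (0 < \prod_(l | l != i) `|X x i - X y l| * k`!)%N.
  by rewrite muln_gt0 P0 fact_gt0.
have aA : (logn q (\prod_(l | l != i) `|X x i - X y l| * k`!) <= 2 * k ^ 2)%N.
  rewrite lognM ?fact_gt0 // mul2n -addnn leq_add ?logn_fact_leq //.
  by apply: leq_trans Pl _; rewrite -mulnn leq_mul ?leq_pred.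
have := dvdn_pfactorM qp a0 aA hN; rewrite /X.
have -> : (c i + q ^ k * x i)%N%:Z - a - ((c i + q ^ k * y i)%N%:Z - a) =
   (q ^ k)%N%:Z * ((x i)%:Z - (y i)%:Z) by rewrite !PoszD !PoszM; ring.
rewrite abszM absz_nat => hk.
have lk : (logn q (q ^ k) <= k)%N by rewrite pfactorK.
have hd := dvdn_pfactorM qp (qn0 k) lk hk.
have {}hd : ((q ^ (h * k - 2 * k ^ 2 - k))%N%:Z %| (x i)%:Z - (y i)%:Z)%Z by rewrite dvdzE.
case/dvdzP: hd => z E.
have : ((x i)%:Z = (y i)%:Z %[mod (q ^ (h * k - 2 * k ^ 2 - k))%N])%Z.
  have -> : (x i)%:Z = z * (q ^ (h * k - 2 * k ^ 2 - k))%N%:Z + (y i)%:Z.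
    by rewrite -E; ring.
  exact: modzMDl.
by rewrite !modz_nat => -[].
Qed.

(** Recording [h (k - j)] further [q]-adic digits of each power sum raises all moduli to [q^(h k)],
    which costs [q^(h C(k,2))]. Then [psum_cong_close] fixes every [x i] modulo [q^D], and since
    [t <= h k] at most [2 k^2] digits of it remain free. *)
Lemma card_psum_cong :
  (#|[set x : {ffun 'I_k -> 'I_(q ^ (t - k))} |
      [forall j : 'I_k, ((q ^ (h * j.+1))%N%:Z %| (S x j.+1 - lam j)%R)%Z]]|
   <= q ^ (h * 'C(k, 2) + 2 * k ^ 3))%N.
Proof.
pose D := (h * k - 2 * k ^ 2 - k)%N.
pose T1 := {dffun forall j : 'I_k, 'I_(q ^ (h * (k - j.+1)))}.
pose T2 := {ffun 'I_k -> 'I_(q ^ (2 * k ^ 2))}.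
pose mu x (j : 'I_k) : nat :=
  absz (modz (divz (S x j.+1 - lam j) (q ^ (h * j.+1))%N%:Z) (q ^ (h * (k - j.+1)))%N%:Z).
pose Phi x : T1 * T2 :=
  (finfun (fun j : 'I_k => Ordinal (ltn_pmod (mu x j) (qn0 (h * (k - j.+1))))),
   [ffun i : 'I_k => Ordinal (ltn_pmod (divn (x i) (q ^ D)) (qn0 (2 * k ^ 2)))]).
rewrite -(card_in_imset (f := Phi)); last first.
  move=> x y; rewrite !inE => /forallP Hx /forallP Hy [/ffunP E1 /ffunP E2].
  have Hmu (j : 'I_k) : mu x j = mu y j.
    have /(congr1 val) := E1 j; rewrite !ffunE /= /mu.
    have m0 z : (0 <= modz z (q ^ (h * (k - j.+1)))%N%:Z) by rewrite modz_ge0 // -lt0n.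
    have mlt z : (`|modz z (q ^ (h * (k - j.+1)))%N%:Z| < q ^ (h * (k - j.+1)))%N.
      by rewrite -ltz_nat gez0_abs // ltz_pmod // ltz_nat.
    by rewrite !modn_small.
  apply/ffunP => i; apply/val_inj.
  have xy : x i = y i %[mod q ^ D].
    apply: psum_cong_close => j /andP[j0 jk].
    have jk' : (j.-1 < k)%N by lia.
    have := Hx (Ordinal jk'); have := Hy (Ordinal jk'); have := Hmu (Ordinal jk').
    rewrite /mu /= prednK // => e /dvdzP[zy Ey] /dvdzP[zx Ex].
    have Q0 : (q ^ (h * j))%N%:Z != 0 by rewrite -lt0n.
    move: e; rewrite Ex Ey !mulzK // => e.
    have {e} : ((q ^ (h * (k - j)))%N%:Z %| zx - zy)%Z.
      rewrite -eqz_mod_dvd; apply/eqP.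
      have m0 z : (0 <= modz z (q ^ (h * (k - j)))%N%:Z) by rewrite modz_ge0 // -lt0n.
      by rewrite -[LHS]gez0_abs // e gez0_abs.
    case/dvdzP=> w Ew.
    have -> : S x j - S y j = w * ((q ^ (h * (k - j)))%N%:Z * (q ^ (h * j))%N%:Z).
      rewrite mulrA -Ew mulrBl -Ex -Ey; ring.
    by rewrite -PoszM -expnD -mulnDr subnK // dvdz_mull.
  have /(congr1 val) := E2 i; rewrite !ffunE /=.
  have small (z : 'I_(q ^ (t - k))) : (z %/ q ^ D < q ^ (2 * k ^ 2))%N.
    rewrite ltn_divLR // -expnD; apply: leq_trans (ltn_ord z) _.
    rewrite leq_exp2l ?prime_gt1 // /D; lia.
  rewrite !modn_small // => dxy.
  by rewrite [LHS](divn_eq _ (q ^ D)) [RHS](divn_eq _ (q ^ D)) dxy xy.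
apply: leq_trans (max_card _) _; rewrite card_prod card_ffun !card_ord card_dep_ffun.
rewrite expnD leq_mul //; last by rewrite -expnM; rewrite leq_exp2l ?prime_gt1 //; lia.
rewrite -[foldr _ _ _]/(foldr muln 1%N (map (fun j : 'I_k => #|'I_(q ^ (h * (k - j.+1)))|) (enum 'I_k))).
rewrite foldrE big_map big_enum /=.
under eq_bigr do rewrite card_ord.
rewrite -expn_sum -big_distrr /= leq_exp2l ?prime_gt1 // leq_mul2l.
apply/orP; right.
rewrite (reindex_inj rev_ord_inj) /= -triangular_sum big_mkord leq_sum // => j _.
by have := ltn_ord j; lia.
Qed.

End CountCongruences.

(** * Powers of an integer modulo a prime power *)

Lemma PoszX (m n : nat) : (m ^ n)%N%:Z = m%:Z ^+ n.
Proof. by rewrite -!natz natrX. Qed.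

Section Lifting.
Variable q : nat.
Hypotheses (qp : prime q) (q3 : (3 <= q)%N).

(** The terms with [1 < i < q] gain a factor [q] from the binomial coefficient; the last one carries
    [q^(b q)], and [b q >= b + 2] because [q >= 3]. *)
Lemma lte_step (b u : nat) : (0 < b)%N -> ~~ (q %| u)%N ->
  exists2 u', ~~ (q %| u')%N & ((1 + q ^ b * u) ^ q = 1 + q ^ b.+1 * u')%N.
Proof.
move=> b0 qu; have q0 := prime_gt0 qp.
rewrite expnDn -(big_mkord xpredT (fun i => ('C(q, i) * (1 ^ (q - i) * (q ^ b * u) ^ i))%N)).
rewrite big_ltn // big_ltn ?ltnS // bin0 bin1 !exp1n expn0 expn1 !mul1n.
have /dvdnP[r ->] : (q ^ b.+2 %| \sum_(2 <= i < q.+1) 'C(q, i) * (1 ^ (q - i) * (q ^ b * u) ^ i))%N.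
  rewrite big_nat_cond; apply: dvdn_sum => i /andP[/andP[i2 iq] _].
  rewrite exp1n mul1n expnMn mulnA dvdn_mulr // -expnM.
  have [->|nq] := eqVneq i q.
    by rewrite binn mul1n dvdn_exp2l //; nia.
  rewrite [(q ^ b.+2)%N]expnS dvdn_mul ?dvdn_exp2l //; last by nia.
  by apply: prime_dvd_bin => //; lia.
exists (u + q * r)%N; first by rewrite dvdn_addl // dvdn_mulr.
by rewrite !expnS; ring.
Qed.

Lemma lte_pow (b u s : nat) : (0 < b)%N -> ~~ (q %| u)%N ->
  exists2 u', ~~ (q %| u')%N & ((1 + q ^ b * u) ^ (q ^ s) = 1 + q ^ (b + s) * u')%N.
Proof.
move=> b0 qu; elim: s => [|s [v qv Ev]]; first by exists u; rewrite // expn1 addn0.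
have [|v' qv' Ev'] := @lte_step (b + s) v _ qv; first by rewrite ltn_addr.
by exists v'; rewrite // expnSr expnM Ev Ev' addnS.
Qed.

(** Here [b] is the valuation of [g^(q-1) - 1]. The exponent grows by exactly one with [s], so every
    exponent from this fixed threshold on can be reached. *)
Lemma lte_unit (g : nat) : (2 <= g)%N -> ~~ (q %| g)%N ->
  exists2 b, (0 < b)%N & forall s, exists2 u, ~~ (q %| u)%N &
    (g ^ (q.-1 * q ^ s) = 1 + q ^ (b + s) * u)%N.
Proof.
move=> g2 qg; have q0 := prime_gt0 qp.
have gq1 : (1 < g ^ q.-1)%N by rewrite -(exp1n q.-1) ltn_exp2r //; lia.
have qd : (q %| g ^ q.-1 - 1)%N.
  have : (g ^ q = g %[mod q])%N by rewrite fermat_little.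
  move/eqP; rewrite eqn_mod_dvd; last by rewrite -{1}(expn1 g) leq_exp2l.
  have -> : (g ^ q - g = g * (g ^ q.-1 - 1))%N by rewrite mulnBr muln1 -expnS prednK.
  rewrite Gauss_dvdr //.
  by rewrite prime_coprime.
have [//|u qu E] := @pfactor_coprime q (g ^ q.-1 - 1) qp; first by lia.
exists (logn q (g ^ q.-1 - 1)); first by rewrite -pfactor_dvdn // ?expn1 //; lia.
move=> s; have qu' : ~~ (q %| u)%N by rewrite -prime_coprime.
have [|v qv Ev] := @lte_pow (logn q (g ^ q.-1 - 1)) u s _ qu'.
  by rewrite -pfactor_dvdn // ?expn1 //; lia.
exists v => //; rewrite expnM -Ev; congr (_ ^ _)%N.
by rewrite mulnC -E; lia.
Qed.

End Lifting.

Definition ffact_poly (j : nat) : {poly int} := \prod_(l < j) ('X - (l%:Z)%:P).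

Lemma ffact_poly_horner (j y : nat) : (ffact_poly j).[y%:Z] = (y ^_ j)%N%:Z.
Proof.
rewrite horner_prod ffact_prod.
have [jy|yj] := leqP j y.
  rewrite (big_morph Posz PoszM (erefl _)); apply: eq_bigr => l _.
  by rewrite !hornerE -subzn //; have := ltn_ord l; lia.
rewrite (bigD1 (Ordinal yj)) //= !hornerE subrr mul0r.
by rewrite (bigD1 (Ordinal yj)) //= subnn mul0n.
Qed.

Lemma size_ffact_poly j : size (ffact_poly j) = j.+1.
Proof. by rewrite size_prod_XsubC [index_enum _]unlock -enumT size_enum_ord. Qed.

Lemma ffact_poly_lead j : (ffact_poly j)`_j = 1.
Proof.
have /monicP : ffact_poly j \is monic by exact: monic_prod_XsubC.
by rewrite lead_coefE size_ffact_poly.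
Qed.

Lemma ffact_poly_coef0 j : (0 < j)%N -> (ffact_poly j)`_0 = 0.
Proof.
move=> j0; rewrite -horner_coef0 -[0 in LHS]/(0%N%:Z) ffact_poly_horner.
by case: j j0.
Qed.

(** * Powers of [1 + q^b u] as polynomials in the exponent *)

Section PowerExpansion.
Variables (q k b u : nat).
Hypotheses (qp : prime q) (k0 : (0 < k)%N) (bk : (k ^ 2 < b)%N) (qu : ~~ (q %| u)%N).

Let w : nat := (q ^ b * u)%N.
Let K : nat := k`!.
(** The coefficient of [y^i] in [k!] times the binomial series of [(1 + w)^y] truncated after degree
    [k]. *)
Let Psi (i : nat) : int :=
  \sum_(j < k.+1) (k`! %/ j`!)%N%:Z * w%:Z ^+ j * (ffact_poly j)`_i.

Lemma bin_sum_expansion (y : nat) :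
  K%:Z * \sum_(j < k.+1) 'C(y, j)%:Z * w%:Z ^+ j = \sum_(i < k.+1) Psi i * y%:Z ^+ i.
Proof.
rewrite big_distrr /=; under [RHS]eq_bigr do rewrite big_distrl /=.
rewrite exchange_big /=; apply: eq_bigr => j _.
have E : \sum_(i < k.+1) (ffact_poly j)`_i * y%:Z ^+ i = (y ^_ j)%N%:Z.
  rewrite -ffact_poly_horner horner_coef size_ffact_poly.
  rewrite [RHS](big_ord_widen_cond k.+1 xpredT (fun i => (ffact_poly j)`_i * y%:Z ^+ i)) //=.
  rewrite [RHS]big_mkcond /=; apply: eq_bigr => i _; case: ltnP => // ij.
  by rewrite nth_default ?mul0r // size_ffact_poly.
under eq_bigr do rewrite -mulrA.
rewrite -big_distrr /= E -bin_ffact PoszM.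
have {1}-> : K = (k`! %/ j`! * j`!)%N by rewrite divnK // fact_dvdn // -ltnS.
by rewrite PoszM; ring.
Qed.

(** Falling factorials of degree below [i] have no coefficient of index [i], and the one of degree
    [i] is monic, so [Psi i = w^i (k!/i! + w r)]. Since [b > k^2] exceeds the valuation of [k!/i!],
    the term [w r] does not affect the valuation. *)
Lemma Psi_val (i : nat) : (0 < i <= k)%N ->
  exists2 E : int, ~~ (q %| E)%Z &
    exists2 v, (v <= k ^ 2)%N & Psi i = (q ^ (i * b + v))%N%:Z * E.
Proof.
case/andP=> i0 ik.
have K0 : (0 < k`! %/ i`!)%N by rewrite divn_gt0 ?fact_gt0 // dvdn_leq ?fact_gt0 ?fact_dvdn.
have [//|m qm Em] := @pfactor_coprime q (k`! %/ i`!) qp.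
set v := logn _ _ in Em.
have vk : (v <= k ^ 2)%N.
  apply: leq_trans (logn_fact_leq k qp); apply: dvdn_leq_log; rewrite ?fact_gt0 //.
  by rewrite -{2}(divnK (fact_dvdn ik)) dvdn_mulr.
have [r Er] : exists r : int, Psi i = w%:Z ^+ i * ((k`! %/ i`!)%N%:Z + w%:Z * r).
  exists (\sum_(j < k.+1 | (i < j)%N) (k`! %/ j`!)%N%:Z * w%:Z ^+ (j - i.+1) * (ffact_poly j)`_i).
  rewrite /Psi (bigD1 (Ordinal (ik : (i < k.+1)%N))) //= ffact_poly_lead mulr1 mulrDr.
  rewrite [w%:Z ^+ i * _%:Z]mulrC; congr (_ + _).
  rewrite big_distrr big_distrr /= (bigID (fun j : 'I_k.+1 => (i < j)%N)) /= addrC big1 ?add0r.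
    apply: eq_big => [j|j /andP[_ ij]].
      by rewrite -val_eqE /=; case: ltngtP.
    have -> : w%:Z ^+ j = w%:Z ^+ i * (w%:Z * w%:Z ^+ (j - i.+1)).
      by rewrite -exprS -exprD; congr (_ ^+ _); lia.
    by ring.
  move=> j /andP[ij]; rewrite -leqNgt => ji.
  rewrite nth_default ?mulr0 // size_ffact_poly ltn_neqAle ji andbT.
  by rewrite eq_sym -val_eqE /= in ij *; rewrite eq_sym.
have bv : (v < b)%N by exact: leq_ltn_trans bk.
exists ((u ^ i)%N%:Z * (m%:Z + (q ^ (b - v) * u)%N%:Z * r)).
  rewrite dvdzE abszM absz_nat Euclid_dvdM // negb_or; apply/andP; split.
    by rewrite Euclid_dvdX // (negbTE qu).
  have : ~~ (q %| m%:Z)%Z by rewrite dvdzE absz_nat -prime_coprime.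
  apply: contra => hd0.
  have {hd0}hd : (q %| m%:Z + (q ^ (b - v) * u)%N%:Z * r)%Z by rewrite dvdzE absz_nat.
  rewrite -(addrK ((q ^ (b - v) * u)%N%:Z * r) m%:Z); apply: rpredB => //.
  by apply: dvdz_mulr; rewrite dvdzE !absz_nat dvdn_mulr // dvdn_exp // subn_gt0.
exists v => //; rewrite Er Em /w.
have -> : (q ^ b)%N = (q ^ v * q ^ (b - v))%N by rewrite -expnD subnKC // ltnW.
have -> : (q ^ (i * b + v) = (q ^ v * q ^ (b - v)) ^ i * q ^ v)%N.
  by rewrite -expnD subnKC ?(ltnW bv) // expnD mulnC [(i * b)%N]mulnC expnM mulnC.
by rewrite !PoszM !PoszX !PoszM !PoszX !exprMn; ring.
Qed.

Lemma pow_expansion : exists D : nat -> int,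
  (forall i, (0 < i <= k)%N -> exists2 d, (i * b <= d <= i * b + i * k ^ 2)%N &
     exists2 E : int, ~~ (q %| E)%Z & D i = (q ^ d)%N%:Z * E) /\
  forall x : nat, ((q ^ (b * k.+1))%N %|
     ((1 + w) ^ (k`! * x))%N%:Z - (1 + \sum_(i < k) D i.+1 * x%:Z ^+ i.+1))%Z.
Proof.
(* Substituting [y = k! x] multiplies [Psi i] by [k!^i]; one factor cancels the [k!] in front of the
   binomial sum, so the coefficients stay integral. *)
exists (fun i => K%:Z ^+ i.-1 * Psi i); split.
  move=> i ik; have [E qE [v vk EP]] := Psi_val ik.
  have [m qm Em] := pfactor_coprime qp (fact_gt0 k).
  have : (logn q k`! <= k ^ 2)%N by exact: logn_fact_leq.
  move: (logn q k`!) Em => l Em lk.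
  exists (i * b + v + l * i.-1)%N.
    case: i ik EP => // i _ _ /=; rewrite -addnA leq_addr leq_add2l mulSn.
    by rewrite leq_add // mulnC leq_mul2l lk orbT.
  exists ((m ^ i.-1)%N%:Z * E).
    rewrite dvdzE abszM !absz_nat Euclid_dvdM // negb_or; apply/andP; split.
      by rewrite -prime_coprime // coprimeXr.
    by move: qE; rewrite dvdzE absz_nat.
  by rewrite EP /K Em !(PoszM, PoszX) !exprMn -!exprM !exprD; ring.
move=> x.
have K0 : K%:Z != 0 by rewrite -lt0n fact_gt0.
have E1 : 1 + \sum_(i < k) (K%:Z ^+ i * Psi i.+1) * x%:Z ^+ i.+1 =
  \sum_(j < k.+1) 'C(k`! * x, j)%:Z * w%:Z ^+ j.
  apply: (mulfI K0); rewrite bin_sum_expansion mulrDr mulr1 big_ord_recl expr0 mulr1.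
  congr (_ + _).
    rewrite /Psi big_ord_recl big1 ?addr0.
      by rewrite fact0 divn1 mulr1 ffact_poly_lead mulr1.
    by move=> j _; rewrite ffact_poly_coef0 ?mulr0.
  rewrite big_distrr; apply: eq_bigr => i _.
  by rewrite /= /bump /= add1n PoszM -/K exprMn [K%:Z ^+ i.+1]exprS; ring.
rewrite E1.
have -> : ((1 + w) ^ (k`! * x))%N%:Z = \sum_(j < (k`! * x).+1) 'C(k`! * x, j)%:Z * w%:Z ^+ j.
  rewrite expnDn (big_morph Posz PoszD (erefl _)); apply: eq_bigr => j _.
  by rewrite exp1n mul1n PoszM PoszX.
set y := (k`! * x)%N.
have W (n : nat) : (y < n)%N -> \sum_(j < y.+1) 'C(y, j)%:Z * w%:Z ^+ j =
     \sum_(j < n) 'C(y, j)%:Z * w%:Z ^+ j.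
  move=> yn; rewrite (big_ord_widen_cond n xpredT (fun j => 'C(y, j)%:Z * w%:Z ^+ j)) //=.
  rewrite big_mkcond /=; apply: eq_bigr => j _; case: ltnP => // yj.
  by rewrite bin_small ?mul0r.
rewrite (W (k.+1 + y.+1)%N) ?leq_addl // big_split_ord /= addrAC subrr add0r.
apply: rpred_sum => j _; apply: dvdz_mull.
by rewrite -PoszX dvdzE !absz_nat /w expnMn -expnM dvdn_mulr // dvdn_exp2l // leq_mul2l leq_addr orbT.
Qed.

End PowerExpansion.

(** * Additive characters *)

Section Exponential.
Variable R : realType.
Implicit Types (s t : R) (z w : R[i]).

Definition e1 (t : R) : R[i] := cos (2 * pi * t) +i* sin (2 * pi * t).

Lemma em_e1 m t : em m t = e1 (t / m%:R).
Proof. by rewrite /em /e1 !mulrA. Qed.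

Lemma e1D s t : e1 (s + t) = e1 s * e1 t.
Proof.
rewrite /e1 mulrDr cosD sinD; apply/eqP; rewrite eq_complex /= eqxx /=.
by rewrite addrC [sin _ * _]mulrC.
Qed.

Lemma e1_0 : e1 0 = 1.
Proof. by rewrite /e1 mulr0 cos0 sin0. Qed.

Lemma e1N t : e1 (- t) = (e1 t)^*%C.
Proof. by rewrite /e1 mulrN cosN sinN. Qed.

Lemma normc_e1 t : normc (e1 t) = 1.
Proof. by rewrite /e1 /= cos2Dsin2 sqrtr1. Qed.

Lemma e1Mn t n : e1 (t *+ n) = e1 t ^+ n.
Proof. by elim: n => [|n IH]; rewrite ?mulr0n ?e1_0 // mulrS e1D IH exprS. Qed.

Lemma e1_1 : e1 1 = 1.
Proof. by rewrite /e1 mulr1 mulrC mulr_natr cos2pi sin2pi. Qed.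

Lemma e1_int (z : int) : e1 z%:~R = 1.
Proof.
case: z => n.
  by rewrite -pmulrn e1Mn e1_1 expr1n.
by rewrite NegzE mulrNz e1N -pmulrn e1Mn e1_1 expr1n conjc1.
Qed.

Lemma e1_eq1 t : 0 <= t < 1 -> e1 t = 1 -> t = 0.
Proof.
case/andP=> t0 t1; have pi0 := pi_gt0 R.
(* [cos] is injective only on [[0, pi]], so [t > 1/2] is reflected to [1 - t]. *)
have half (x : R) : 0 <= x -> 2 * x <= 1 -> cos (2 * pi * x) = 1 -> x = 0.
  move=> x0 x1 Hc.
  have : 2 * pi * x = 0.
    have h1 : 2 * pi * x \in `[0, pi].
      rewrite in_itv /=; apply/andP; split; first by rewrite !mulr_ge0 ?ler0n ?(ltW pi0).
      by rewrite mulrAC -[leRHS]mul1r ler_pM2r.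
    have h2 : (0 : R) \in `[0, pi] by rewrite in_itv /= lexx (ltW pi0).
    by apply: (cos_inj h1 h2); rewrite Hc cos0.
  by move/eqP; rewrite !mulf_eq0 (gt_eqF pi0) pnatr_eq0 /= => /eqP.
case=> Hc Hs; have [h|h] := lerP (2 * t) 1; first exact: half.
have : 1 - t = 0.
  apply: half; [lra | lra |].
  have E : 2 * pi = pi *+ 2 :> R by rewrite mulr_natl.
  by rewrite mulrBr mulr1 cosB E cos2pi sin2pi -E mul1r mul0r addr0.
by move=> ?; lra.
Qed.

Lemma e1_fracE (A : int) (N : nat) (v : int) : (0 < N)%N -> coprimez A N ->
  e1 (A%:~R / N%:R * v%:~R) = 1 -> (N %| v)%Z.
Proof.
move=> N0 cAN.
have NR : N%:R != 0 :> R by rewrite pnatr_eq0 -lt0n.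
have -> : A%:~R / N%:R * v%:~R =
    ((A * v) %/ N)%Z%:~R + ((A * v) %% N)%Z%:~R / N%:R :> R.
  rewrite mulrAC -intrM {1}(divz_eq (A * v) N) intrD intrM -pmulrn.
  by rewrite mulrDl mulfK.
rewrite e1D e1_int mul1r => h.
have NZ : N%:Z != 0 by rewrite -lt0n.
have : ((A * v %% N)%Z%:~R / N%:R : R) = 0.
  apply: e1_eq1 => //; rewrite divr_ge0 ?ler0n ?ler0z ?modz_ge0 //=.
  rewrite ltr_pdivrMr ?ltr0n // mul1r pmulrn ltr_int.
  by apply: ltz_pmod; rewrite ltz_nat.
move/eqP; rewrite mulf_eq0 invr_eq0 (negbTE NR) orbF intr_eq0 => /eqP hm.
rewrite coprimez_sym in cAN; rewrite -(Gauss_dvdzr v cAN).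
exact/dvdz_mod0P.
Qed.

Lemma sum_e1_eq0 (A : int) (N V : nat) (u : int) : (0 < N)%N -> coprimez A N ->
  (N %| V)%N -> ~~ (N %| u)%Z ->
  \sum_(v < V) e1 (A%:~R / N%:R * v%:R * u%:~R) = 0.
Proof.
move=> N0 cAN /dvdnP[c ->] Nu.
pose z := e1 (A%:~R / N%:R * u%:~R).
have z1 : z != 1 by apply: contraNneq Nu => /(e1_fracE N0 cAN).
have Ez v : e1 (A%:~R / N%:R * v%:R * u%:~R) = z ^+ v.
  by rewrite /z -e1Mn -mulr_natr; congr e1; ring.
under eq_bigr do rewrite Ez.
have /eqP := subrX1 z (c * N); rewrite eq_sym.
have -> : z ^+ (c * N) - 1 = 0.
  rewrite -Ez.
  have -> : A%:~R / N%:R * (c * N)%:R * u%:~R = (A * c%:Z * u)%:~R :> R.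
    have NR : N%:R != 0 :> R by rewrite pnatr_eq0 -lt0n.
    by rewrite natrM !intrM -pmulrn; field.
  by rewrite e1_int subrr.
by rewrite mulf_eq0 subr_eq0 (negbTE z1) /= => /eqP.
Qed.

Lemma normc_ge0 z : 0 <= normc z.
Proof. by case: z => a b /=; rewrite sqrtr_ge0. Qed.

Lemma normc_sqr z : (normc z ^+ 2)%:C = z * z^*%C.
Proof.
case: z => a b /=; rewrite sqr_sqrtr ?addr_ge0 ?sqr_ge0 //.
by apply/eqP; rewrite eq_complex /=; apply/andP; split; apply/eqP; ring.
Qed.

Lemma normcX z n : normc (z ^+ n) = normc z ^+ n.
Proof. by elim: n => [|n IH]; rewrite ?expr0 ?normc1 // !exprS normcM IH. Qed.

Lemma normcJ z : normc (z^*%C) = normc z.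
Proof. by case: z => a b /=; rewrite sqrrN. Qed.

Lemma normc_real t : normc (t%:C) = `|t|.
Proof. by rewrite /= expr0n addr0 sqrtr_sqr. Qed.

Lemma normc_sum (I : Type) (r : seq I) (P : pred I) (F : I -> R[i]) :
  normc (\sum_(i <- r | P i) F i) <= \sum_(i <- r | P i) normc (F i).
Proof.
elim/big_rec2: _ => [|i x y _ IH]; first by rewrite normc0.
by apply: le_trans (le_normcD _ _) _; rewrite lerD2l.
Qed.

Lemma normc_prod (I : Type) (r : seq I) (P : pred I) (F : I -> R[i]) :
  normc (\prod_(i <- r | P i) F i) = \prod_(i <- r | P i) normc (F i).
Proof. exact: (big_morph (@normc R) (@normcM R) (@normc1 R)). Qed.

Lemma e1_sum (I : Type) (r : seq I) (P : pred I) (F : I -> R) :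
  e1 (\sum_(i <- r | P i) F i) = \prod_(i <- r | P i) e1 (F i).
Proof. exact: (big_morph e1 e1D e1_0). Qed.

Lemma normc_sum_sqr (T : finType) (P : pred T) (f : T -> R[i]) :
  (normc (\sum_(x | P x) f x) ^+ 2)%:C = \sum_(x | P x) \sum_(y | P y) f x * (f y)^*%C.
Proof.
rewrite normc_sqr rmorph_sum big_distrl /=; apply: eq_bigr => x _.
by rewrite big_distrr.
Qed.

End Exponential.

Arguments e1 {R} t : simpl never.

(** * Second moments of character sums over boxes and grids *)

Section Orthogonality.
Variables (R : realType) (T : finType) (k W : nat).
Variables (V : 'I_k -> nat) (alpha : 'I_k -> R) (phi : T -> 'I_k -> nat).

(** The sides [V j] differ; cutting the box out of the maps into one common ['I_W] keeps its
    elements ordinary finite functions. *)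
Let box := family (fun j => [pred w : 'I_W | (w < V j)%N]).
Let ch (v : {ffun 'I_k -> 'I_W}) x : R[i] :=
  e1 (\sum_j alpha j * (v j)%:R * (phi x j)%:R).

Lemma sum_char_sqr (xi : T -> R[i]) :
  \sum_(v in box) (normc (\sum_x xi x * ch v x) ^+ 2)%:C =
  \sum_x \sum_y xi x * (xi y)^*%C *
    \prod_j \sum_(w : 'I_W | (w < V j)%N)
       e1 (alpha j * w%:R * ((phi x j)%:Z - (phi y j)%:Z)%:~R).
Proof.
under eq_bigr do rewrite normc_sum_sqr.
rewrite exchange_big /=; apply: eq_bigr => x _.
rewrite exchange_big /=; apply: eq_bigr => y _.
rewrite (bigA_distr_big_dep (fun (j : 'I_k) (w : 'I_W) => (w < V j)%N)) big_distrr /=.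
apply: eq_bigr => v _.
have cM (a b : R[i]) : (a * b)^*%C = a^*%C * b^*%C by exact: rmorphM.
rewrite cM mulrACA; congr (_ * _).
rewrite /ch -e1N -e1D -sumrB e1_sum; apply: eq_bigr => j _.
by rewrite intrD rmorphN /= mulrDr mulrN -!pmulrn.
Qed.

Variable N : 'I_k -> nat.
Hypothesis VW : forall j, (V j <= W)%N.
Hypothesis orth : forall j (u : int), ~~ (N j %| u)%Z ->
  \sum_(w < V j) e1 (alpha j * w%:R * u%:~R) = 0.

(** By [orth] a pair contributes only if all its differences are divisible by the [N j]; such pairs
    are bounded trivially, so the weights matter only through their size. *)
Lemma sum_char_sqr_le (xi : T -> R[i]) : (forall x, normc (xi x) <= 1) ->
  \sum_(v in box) normc (\sum_x xi x * ch v x) ^+ 2 <=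
  (\prod_j V j)%:R *
  (#|[set p : T * T | [forall j, (N j %| ((phi p.1 j)%:Z - (phi p.2 j)%:Z)%R)%Z]]|)%:R.
Proof.
move=> xi1.
have Ew j (u : int) : \sum_(w : 'I_W | (w < V j)%N) e1 (alpha j * w%:R * u%:~R) =
    \sum_(w < V j) e1 (alpha j * w%:R * u%:~R).
  by rewrite (big_ord_widen W (fun w : nat => e1 (alpha j * w%:R * u%:~R))).
have ge0 : 0 <= \sum_(v in box) normc (\sum_x xi x * ch v x) ^+ 2.
  by apply: sumr_ge0 => v _; rewrite exprn_ge0 ?normc_ge0.
rewrite -[leLHS](ger0_norm ge0) -normc_real rmorph_sum /= sum_char_sqr.
apply: le_trans (normc_sum _ _ _) _.
rewrite -sum1_card natr_sum big_distrr /=.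
set D := [set p | _]; rewrite [leRHS]big_mkcond /=.
rewrite [leRHS](eq_bigr (fun p : T * T => if (p.1, p.2) \in D then (\prod_j V j)%:R * 1%:R else 0));
  last by move=> -[x y] _ /=.
rewrite -(pair_bigA _ (fun x y => if (x, y) \in D then (\prod_j V j)%:R * 1%:R else 0)) /=.
apply: ler_sum => x _; apply: le_trans (normc_sum _ _ _) _; apply: ler_sum => y _.
rewrite !normcM normcJ inE /= normc_prod.
under eq_bigr do rewrite Ew.
case: ifPn => [_|]; last first.
  rewrite negb_forall => /existsP[j /orth E].
  by rewrite [X in _ * X](bigD1 j) //= E normc0 mul0r mulr0.
rewrite mulr1 natr_prod -[leRHS]mul1r; apply: ler_pM.
- by rewrite mulr_ge0 ?normc_ge0.
- by apply: prodr_ge0 => j _; exact: normc_ge0.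
- by rewrite -[leRHS]mulr1 ler_pM ?normc_ge0.
apply: ler_prod => j _; rewrite normc_ge0 /=.
apply: le_trans (normc_sum _ _ _) _.
by under eq_bigr do rewrite normc_e1; rewrite sumr_const card_ord.
Qed.

End Orthogonality.

Section GridMean.
Variables (R : realType) (T : finType) (k M : nat) (phi : T -> 'I_k -> nat).
Hypothesis M0 : (0 < M)%N.
Hypothesis small : forall x j, (phi x j < M)%N.

(** A finite form of the mean value integral over the torus: the frequencies run over fractions with
    denominator [M], and by [small] the congruences that they detect are equalities. *)
Lemma grid_mean :
  \sum_(v : {ffun 'I_k -> 'I_M})
    normc (\sum_x e1 (\sum_j M%:R^-1 * (v j)%:R * (phi x j)%:R) : R[i]) ^+ 2 =
  (M ^ k)%:R * (#|[set p : T * T | [forall j, phi p.1 j == phi p.2 j]]|)%:R.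
Proof.
have Ew (u : int) : \sum_(w : 'I_M | (w < M)%N) e1 (M%:R^-1 * w%:R * u%:~R) =
    \sum_(w < M) e1 (M%:R^-1 * w%:R * u%:~R) :> R[i].
  by rewrite (big_ord_widen M (fun w : nat => e1 (M%:R^-1 * w%:R * u%:~R))).
have inj : injective (fun t : R => t%:C) by move=> a b [].
apply: inj; rewrite rmorph_sum /=.
have -> : \sum_(v : {ffun 'I_k -> 'I_M})
    (normc (\sum_x e1 (\sum_j M%:R^-1 * (v j)%:R * (phi x j)%:R) : R[i]) ^+ 2)%:C =
   \sum_(v in family (fun _ : 'I_k => [pred w : 'I_M | (w < M)%N]))
    (normc (\sum_x 1 * e1 (\sum_j M%:R^-1 * (v j)%:R * (phi x j)%:R) : R[i]) ^+ 2)%:C.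
  apply: eq_big => [v|v _]; first by apply/esym/familyP => j; rewrite inE ltn_ord.
  by under [in RHS]eq_bigr do rewrite mul1r.
rewrite (@sum_char_sqr R T k M (fun=> M) (fun=> M%:R^-1) phi (fun=> 1)).
under eq_bigr => x _ do under eq_bigr => y _ do rewrite conjc1 !mul1r.
rewrite -sum1_card natr_sum big_distrr /= rmorph_sum.
set D := [set p | _]; rewrite [RHS]big_mkcond /=.
rewrite [RHS](eq_bigr (fun p : T * T => if (p.1, p.2) \in D then ((M ^ k)%:R * 1%:R)%:C else 0));
  last by move=> -[x y] _ /=.
rewrite -(pair_bigA _ (fun x y => if (x, y) \in D then ((M ^ k)%:R * 1%:R)%:C else 0)) /=.
apply: eq_bigr => x _; apply: eq_bigr => y _.
rewrite inE /=; case: ifPn => [/forallP xy|].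
  have E j : \sum_(w : 'I_M | (w < M)%N)
      e1 (M%:R^-1 * w%:R * ((phi x j)%:Z - (phi y j)%:Z)%:~R) = M%:R :> R[i].
    rewrite Ew; under eq_bigr do rewrite (eqP (xy j)) subrr mulr0 e1_0.
    by rewrite sumr_const card_ord.
  under eq_bigr do rewrite E.
  by rewrite prodr_const card_ord mulr1 rmorph_nat natrX.
rewrite negb_forall => /existsP[j xy].
rewrite (bigD1 j) //= Ew.
have nd : ~~ (M %| ((phi x j)%:Z - (phi y j)%:Z)%R)%Z.
  rewrite dvdzE absz_nat; apply/negP => /dvdn_leq.
  by have := small x j; have := small y j; move/eqP: xy; lia.
have c1 : coprimez 1 M by rewrite coprimezE coprime1n.
have E0 : \sum_(w < M) e1 (M%:R^-1 * w%:R * ((phi x j)%:Z - (phi y j)%:Z)%:~R) = 0 :> R[i].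
  rewrite -[RHS](sum_e1_eq0 R M0 c1 (dvdnn M) nd).
  by apply: eq_bigr => w _; rewrite mulr1z mul1r.
by rewrite E0 mul0r.
Qed.

End GridMean.

(** * Vinogradov's mean value for powers of one prime *)

Section RealInequalities.
Variable R : realFieldType.

Lemma chebyshev_sum (I : finType) (x : I -> R) p : (forall i, 0 <= x i) ->
  (\sum_i x i) * (\sum_i x i ^+ p) <= #|I|%:R * \sum_i x i ^+ p.+1.
Proof.
move=> x0; rewrite -subr_ge0.
have E : \sum_i \sum_j (x i - x j) * (x i ^+ p - x j ^+ p) =
   2 * (#|I|%:R * \sum_i x i ^+ p.+1 - (\sum_i x i) * (\sum_i x i ^+ p)).
  have E1 : \sum_(i : I) \sum_(j : I) x i ^+ p.+1 = #|I|%:R * \sum_i x i ^+ p.+1.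
    rewrite big_distrr /=; apply: eq_bigr => i _; by rewrite sumr_const mulr_natl.
  have E2 : \sum_(i : I) \sum_(j : I) x j ^+ p.+1 = #|I|%:R * \sum_i x i ^+ p.+1.
    by rewrite exchange_big.
  have E3 : \sum_i \sum_j x i * x j ^+ p = (\sum_i x i) * (\sum_i x i ^+ p).
    rewrite big_distrl /=; apply: eq_bigr => i _; by rewrite big_distrr.
  have E4 : \sum_i \sum_j x j * x i ^+ p = (\sum_i x i) * (\sum_i x i ^+ p).
    by rewrite exchange_big.
  rewrite mulr_natl mulr2n -{1}E1 -E2 -{1}E3 -E4 addrACA -opprD -!big_split -sumrB /=.
  apply: eq_bigr => i _; rewrite -!big_split -sumrB /=.
  by apply: eq_bigr => j _; rewrite !exprS; ring.
have : 0 <= \sum_i \sum_j (x i - x j) * (x i ^+ p - x j ^+ p).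
  apply: sumr_ge0 => i _; apply: sumr_ge0 => j _.
  have [h|/ltW h] := lerP (x i) (x j).
    by rewrite mulr_le0 // subr_le0 // lerXn2r // nnegrE.
  by rewrite mulr_ge0 // subr_ge0 // lerXn2r // nnegrE.
by rewrite E pmulr_rge0 // ltr0n.
Qed.

Lemma power_mean (I : finType) (x : I -> R) p : (forall i, 0 <= x i) ->
  (\sum_i x i) ^+ p.+1 <= #|I|%:R ^+ p * \sum_i x i ^+ p.+1.
Proof.
move=> x0; elim: p => [|p IH].
  by rewrite expr1 expr0 mul1r; apply: ler_sum => i _; rewrite expr1.
rewrite exprS; apply: le_trans (_ : (\sum_i x i) * (#|I|%:R ^+ p * \sum_i x i ^+ p.+1) <= _).
  by apply: ler_wpM2l => //; apply: sumr_ge0.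
rewrite mulrCA exprSr -mulrA; apply: ler_wpM2l; first by rewrite exprn_ge0 ?ler0n.
exact: chebyshev_sum.
Qed.

(* The indices with [x c >= y / (2 Q)] carry at least half of the sum: there
   are either [k] of them, or so few that one carries a large share. *)
Lemma large_class_dichotomy (Q k : nat) (x : 'I_Q -> R) (y : R) :
  (0 < Q)%N -> (0 < k)%N -> (forall c, 0 <= x c) -> 0 <= y -> y <= \sum_c x c ->
  y ^+ (2 * k) <= (2 * Q%:R) ^+ (2 * k) *
     \sum_(c : {ffun 'I_k -> 'I_Q} | injectiveb c) \prod_i x (c i) ^+ 2
  \/ exists c, y <= 2 * k%:R * x c.
Proof.
move=> Q0 k0 x0 y0 yx.
pose B := [set c | y <= 2 * Q%:R * x c].
have [kB|Bk] := leqP k #|B|; [left | right].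
  pose c : {ffun 'I_k -> 'I_Q} := [ffun i => enum_val (widen_ord kB i)].
  have cinj : injectiveb c.
    apply/injectiveP => i j; rewrite !ffunE => /enum_val_inj /(congr1 val) /= h.
    exact/val_inj.
  rewrite (bigD1 c) //= mulrDr -[leLHS]addr0; apply: lerD; last first.
    rewrite mulr_ge0 ?exprn_ge0 ?mulr_ge0 ?ler0n //.
    by apply: sumr_ge0 => d _; apply: prodr_ge0 => i _; rewrite exprn_ge0.
  have pk (a : R) : a ^+ k = \prod_(i < k) a by rewrite prodr_const card_ord.
  rewrite !exprM (pk (y ^+ 2)) (pk ((2 * Q%:R) ^+ 2)) -big_split /=.
  apply: ler_prod => i _; rewrite exprn_ge0 //= -exprMn.
  rewrite lerXn2r ?nnegrE ?mulr_ge0 ?ler0n //.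
  by have := enum_valP (widen_ord kB i); rewrite inE ffunE.
pose c0 := [arg max_(c > Ordinal Q0) x c]%O.
have c0P c : x c <= x c0.
  by rewrite /c0; case: arg_maxP => // i _; apply.
exists c0.
have QR : 0 < Q%:R :> R by rewrite ltr0n.
have : y <= k%:R * x c0 + y / 2.
  apply: le_trans yx _; rewrite (bigID (mem B)) /=; apply: lerD.
    apply: le_trans (_ : \sum_(i in B) x c0 <= _); first by apply: ler_sum.
    rewrite sumr_const -[leLHS]mulr_natl; apply: ler_wpM2r => //.
    by rewrite ler_nat ltnW.
  apply: le_trans (_ : \sum_(i < Q) y / (2 * Q%:R) <= _).
    rewrite [leRHS](bigID (mem B)) /= -[leLHS]add0r; apply: lerD.
      by apply: sumr_ge0 => i _; rewrite divr_ge0 ?mulr_ge0 ?ler0n.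
    apply: ler_sum => i; rewrite inE -ltNge => /ltW h.
    by rewrite ler_pdivlMr ?mulr_gt0 ?ltr0n // mulrC.
  have QN : Q%:R != 0 :> R by rewrite gt_eqF.
  by rewrite sumr_const card_ord -[leLHS]mulr_natl le_eqVlt; apply/orP; left; apply/eqP; field.
by move=> h; lra.
Qed.

(** The same sum [y] is split into classes modulo [q^k] (the [x c]) and modulo [q^h] (the [z a]). In
    the first case of the dichotomy [2 k] factors go to [k] distinct large classes, and the power
    mean distributes the other [2 s] over the [z a]; in the second case one class takes all
    factors. *)
Lemma class_decomposition (Q H k s : nat) (x : 'I_Q -> R) (z : 'I_H -> R) (y : R) :
  (0 < Q)%N -> (0 < k)%N -> (0 < s)%N ->
  (forall c, 0 <= x c) -> (forall a, 0 <= z a) ->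
  0 <= y -> y <= \sum_c x c -> y <= \sum_a z a ->
  y ^+ (2 * (s + k)) <= (2 * Q%:R) ^+ (2 * k) * H%:R ^+ (2 * s).-1 *
     (\sum_(c : {ffun 'I_k -> 'I_Q} | injectiveb c) \sum_a
         (\prod_i x (c i) ^+ 2) * z a ^+ (2 * s)) +
     (2 * k%:R) ^+ (2 * (s + k)) * \sum_c x c ^+ (2 * (s + k)).
Proof.
move=> Q0 k0 s0 x0 z0 y0 yx yz.
have P0 (c : {ffun 'I_k -> 'I_Q}) : 0 <= \prod_i x (c i) ^+ 2.
  by apply: prodr_ge0 => i _; rewrite exprn_ge0.
have [h|[c h]] := large_class_dichotomy Q0 k0 x0 y0 yx.
  rewrite -[leLHS]addr0; apply: lerD; last first.
    rewrite mulr_ge0 ?exprn_ge0 ?mulr_ge0 ?ler0n //.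
    by apply: sumr_ge0 => c _; rewrite exprn_ge0.
  have hz : y ^+ (2 * s) <= H%:R ^+ (2 * s).-1 * \sum_a z a ^+ (2 * s).
    have s2 : (0 < 2 * s)%N by rewrite muln_gt0.
    have := power_mean (2 * s).-1 z0; rewrite prednK // card_ord; apply: le_trans.
    by rewrite lerXn2r // nnegrE // sumr_ge0.
  rewrite mulnDr addnC exprD; apply: le_trans (ler_pM _ _ h hz) _; rewrite ?exprn_ge0 //.
  rewrite le_eqVlt; apply/orP; left; apply/eqP.
  under [in RHS]eq_bigr do rewrite -big_distrr /=.
  by rewrite -big_distrl /=; ring.
rewrite -[leLHS]add0r; apply: lerD.
  rewrite mulr_ge0 ?mulr_ge0 ?exprn_ge0 ?mulr_ge0 ?ler0n //.
  by apply: sumr_ge0 => d _; apply: sumr_ge0 => a _; rewrite mulr_ge0 ?exprn_ge0.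
apply: le_trans (_ : (2 * k%:R * x c) ^+ (2 * (s + k)) <= _).
  by rewrite lerXn2r // nnegrE ?mulr_ge0 ?ler0n.
rewrite exprMn; apply: ler_wpM2l; first by rewrite exprn_ge0 ?mulr_ge0 ?ler0n.
rewrite (bigD1 c) //= -[leLHS]addr0 lerD2l; apply: sumr_ge0 => d _; exact: exprn_ge0.
Qed.

End RealInequalities.

Lemma card_le_fiber (T U : finType) (D : {set T}) (f : T -> U) (G : {set U}) (B : nat) :
  (forall p, p \in D -> f p \in G) ->
  (forall u, u \in G -> (#|[set p in D | f p == u]| <= B)%N) -> (#|D| <= #|G| * B)%N.
Proof.
move=> DG fB; rewrite -sum1_card (partition_big f (mem G)) //=.
rewrite -sum_nat_const; apply: leq_sum => u /fB; apply: leq_trans.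
by rewrite sum1_card; apply: eq_leq; apply: eq_card => p; rewrite !inE.
Qed.

(* Weighting a pair by [m u / m w + m w / m u >= 2], with [m] the size of the
   fibre of [f], counts each fibre of [f] against itself. *)
Lemma card_shifted_le (T : finType) (K : eqType) (f : T -> K) (P : rel T) :
  (forall u w w', P u w -> P u w' -> f w = f w') ->
  (forall u u' w, P u w -> P u' w -> f u = f u') ->
  (#|[set p : T * T | P p.1 p.2]| <= #|[set p : T * T | f p.1 == f p.2]|)%N.
Proof.
move=> P1 P2.
pose m u := #|[set w | f w == f u]|.
have m0 u : 0 < (m u)%:R :> rat.
  by rewrite ltr0n /m card_gt0; apply/set0Pn; exists u; rewrite inE.
have mE u w : f u = f w -> m u = m w by rewrite /m => ->.
have cardE1 (Q : rel T) : #|[set p : T * T | Q p.1 p.2]|%:R = \sum_u \sum_(w | Q u w) 1 :> rat.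
  rewrite -sum1_card natr_sum pair_big_dep /=; apply: eq_bigl => p; by rewrite inE.
have bound (Q : rel T) : (forall u w w', Q u w -> Q u w' -> f w = f w') ->
    \sum_u \sum_(w | Q u w) (m u)%:R / (m w)%:R <= #|[set p : T * T | f p.1 == f p.2]|%:R :> rat.
  move=> HQ; rewrite (cardE1 (fun u w => f u == f w)); apply: ler_sum => u _.
  have -> : \sum_(w | f u == f w) 1 = (m u)%:R :> rat.
    by rewrite /m -sum1_card natr_sum; apply: eq_bigl => w; rewrite inE eq_sym.
  have [w0 Q0|nQ] := pickP (Q u); last by rewrite big_pred0.
  apply: le_trans (_ : \sum_(w | f w == f w0) (m u)%:R / (m w0)%:R <= _).
    rewrite [leLHS]big_mkcond [leRHS]big_mkcond; apply: ler_sum => w _.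
    case: ifPn => [Qw|_].
      by rewrite (HQ _ _ _ Qw Q0) eqxx (mE w w0 (HQ _ _ _ Qw Q0)).
    by case: ifP => // _; rewrite divr_ge0 ?ler0n.
  have -> : \sum_(w | f w == f w0) (m u)%:R / (m w0)%:R = (m w0)%:R * ((m u)%:R / (m w0)%:R) :> rat.
    rewrite sumr_const -[LHS]mulr_natl; congr (_%:R * _).
    by rewrite /m; apply: eq_card => w; rewrite !inE.
  by rewrite mulrCA mulfV ?mulr1 // gt_eqF.
rewrite -(ler_nat rat) (cardE1 P).
suff : 2 * \sum_u \sum_(w | P u w) 1 <=
    #|[set p : T * T | f p.1 == f p.2]|%:R + #|[set p : T * T | f p.1 == f p.2]|%:R :> rat.
  by rewrite -mulr2n -[leRHS]mulr_natl ler_pM2l.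
apply: le_trans (lerD (bound P P1) (bound (fun w u => P u w) _)); last first.
  by move=> w u u' h h'; exact: (P2 _ _ _ h h').
have -> : \sum_u \sum_(w | P w u) (m u)%:R / (m w)%:R =
    \sum_u \sum_(w | P u w) (m w)%:R / (m u)%:R :> rat.
  rewrite [LHS](exchange_big_dep xpredT) //=.
rewrite -big_split big_distrr /=; apply: ler_sum => u _.
rewrite -big_split big_distrr /=; apply: ler_sum => w _.
have := m0 u; have := m0 w; move: (m u)%:R (m w)%:R => a b b0 a0.
rewrite mulr1 -(ler_pM2r (mulr_gt0 a0 b0)) [leRHS]mulrDl.
have -> : a / b * (a * b) = a ^+ 2 by field; rewrite gt_eqF.
have -> : b / a * (a * b) = b ^+ 2 by field; rewrite gt_eqF.
by have := sqr_ge0 (a - b); rewrite sqrrB; lra.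
Qed.

Lemma big_digits (R : zmodType) (N A B : nat) (F : nat -> R) : N = (A * B)%N ->
  \sum_(x < N) F x = \sum_(c < A) \sum_(x < B) F (c + A * x)%N.
Proof.
move=> ->; elim: B => [|B IH].
  by rewrite muln0 big_ord0 big1 // => c _; rewrite big_ord0.
rewrite mulnSr big_split_ord /= IH.
under [in RHS]eq_bigr do rewrite big_ord_recr.
by rewrite big_split /=; congr (_ + _); apply: eq_bigr => c _; rewrite addnC.
Qed.

Lemma psum_shift (I : finType) (z : I -> int) (b : int) (j : nat) :
  \sum_i (z i + b) ^+ j = \sum_(l < j.+1) (b ^+ (j - l) *+ 'C(j, l)) * \sum_i z i ^+ l.
Proof.
under [RHS]eq_bigr do rewrite big_distrr /=.
rewrite exchange_big; apply: eq_bigr => i _; rewrite addrC exprDn.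
by apply: eq_bigr => l _; rewrite mulrnAl.
Qed.

(** Vinogradov's [J_{n,k}(q^t)], with [n] variables on each side. *)
Definition vcount (q k n t : nat) : nat :=
  #|[set p : {ffun 'I_n -> 'I_(q ^ t)} * {ffun 'I_n -> 'I_(q ^ t)} |
     [forall j : 'I_k, (\sum_i p.1 i ^ j.+1 == \sum_i p.2 i ^ j.+1)%N]]|.

(** Translation-dilation invariance: since [Q z = (a + Q z) - a], the binomial theorem expresses the
    power sums of [Q z] through those of [a + Q z] of no larger degree. *)
Lemma psum_eq_translate (k n : nat) (a Q : nat) (x y : 'I_n -> nat) : (0 < Q)%N ->
  (forall j, (0 < j <= k)%N ->
     (\sum_i (a + Q * x i) ^ j = \sum_i (a + Q * y i) ^ j)%N) ->
  forall j, (0 < j <= k)%N -> (\sum_i x i ^ j = \sum_i y i ^ j)%N.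
Proof.
move=> Q0 H j jk.
have toZ (z : 'I_n -> nat) l : (\sum_i z i ^ l)%N%:Z = \sum_i (z i)%:Z ^+ l.
  by rewrite (big_morph Posz PoszD (erefl _)); apply: eq_bigr => i _; rewrite PoszX.
have scale (z : 'I_n -> nat) : Q%:Z ^+ j * \sum_i (z i)%:Z ^+ j =
    \sum_(l < j.+1) ((- a%:Z) ^+ (j - l) *+ 'C(j, l)) * \sum_i (a + Q * z i)%N%:Z ^+ l.
  rewrite -psum_shift big_distrr /=; apply: eq_bigr => i _.
  by rewrite -exprMn PoszD PoszM [a%:Z + _]addrC addrK.
have QZ : Q%:Z ^+ j != 0 by rewrite expf_neq0 // -lt0n.
suff /eqP : (\sum_i x i ^ j)%N%:Z = (\sum_i y i ^ j)%N%:Z by rewrite eqz_nat => /eqP.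
rewrite !toZ; apply: (mulfI QZ); rewrite !scale; apply: eq_bigr => l _; congr (_ * _).
have [->|l0] := posnP l; first by apply: eq_bigr => i _; rewrite !expr0.
rewrite -!toZ H // l0 /=; have := ltn_ord l; case/andP: jk; lia.
Qed.

(** * Linnik's [p]-adic recursion for the number of solutions *)

Section MeanValueStep.
Variables (R : realType) (q k s t h : nat).
Hypotheses (qp : prime q) (k0 : (0 < k)%N) (s0 : (0 < s)%N).
Hypotheses (kt : (k <= t)%N) (ht : (h <= t)%N) (thk : (t <= h * k)%N).

Let n := (s + k)%N.
(* [M] exceeds all power sums involved, so congruence modulo [M] is equality. *)
Let M := (n * q ^ (t * k)).+1.
Let qn0 e : (0 < q ^ e)%N. Proof. by rewrite expn_gt0 prime_gt0. Qed.

Let chi (v : {ffun 'I_k -> 'I_M}) (x : 'I_k -> nat) : R[i] :=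
  e1 (\sum_j M%:R^-1 * (v j)%:R * (x j)%:R).
Let S v c e : R[i] := \sum_(x < q ^ (t - e)) chi v (fun j => (c + q ^ e * x) ^ j.+1)%N.

Lemma chi_prod v N (I : finType) (f : I -> nat -> nat) :
  \prod_i \sum_(x < N) chi v (fun j => f i x ^ j.+1)%N =
  \sum_(x : {ffun I -> 'I_N}) chi v (fun j => \sum_i f i (x i) ^ j.+1)%N.
Proof.
rewrite bigA_distr_bigA; apply: eq_bigr => x _; rewrite -e1_sum /chi; congr e1.
by rewrite exchange_big; apply: eq_bigr => j _; rewrite natr_sum big_distrr.
Qed.

Lemma chi_pow v N m (f : nat -> nat) :
  (\sum_(x < N) chi v (fun j => f x ^ j.+1)%N) ^+ m =
  \sum_(x : {ffun 'I_m -> 'I_N}) chi v (fun j => \sum_i f (x i) ^ j.+1)%N.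
Proof. by rewrite -(chi_prod v N (fun (_ : 'I_m) x => f x)) prodr_const card_ord. Qed.

Lemma S_pow v c e m : normc (S v c e) ^+ (2 * m) = normc (
  \sum_(x : {ffun 'I_m -> 'I_(q ^ (t - e))})
     chi v (fun j => \sum_i (c + q ^ e * x i) ^ j.+1)%N) ^+ 2.
Proof. by rewrite mulnC exprM -normcX /S (chi_pow v _ m (fun x => (c + q ^ e * x)%N)). Qed.

Lemma chi_split v e : (e <= t)%N ->
  S v 0 0 = \sum_(c < q ^ e) S v c e.
Proof.
move=> et; have qE : (q ^ (t - 0) = q ^ e * q ^ (t - e))%N by rewrite -expnD subn0 subnKC.
rewrite /S (big_digits (fun x => chi v (fun j => (0 + q ^ 0 * x) ^ j.+1)%N) qE).
apply: eq_bigr => c _; apply: eq_bigr => x _; rewrite /chi; congr e1.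
by apply: eq_bigr => j _; rewrite expn0 mul1n add0n.
Qed.

Lemma digit_bound c e (x : 'I_(q ^ (t - e))) (j : 'I_k) : (e <= t)%N -> (c < q ^ e)%N ->
  ((c + q ^ e * x) ^ j.+1 <= q ^ (t * k))%N.
Proof.
move=> et ce; rewrite expnM; apply: (@leq_trans ((q ^ t) ^ j.+1)).
  have qE : (q ^ t = q ^ e * q ^ (t - e))%N by rewrite -expnD subnKC.
  rewrite leq_exp2r // qE.
  have xl := ltn_ord x; have {}xl : (x.+1 <= q ^ (t - e))%N by [].
  apply: leq_trans (_ : (q ^ e * x.+1 <= _)%N); last by rewrite leq_mul2l xl orbT.
  by rewrite mulnS leq_add2r ltnW.
by rewrite leq_pexp2l // ltn_ord.
Qed.

(** By translation and dilation, a class modulo [q^e] has no larger moment than a full range of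
    length [q^(t - e)]. *)
Lemma mean_pow c e m : (e <= t)%N -> (c < q ^ e)%N -> (m <= n)%N ->
  \sum_v normc (S v c e) ^+ (2 * m) <= (M ^ k)%:R * (vcount q k m (t - e))%:R.
Proof.
move=> et ce mn.
under eq_bigr do rewrite S_pow.
rewrite (@grid_mean R {ffun 'I_m -> 'I_(q ^ (t - e))} k M
  (fun x j => \sum_(i < m) (c + q ^ e * x i) ^ j.+1)%N) //; last first.
  move=> x j; rewrite ltnS; apply: leq_trans (_ : (m * q ^ (t * k) <= _)%N); last first.
    by rewrite leq_mul2r mn orbT.
  rewrite -[m in (m * _)%N]card_ord -sum_nat_const; apply: leq_sum => i _.
  exact: digit_bound.
apply: ler_wpM2l; first exact: ler0n.
rewrite ler_nat /vcount; apply: subset_leq_card; apply/fintype.subsetP => -[x y]; rewrite !inE /=.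
move=> /forallP H; apply/forallP => j; apply/eqP.
apply: (@psum_eq_translate k m c (q ^ e)); rewrite ?ltn_ord // => l /andP[l0 lk].
have lk' : (l.-1 < k)%N by lia.
by have /eqP := H (Ordinal lk'); rewrite /= prednK.
Qed.

Lemma vcount_mean : (M ^ k)%:R * (vcount q k n t)%:R =
  \sum_v normc (S v 0 0) ^+ (2 * n).
Proof.
under eq_bigr do rewrite S_pow.
rewrite (@grid_mean R {ffun 'I_n -> 'I_(q ^ (t - 0))} k M
  (fun x j => \sum_(i < n) (0 + q ^ 0 * x i) ^ j.+1)%N) //; last first.
  move=> x j; rewrite ltnS.
  rewrite -[n in (n * _)%N]card_ord -sum_nat_const; apply: leq_sum => i _.
  by apply: digit_bound => //; rewrite expn0.
congr (_ * _%:R); rewrite /vcount subn0; apply: eq_card => p; rewrite !inE.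
apply: eq_forallb => j; rewrite expn0.
by congr (_ == _); apply: eq_bigr => i _; rewrite mul1n add0n.
Qed.

Let phi (c : 'I_k -> nat) (a : nat)
    (p : {ffun 'I_k -> 'I_(q ^ (t - k))} * {ffun 'I_s -> 'I_(q ^ (t - h))}) (j : 'I_k) : nat :=
  (\sum_i (c i + q ^ k * p.1 i) ^ j.+1 + \sum_i (a + q ^ h * p.2 i) ^ j.+1)%N.

Lemma mixed_mean (c : {ffun 'I_k -> 'I_(q ^ k)}) (a : 'I_(q ^ h)) :
  \sum_v (\prod_i normc (S v (c i) k) ^+ 2) * normc (S v a h) ^+ (2 * s) =
  (M ^ k)%:R * #|[set p | [forall j, phi (fun i => c i) a p.1 j == phi (fun i => c i) a p.2 j]]|%:R.
Proof.
rewrite -grid_mean //; last first.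
  move=> p j; rewrite ltnS /phi.
  rewrite addnC mulnDl leq_add //.
    rewrite -[s in (s * _)%N]card_ord -sum_nat_const; apply: leq_sum => i _.
    exact: digit_bound.
  rewrite -[X in (X * q ^ _)%N]card_ord -sum_nat_const; apply: leq_sum => i _.
  exact: digit_bound.
apply: eq_bigr => v _.
rewrite S_pow prodrXl -exprMn -normc_prod -normcM /S.
rewrite (chi_prod v _ (fun i x => (c i + q ^ k * x)%N)) big_distrl /=.
under eq_bigr do rewrite big_distrr.
rewrite /= pair_bigA /=.
congr (normc _ ^+ 2); apply: eq_bigr => p _; rewrite /chi -e1D; congr e1.
by rewrite -big_split /=; apply: eq_bigr => j _; rewrite -mulrDr natrD.
Qed.

(** After translation by [a] the variables of the second kind are multiples of [q^h], so the power
    sums of [x] and [y] agree modulo [q^(h j)] in degree [j]. For each [y], [card_psum_cong] bounds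
    the number of [x]; for each pair [x], [y] the remaining variables have prescribed differences of
    power sums, which [card_shifted_le] compares with the homogeneous system. *)
Lemma mixed_count (c : {ffun 'I_k -> 'I_(q ^ k)}) (a : 'I_(q ^ h)) : injective c ->
  (#|[set p | [forall j, phi (fun i => c i) a p.1 j == phi (fun i => c i) a p.2 j]]| <=
   q ^ ((t - k) * k) * q ^ (h * 'C(k, 2) + 2 * k ^ 3) * vcount q k s (t - h))%N.
Proof.
move=> cinj.
pose TX := {ffun 'I_k -> 'I_(q ^ (t - k))}.
pose Z (x : TX) (j : nat) : int := \sum_i ((c i + q ^ k * x i)%N%:Z - a%:Z) ^+ j.
pose good (y : TX) := [set x : TX |
   [forall j : 'I_k, ((q ^ (h * j.+1))%N%:Z %| (Z x j.+1 - Z y j.+1)%R)%Z]].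
pose G := [set xy : TX * TX | xy.1 \in good xy.2].
have GB : (#|G| <= q ^ ((t - k) * k) * q ^ (h * 'C(k, 2) + 2 * k ^ 3))%N.
  have -> : (q ^ ((t - k) * k) = #|[set: TX]|)%N.
    by rewrite cardsT card_ffun !card_ord expnM.
  apply: (@card_le_fiber _ _ G snd) => [p|y _]; first by rewrite inE.
  have cm i j : i != j -> c i != c j %[mod q ^ k].
    move=> ij; rewrite !modn_small //; apply: contra ij => /eqP ij.
    by apply/eqP/cinj/val_inj.
  apply: leq_trans (card_psum_cong a (fun j => Z y j.+1) qp k0 kt thk cm).
  rewrite -(card_in_imset (f := fst)).
    apply: subset_leq_card; apply/fintype.subsetP => x /imsetP[[x' y']].
    by rewrite !inE => /andP[/= H /eqP <-] ->.
  move=> [x1 y1] [x2 y2]; rewrite !inE /= => /andP[_ /eqP ->] /andP[_ /eqP ->].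
  by move=> ->.
apply: leq_trans (_ : (#|G| * vcount q k s (t - h) <= _)%N); last by rewrite leq_mul2r GB orbT.
have key p : (forall j, phi (fun i => c i) a p.1 j = phi (fun i => c i) a p.2 j) ->
   forall j, (0 < j <= k)%N ->
   Z p.1.1 j - Z p.2.1 j =
     (q ^ (h * j))%N%:Z * (\sum_i (p.2.2 i)%:Z ^+ j - \sum_i (p.1.2 i)%:Z ^+ j).
  move=> H j jk.
  pose U (r : TX * {ffun 'I_s -> 'I_(q ^ (t - h))}) (l : nat) : int :=
    \sum_i (c i + q ^ k * r.1 i)%N%:Z ^+ l + \sum_i (a + q ^ h * r.2 i)%N%:Z ^+ l.
  have UU l : (l <= k)%N -> U p.1 l = U p.2 l.
    case: l => [|l] lk.
      by congr (_ + _); apply: eq_bigr => i _; rewrite !expr0.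
    have UE r : U r l.+1 = (phi (fun i => c i) a r (Ordinal lk))%:Z.
      rewrite PoszD !(big_morph Posz PoszD (erefl _)).
      by congr (_ + _); apply: eq_bigr => i _; rewrite PoszX.
    by rewrite !UE H.
  have ZU (r : TX * {ffun 'I_s -> 'I_(q ^ (t - h))}) : Z r.1 j + (q ^ (h * j))%N%:Z * \sum_i (r.2 i)%:Z ^+ j =
      \sum_(l < j.+1) ((- a%:Z) ^+ (j - l) *+ 'C(j, l)) * U r l.
    under [RHS]eq_bigr do rewrite /U mulrDr.
    rewrite big_split -!psum_shift /=; congr (_ + _); rewrite big_distrr.
    apply: eq_bigr => i _; rewrite PoszD PoszM [a%:Z + _]addrC addrK exprMn.
    by rewrite !PoszX exprM.
  have : Z p.1.1 j + (q ^ (h * j))%N%:Z * \sum_i (p.1.2 i)%:Z ^+ j =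
         Z p.2.1 j + (q ^ (h * j))%N%:Z * \sum_i (p.2.2 i)%:Z ^+ j.
    rewrite !ZU; apply: eq_bigr => l _; rewrite UU //.
    by have := ltn_ord l; case/andP: jk; lia.
  by rewrite mulrBr => /eqP; rewrite addrC -subr_eq => /eqP <-; ring.
apply: (@card_le_fiber _ _ _ (fun p => (p.1.1, p.2.1)) G) => [p|[x y] _].
  rewrite !inE /= => /forallP H; apply/forallP => j.
  rewrite (key p) ?ltn_ord // ?dvdz_mulr // => l.
  by apply/eqP.
pose ps (u : {ffun 'I_s -> 'I_(q ^ (t - h))}) : {ffun 'I_k -> int} :=
  [ffun j : 'I_k => \sum_i (u i)%:Z ^+ j.+1].
pose P (u w : {ffun 'I_s -> 'I_(q ^ (t - h))}) :=
  [forall j : 'I_k, Z x j.+1 - Z y j.+1 == (q ^ (h * j.+1))%N%:Z * (ps w j - ps u j)].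
have PD u w u' w' : P u w -> P u' w' -> forall j, ps w j - ps u j = ps w' j - ps u' j.
  move=> /forallP H /forallP H' j; have := H j; rewrite (eqP (H' j)) => /eqP.
  have Q0 : (q ^ (h * j.+1))%N%:Z != 0 by rewrite -lt0n.
  by move/(mulfI Q0).
apply: leq_trans (leq_trans (card_shifted_le (P := P) (f := ps) _ _) _).
- rewrite -(card_in_imset (f := fun p => (p.1.2, p.2.2))).
    apply: subset_leq_card; apply/fintype.subsetP => p /imsetP[r].
    rewrite !inE => /andP[/forallP H /eqP[E1 E2]] -> /=.
    apply/forallP => j; rewrite !ffunE -E1 -E2; apply/eqP/key.
      by move=> l; apply/eqP.
    by rewrite /= ltn_ord.
  move=> [[x1 u1] [y1 w1]] [[x2 u2] [y2 w2]].
  by rewrite !inE /= => /andP[_ /eqP[-> ->]] /andP[_ /eqP[-> ->]] [-> ->].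
- move=> u w w' Pw Pw'; apply/ffunP => j.
  by have /(congr1 (fun z => z + ps u j)) := PD _ _ _ _ Pw Pw' j; rewrite !subrK.
- move=> u u' w Pu Pu'; apply/ffunP => j.
  by have /addrI/oppr_inj := PD _ _ _ _ Pu Pu' j.
apply: subset_leq_card; apply/fintype.subsetP => -[u w]; rewrite !inE /= => /eqP E.
apply/forallP => j; have /ffunP/(_ j) := E; rewrite !ffunE => Ej.
suff /eqP : (\sum_i u i ^ j.+1)%N%:Z = (\sum_i w i ^ j.+1)%N%:Z by rewrite eqz_nat.
rewrite !(big_morph Posz PoszD (erefl _)).
by under eq_bigr do rewrite PoszX; under [RHS]eq_bigr do rewrite PoszX.
Qed.

(** The first term, from [k] distinct classes, drops [k] variables and shortens the range by [q^h];
    the second, from one dominant class, keeps all variables and shortens the range by [q^k]. *)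
Theorem vcount_step :
  (vcount q k n t)%:R <= (2 * (q ^ k)%:R) ^+ (2 * k) * (q ^ k)%:R ^+ k * (q ^ h)%:R ^+ (2 * s) *
     (q ^ ((t - k) * k) * q ^ (h * 'C(k, 2) + 2 * k ^ 3) * vcount q k s (t - h))%:R
   + (2 * k%:R) ^+ (2 * n) * (q ^ k)%:R * (vcount q k n (t - k))%:R :> R.
Proof.
have Mk0 : 0 < (M ^ k)%:R :> R by rewrite ltr0n expn_gt0.
rewrite -(ler_pM2l Mk0) vcount_mean.
have pt v : normc (S v 0 0) ^+ (2 * n) <= (2 * (q ^ k)%:R) ^+ (2 * k) * (q ^ h)%:R ^+ (2 * s).-1 *
     (\sum_(c : {ffun 'I_k -> 'I_(q ^ k)} | injectiveb c) \sum_(a < q ^ h)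
         (\prod_i normc (S v (c i) k) ^+ 2) * normc (S v a h) ^+ (2 * s)) +
     (2 * k%:R) ^+ (2 * n) * \sum_(c < q ^ k) normc (S v c k) ^+ (2 * n).
  apply: (class_decomposition (x := fun c : 'I_(q ^ k) => normc (S v c k))
    (z := fun a : 'I_(q ^ h) => normc (S v a h))) => //.
  - by move=> c; exact: normc_ge0.
  - by move=> c; exact: normc_ge0.
  - exact: normc_ge0.
  - by rewrite (chi_split v kt); exact: normc_sum.
  - by rewrite (chi_split v ht); exact: normc_sum.
apply: le_trans (ler_sum _ (fun v _ => pt v)) _.
rewrite big_split -!big_distrr /= mulrDr; apply: lerD.
  rewrite exchange_big; under eq_bigr do rewrite exchange_big.
  under eq_bigr do under eq_bigr do rewrite mixed_mean.
  set B := (_ * _ * vcount q k s (t - h))%N.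
  have mixB : \sum_(c : {ffun 'I_k -> 'I_(q ^ k)} | injectiveb c) \sum_(a < q ^ h)
     (M ^ k)%:R * (#|[set p | [forall j, phi (fun i => c i) a p.1 j == phi (fun i => c i) a p.2 j]]|)%:R
     <= (q ^ k)%:R ^+ k * ((q ^ h)%:R * ((M ^ k)%:R * B%:R)) :> R.
    have -> : (q ^ k)%:R ^+ k * ((q ^ h)%:R * ((M ^ k)%:R * B%:R)) =
       \sum_(c : {ffun 'I_k -> 'I_(q ^ k)}) \sum_(a < q ^ h) (M ^ k)%:R * B%:R :> R.
      rewrite !sumr_const card_ffun !card_ord.
      by rewrite -[RHS]mulr_natl -[in RHS](mulr_natl ((M ^ k)%:R * B%:R)) -(natrX _ (q ^ k)).
    rewrite [leRHS](bigID (fun c : {ffun 'I_k -> 'I_(q ^ k)} => injectiveb c)) /= -[leLHS]addr0.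
    apply: lerD; last by apply: sumr_ge0 => c _; apply: sumr_ge0 => a _; rewrite mulr_ge0.
    apply: ler_sum => c /injectiveP cinj; apply: ler_sum => a _.
    by rewrite ler_pM2l // ler_nat; apply: mixed_count.
  apply: le_trans (ler_wpM2l _ mixB) _; first by rewrite mulr_ge0 ?exprn_ge0 ?mulr_ge0 ?ler0n.
  have -> : (q ^ h)%:R ^+ (2 * s) = (q ^ h)%:R ^+ (2 * s).-1 * (q ^ h)%:R :> R.
    by rewrite -exprSr prednK // muln_gt0.
  by rewrite le_eqVlt; apply/orP; left; apply/eqP; ring.
rewrite exchange_big /=.
have mB (c : 'I_(q ^ k)) : true -> \sum_v normc (S v c k) ^+ (2 * n) <=
    (M ^ k)%:R * (vcount q k n (t - k))%:R by move=> _; exact: mean_pow.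
apply: le_trans (ler_wpM2l _ (ler_sum _ mB)) _; first by rewrite exprn_ge0 ?mulr_ge0 ?ler0n.
rewrite sumr_const card_ord -[X in _ * X]mulr_natl.
by rewrite le_eqVlt; apply/orP; left; apply/eqP; ring.
Qed.

End MeanValueStep.

Lemma ceil_div_bounds n d : (0 < d)%N -> (n <= d * ((n + d.-1) %/ d) <= n + d)%N.
Proof.
move=> d0; have := divn_eq (n + d.-1) d; have := ltn_pmod (n + d.-1) d0.
by rewrite mulnC; move: (_ * _)%N (_ %% _)%N => x y; lia.
Qed.

Lemma vcount_trivial (q k n t : nat) : (vcount q k n t <= q ^ (2 * n * t))%N.
Proof.
apply: leq_trans (max_card _) _.
rewrite card_prod card_ffun !card_ord -!expnM -expnD leq_eqVlt; apply/orP; left.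
by apply/eqP; congr (_ ^ _)%N; lia.
Qed.

(** * Solution of the recursion *)

Section MeanValueBound.
Variables (R : realType) (q k : nat).
Hypotheses (qp : prime q) (k2 : (2 <= k)%N) (kq : (4 * k ^ 2 <= q ^ k)%N).

(* [kap - eta i] is the saving over the trivial exponent [2 n t] after [i] steps. *)
Definition kap : R := k%:R * (k%:R + 1) / 2.
Definition eta (i : nat) : R := kap * (1 - k%:R^-1) ^+ i.

Let K : R := k%:R.
Let K2 : 2 <= K. Proof. by rewrite /K ler_nat. Qed.
Let B : R := q%:R.
Let B2 : 2 <= B. Proof. by rewrite ler_nat prime_gt1. Qed.
Let B0 : 0 < B. Proof. by apply: lt_le_trans B2. Qed.

Lemma kap_ge0 : 0 <= kap.
Proof. by rewrite /kap -/K; have := K2; nra. Qed.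

Lemma kap_le : kap <= K ^+ 2.
Proof. by rewrite /kap -/K; have := K2; nra. Qed.

Lemma eta_bounds i : 0 <= eta i <= kap.
Proof.
have h0 : 0 <= K^-1 <= 1.
  by rewrite invr_ge0 ler0n invf_le1 ?ltr0n ?(ltnW k2) // ler1n (ltnW k2).
have h1 : 0 <= 1 - K^-1 <= 1 by lra.
rewrite /eta -/K mulr_ge0 ?kap_ge0 ?exprn_ge0 //=; last by lra.
rewrite -[leRHS]mulr1 ler_wpM2l ?kap_ge0 // exprn_ile1 //; lra.
Qed.

Let powB x y : x <= y -> B `^ x <= B `^ y.
Proof. by apply: ler_powR; have := B2; lra. Qed.

Let powBn n : (q ^ n)%:R = B `^ n%:R.
Proof. by rewrite powR_mulrn ?natrX // ltW. Qed.

Let BD x y : B `^ x * B `^ y = B `^ (x + y).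
Proof. by rewrite powRD //; apply/implyP => _; rewrite gt_eqF. Qed.

Let BX x n : (B `^ x) ^+ n = B `^ (n%:R * x).
Proof. by rewrite -powR_mulrn ?powR_ge0 // -powRrM mulrC. Qed.

Let half_sum (a b E : R) : a <= B `^ (E - 1) -> b <= B `^ (E - 1) -> a + b <= B `^ E.
Proof.
have -> : B `^ E = B `^ (E - 1) * B.
  by rewrite -[X in _ * X]powRr1 ?(ltW B0) // BD subrK.
by have := powR_ge0 B (E - 1); have := B2; nra.
Qed.

(** Induction on [i] treats the first term of [vcount_step]; for fixed [i], strong induction on [t]
    treats the second, where the number of variables is unchanged. The term [8 K^3 i] collects the
    constant losses. *)
Lemma vcount_bound i t : (vcount q k (k ^ 2 + i * k) t)%:R <=
  B `^ (8 * K ^+ 3 * i%:R + (2 * (k ^ 2 + i * k)%:R - kap + eta i) * t%:R).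
Proof.
elim: i t => [|i IHi] t.
  rewrite mulr0 add0r /eta expr0 mulr1 subrK -!natrM -powBn ler_nat.
  exact: vcount_trivial.
have /andP[eta0 etak] := eta_bounds i; have /andP[eta0' etak'] := eta_bounds i.+1.
have kapk := kap_le; have kap0 := kap_ge0.
elim/ltn_ind: t => t IHt.
set s := (k ^ 2 + i * k)%N in IHi *.
have nE : (k ^ 2 + i.+1 * k = s + k)%N by rewrite /s mulSn [(k + i * k)%N]addnC addnA.
rewrite nE in IHt *; set n := (s + k)%N in IHt *.
have [tk|kt] := ltnP t k.
  apply: le_trans (_ : (q ^ (2 * n * t))%:R <= _); first by rewrite ler_nat vcount_trivial.
  rewrite powBn; apply: powB; rewrite !natrM.
  have tK : t%:R <= K by rewrite ler_nat ltnW.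
  have i1 : 1 <= i.+1%:R :> R by rewrite ler1n.
  have : (kap - eta i.+1) * t%:R <= K ^+ 2 * K.
    by apply: ler_pM => //; [lra | lra].
  have K3 : 0 <= K ^+ 3 by rewrite exprn_ge0 // ler0n.
  have : 8 * K ^+ 3 * 1 <= 8 * K ^+ 3 * i.+1%:R by apply: ler_wpM2l => //; lra.
  have -> : K ^+ 2 * K = K ^+ 3 by ring.
  by move=> h1 h2; lra.
pose h := ((t + k.-1) %/ k)%N.
have k0 : (0 < k)%N by exact: ltnW.
have thk : (t <= h * k)%N.
  by rewrite mulnC; case/andP: (ceil_div_bounds t k0).
have hkt : (h * k <= t + k.-1)%N by exact: leq_divM.
have ht : (h <= t)%N.
  by rewrite -ltnS ltn_divLR // mulSn addnC -addSn prednK // leq_add2l leq_pmulr.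
have s0 : (0 < s)%N by rewrite /s addn_gt0 expn_gt0 k0.
apply: le_trans (vcount_step R qp k0 s0 kt ht thk) _.
rewrite -/n; apply: half_sum.
  apply: le_trans (_ : B `^ (2 * K * (1 + K)) * B `^ (K * K) * B `^ (2 * s%:R * h%:R) *
     (B `^ ((t%:R - K) * K) * B `^ (h%:R * (K * (K - 1) / 2) + 2 * K ^+ 3) *
      B `^ (8 * K ^+ 3 * i%:R + (2 * s%:R - kap + eta i) * (t - h)%:R)) <= _).
    rewrite !natrM; apply: ler_pM.
    - by rewrite !mulr_ge0 ?exprn_ge0 ?mulr_ge0 ?ler0n.
    - by rewrite !mulr_ge0 ?ler0n.
    - apply: ler_pM; rewrite ?mulr_ge0 ?exprn_ge0 ?mulr_ge0 ?ler0n //; last first.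
        by rewrite powBn BX natrM.
      apply: ler_pM; rewrite ?exprn_ge0 ?mulr_ge0 ?ler0n //; last by rewrite powBn BX.
      apply: le_trans (_ : (B `^ (1 + K)) ^+ (2 * k) <= _); last by rewrite BX natrM.
      rewrite lerXn2r ?nnegrE ?powR_ge0 ?mulr_ge0 ?ler0n //.
      by rewrite -BD powRr1 ?(ltW B0) // powBn ler_wpM2r ?powR_ge0.
    - apply: ler_pM => //; rewrite ?mulr_ge0 ?ler0n //.
      rewrite !powBn natrD (natrM _ 2) natrX !natrM natrB //.
      have -> : 'C(k, 2)%:R = K * (K - 1) / 2.
        have := mul_bin_diag k 1; rewrite bin1 => /(congr1 (fun x => x%:R : R)).
        by rewrite !natrM -subn1 natrB // => ->; field.
      exact: lexx.
  rewrite !BD; apply: powB; rewrite natrB // /n natrD -/K.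
  have -> : eta i.+1 = eta i - eta i / K by rewrite /eta exprSr -/K; ring.
  have KN : K != 0 by rewrite gt_eqF // ltr0n.
  pose w := eta i / K.
  have Ew : eta i = w * K by rewrite /w divfK.
  have w0 : 0 <= w by rewrite divr_ge0 ?ler0n.
  have wK : w <= K by move: Ew; have := K2; nra.
  have hK : h%:R * K <= t%:R + K.
    by rewrite -natrM -natrD ler_nat; apply: leq_trans hkt _; rewrite leq_add2l leq_pred.
  (* Since [C(k,2) + kap = k^2] and the terms [2 s h] cancel, [h] occurs only in
     [h (k^2 - eta i) = h K (K - w)]. As [h k <= t + k], this is about [t (k - eta i / k)], and the
     recursion of [eta] follows. *)
  have hb : h%:R * K * (K - w) <= (t%:R + K) * (K - w).
    by apply: ler_wpM2r => //; rewrite subr_ge0.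
  rewrite -/w Ew -[i.+1]addn1 natrD.
  have K3 : 6 * K ^+ 3 - 3 * K ^+ 2 - 2 * K - 1 >= 0 by have := K2; nra.
  rewrite /kap -/K; nra.
have IH := IHt (t - k)%N; rewrite ltn_subLR // -{1}[t]add0n ltn_add2r k0 in IH.
apply: le_trans (_ : B `^ (K * n%:R) * B `^ K * B `^ (8 * K ^+ 3 * i.+1%:R +
       (2 * n%:R - kap + eta i.+1) * (t - k)%:R) <= _).
  apply: ler_pM; rewrite ?mulr_ge0 ?exprn_ge0 ?mulr_ge0 ?ler0n //; last exact: IH.
  apply: ler_pM; rewrite ?mulr_ge0 ?exprn_ge0 ?mulr_ge0 ?ler0n //; last by rewrite powBn.
  rewrite exprM [K * n%:R]mulrC -BX -(powBn k); rewrite lerXn2r ?nnegrE ?exprn_ge0 ?mulr_ge0 ?ler0n //.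
  have -> : (2 * K) ^+ 2 = (4 * k ^ 2)%:R by rewrite natrM natrX /K; ring.
  by rewrite ler_nat.
rewrite !BD; apply: powB; rewrite natrB // -/K.
(* Shortening the range by [q^k] gains [k (2 n - kap + eta i.+1)] in the exponent. This exceeds the
   loss [k n + k + 1] because [kap = k (k + 1) / 2] is at most [n / 2]; starting from [k^2]
   variables ensures this. *)
have nk : K ^+ 2 + K <= n%:R by rewrite /n /s -natrX -natrD ler_nat leq_add2r leq_addr.
have : K * (n%:R - kap - 1) >= K * (K ^+ 2 + K - kap - 1) by rewrite ler_wpM2l ?ler0n //; lra.
have : K * (K ^+ 2 + K - kap - 1) >= 1 by rewrite /kap -/K; have := K2; nra.
have : 0 <= K * eta i.+1 by rewrite mulr_ge0 ?ler0n.
move=> h1 h2 h3; nra.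
Qed.

End MeanValueBound.

(** * Bilinear exponential sums *)

Lemma cauchy_schwarz_sum (R : realFieldType) (I : finType) (P : pred I) (a b : I -> R) :
  (\sum_(i | P i) a i * b i) ^+ 2 <= (\sum_(i | P i) a i ^+ 2) * (\sum_(i | P i) b i ^+ 2).
Proof.
have E : \sum_(i | P i) \sum_(j | P j) (a i * b j - a j * b i) ^+ 2 =
   2 * ((\sum_(i | P i) a i ^+ 2) * (\sum_(i | P i) b i ^+ 2) - (\sum_(i | P i) a i * b i) ^+ 2).
  have E1 : \sum_(i | P i) \sum_(j | P j) a i ^+ 2 * b j ^+ 2 =
      (\sum_(i | P i) a i ^+ 2) * (\sum_(i | P i) b i ^+ 2).
    by rewrite big_distrl /=; apply: eq_bigr => i _; rewrite big_distrr.
  have E2 : \sum_(i | P i) \sum_(j | P j) a j ^+ 2 * b i ^+ 2 =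
      (\sum_(i | P i) a i ^+ 2) * (\sum_(i | P i) b i ^+ 2) by rewrite exchange_big.
  have E3 : \sum_(i | P i) \sum_(j | P j) (a i * b i) * (a j * b j) =
      (\sum_(i | P i) a i * b i) ^+ 2.
    by rewrite expr2 big_distrl /=; apply: eq_bigr => i _; rewrite big_distrr.
  rewrite mulr_natl mulr2n -{1}E1 -E2 -E3 addrACA -opprD -!big_split -sumrB /=.
  apply: eq_bigr => i _; rewrite -!big_split -sumrB /=.
  by apply: eq_bigr => j _; ring.
have : 0 <= \sum_(i | P i) \sum_(j | P j) (a i * b j - a j * b i) ^+ 2.
  by apply: sumr_ge0 => i _; apply: sumr_ge0 => j _; rewrite sqr_ge0.
by rewrite E pmulr_rge0 ?ltr0n // subr_ge0.
Qed.

Lemma unimodular (R : realType) (z : R[i]) :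
  exists2 xi : R[i], normc xi = 1 & xi * z = (normc z)%:C.
Proof.
have [->|z0] := eqVneq z 0.
  by exists 1; rewrite ?normc1 // mulr0 normc0.
have n0 : normc z != 0 by apply: contra z0 => /eqP/eq0_normc ->.
have nC : (normc z)%:C != 0 by apply: contra n0; rewrite eq_complex /= eqxx andbT.
exists (z^*%C / (normc z)%:C); last first.
  by rewrite mulrAC [_ * z]mulrC -normc_sqr expr2 rmorphM /= mulfK.
by rewrite normcM normcJ normcV normc_real ger0_norm ?normc_ge0 // divff.
Qed.

Section Bilinear.
Variables (R : realType) (q k l t : nat) (alpha : 'I_k -> R) (e : 'I_k -> nat).
Hypotheses (qp : prime q) (k0 : (0 < k)%N) (l0 : (0 < l)%N).
Hypothesis et : forall j : 'I_k, (e j <= t * j.+1)%N.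
Hypothesis alphaE : forall j, (0 < e j)%N ->
  exists2 A : int, ~~ (q %| A)%Z & alpha j = A%:~R / (q ^ e j)%:R.

Let P := (q ^ t)%N.
Let J := vcount q k l t.
Let V (j : 'I_k) := (l * q ^ (t * j.+1))%N.
(* [U j] bounds the number of multiples of [q ^ e j] in an interval of
   length [2 * V j]. *)
Let U (j : 'I_k) := (2 * l * q ^ (t * j.+1 - e j))%N.
Let W := (l * q ^ (t * k))%N.
Let qn0 n : (0 < q ^ n)%N. Proof. by rewrite expn_gt0 prime_gt0. Qed.
Let T := {ffun 'I_l -> 'I_(q ^ t)}.
Let psi (x : T) (j : 'I_k) : nat := (\sum_i x i ^ j.+1)%N.

Lemma psi_lt x j : (psi x j < V j)%N.
Proof.
rewrite /psi /V -[l in (l * _)%N]card_ord -sum_nat_const.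
rewrite (bigD1 (Ordinal l0)) //= [X in (_ < X)%N](bigD1 (Ordinal l0)) //= -addSn.
rewrite leq_add //; first by rewrite expnM ltn_exp2r.
by apply: leq_sum => i _; rewrite expnM leq_exp2r // ltnW.
Qed.

Lemma VW j : (V j <= W)%N.
Proof. by rewrite leq_mul2l leq_exp2l ?prime_gt1 // leq_mul2l ltn_ord !orbT. Qed.

(** At most [\prod_j U j] vectors of differences are admissible, and by [card_shifted_le] each is
    attained by at most [J] pairs. *)
Lemma psi_count_mod :
  (#|[set p : T * T | [forall j, ((q ^ e j)%N %| ((psi p.1 j)%:Z - (psi p.2 j)%:Z)%R)%Z]]| <=
   (\prod_j U j) * J)%N.
Proof.
pose TU := {dffun forall j : 'I_k, 'I_(U j)}.
pose N (p : T * T) j := (psi p.1 j + V j - psi p.2 j)%N.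
have NU p j : (N p j %/ q ^ e j < U j)%N.
  rewrite ltn_divLR // /U -mulnA -expnD subnK //.
  by have := psi_lt p.1 j; have := psi_lt p.2 j; rewrite /N /V; lia.
have -> : (\prod_j U j = #|[set: TU]|)%N.
  rewrite cardsT card_dep_ffun foldrE big_map big_enum /=.
  by apply: eq_bigr => j _; rewrite card_ord.
pose f p : TU := finfun (fun j => Ordinal (NU p j)).
apply: (@card_le_fiber _ _ _ f) => // u _.
have NZ p j : (N p j)%:Z = (psi p.1 j)%:Z + (V j)%:Z - (psi p.2 j)%:Z.
  by have := psi_lt p.1 j; have := psi_lt p.2 j; rewrite /N; lia.
pose Q x y := [forall j, N (x, y) j == (u j * q ^ e j)%N].
pose ps x : {ffun 'I_k -> int} := [ffun j => (psi x j)%:Z].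
apply: leq_trans (_ : (#|[set p : T * T | Q p.1 p.2]| <= _)%N).
  apply: subset_leq_card; apply/fintype.subsetP => p; rewrite !inE /Q.
  move=> /andP[/forallP H /eqP <-]; apply/forallP => j; rewrite ffunE /=.
  have {}H : (q ^ e j %| N (p.1, p.2) j)%N.
    have := H j; rewrite -[(_ %| N _ _)%N]/((q ^ e j)%N%:Z %| (N (p.1, p.2) j)%:Z)%Z NZ /=.
    rewrite addrAC => h; apply: rpredD => //; rewrite dvdzE !absz_nat dvdn_mull //.
    exact: dvdn_exp2l.
  by rewrite eq_sym; apply/eqP; exact: divnK.
apply: leq_trans (leq_trans (card_shifted_le (P := Q) (f := ps) _ _) _).
- exact: leqnn.
- move=> x y y' /forallP H /forallP H'; apply/ffunP => j; rewrite !ffunE.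
  have := NZ (x, y) j; have := NZ (x, y') j; rewrite (eqP (H j)) (eqP (H' j)) /=; lia.
- move=> x y y' /forallP H /forallP H'; apply/ffunP => j; rewrite !ffunE.
  have := NZ (x, y') j; have := NZ (y, y') j; rewrite (eqP (H j)) (eqP (H' j)) /=; lia.
apply: subset_leq_card; apply/fintype.subsetP => p; rewrite !inE => /eqP/ffunP E.
by apply/forallP => j; have := E j; rewrite !ffunE => /eqP; rewrite eqz_nat.
Qed.

Let Tv (xi : 'I_(q ^ t) -> R[i]) (v : 'I_k -> nat) : R[i] :=
  \sum_(y < q ^ t) xi y * e1 (\sum_j alpha j * (v j)%:R * (y ^ j.+1)%:R).

Lemma Tv_moment (xi : 'I_(q ^ t) -> R[i]) : (forall y, normc (xi y) = 1) ->
  \sum_(v in family (fun j => [pred w : 'I_W | (w < V j)%N])) normc (Tv xi (fun j => v j)) ^+ (2 * l)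
  <= (\prod_j V j)%:R * ((\prod_j U j) * J)%:R.
Proof.
move=> xi1.
have orth j (u : int) : ~~ ((q ^ e j)%N %| u)%Z ->
    \sum_(w < V j) e1 (alpha j * w%:R * u%:~R) = 0 :> R[i].
  have [->|ej] := posnP (e j); first by rewrite expn0 dvd1z.
  have [A qA ->] := alphaE ej.
  apply: sum_e1_eq0 => //; last by rewrite /V dvdn_mull // dvdn_exp2l.
  rewrite coprimez_sym coprimezE absz_nat coprimeXl // prime_coprime //.
have h := @sum_char_sqr_le R T k W V alpha psi (fun j => (q ^ e j)%N) VW orth
   (fun x => \prod_i xi (x i)) _.
apply: le_trans (_ : _ <= (\prod_j V j)%:R * _%:R) (ler_wpM2l (ler0n _ _) _); last first.
  by rewrite ler_nat; exact: psi_count_mod.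
apply: le_trans (h _); last first.
  by move=> x; rewrite normc_prod big1.
rewrite le_eqVlt; apply/orP; left; apply/eqP; apply: eq_bigr => v _.
rewrite mulnC exprM -normcX; congr (normc _ ^+ 2).
rewrite -[l in LHS]card_ord -prodr_const bigA_distr_bigA; apply: eq_bigr => x _.
rewrite big_split /= -e1_sum; congr (_ * e1 _).
rewrite exchange_big; apply: eq_bigr => j _; by rewrite /psi natr_sum big_distrr.
Qed.

(** Hoelder's inequality in [y] opens the inner sum into [l]-tuples of [z], which enter only through
    their power sums; a second Hoelder inequality over these tuples opens the sum over [y]. One
    factor [J] counts coincidences among the [z]-tuples, the other, with the [U j],
    near-coincidences among the [y]-tuples. *)
Theorem bilinear_sum_bound :
  normc (\sum_(y < q ^ t) \sum_(z < q ^ t) e1 (\sum_j alpha j * ((y * z) ^ j.+1)%:R) : R[i])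
    ^+ (2 * l ^ 2) <=
  (q ^ t)%:R ^+ (4 * (l * l.-1)) * J%:R ^+ 2 * (\prod_j V j)%:R * (\prod_j U j)%:R.
Proof.
pose Sy (y : 'I_(q ^ t)) : R[i] :=
  \sum_(z < q ^ t) e1 (\sum_j alpha j * ((y * z) ^ j.+1)%:R).
(* The unimodular [xi y] replaces [normc (Sy y) ^+ l] by [xi y * Sy y ^+ l], so that the tuples of
   [z] can be summed last. *)
have /boolp.choice[xi Hxi] y : exists xi : R[i], normc xi = 1 /\ xi * Sy y ^+ l = (normc (Sy y ^+ l))%:C.
  by have [xi h1 h2] := unimodular (Sy y ^+ l); exists xi.
have xi1 y : normc (xi y) = 1 by case: (Hxi y).
pose X := \sum_(z : T) normc (Tv xi (psi z)).
pose Y := \sum_(z : T) normc (Tv xi (psi z)) ^+ l.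
have X0 : 0 <= X by apply: sumr_ge0 => z _; exact: normc_ge0.
have Y0 : 0 <= Y by apply: sumr_ge0 => z _; rewrite exprn_ge0 ?normc_ge0.
have stepS : normc (\sum_y Sy y) ^+ l <= P%:R ^+ l.-1 * X.
  apply: le_trans (_ : (\sum_y normc (Sy y)) ^+ l <= _).
    rewrite lerXn2r ?nnegrE ?normc_ge0 ?normc_sum //.
    by apply: sumr_ge0 => y _; exact: normc_ge0.
  have := power_mean (I := 'I_(q ^ t)) l.-1 (fun y => normc_ge0 (Sy y)).
  rewrite prednK // card_ord => /le_trans; apply.
  apply: ler_wpM2l; first by rewrite exprn_ge0.
  have -> : \sum_i normc (Sy i) ^+ l = normc (\sum_y xi y * Sy y ^+ l).
    under [in RHS]eq_bigr do rewrite (proj2 (Hxi _)) normcX.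
    rewrite -rmorph_sum normc_real ger0_norm //.
    by apply: sumr_ge0 => y _; rewrite exprn_ge0 ?normc_ge0.
  have -> : \sum_y xi y * Sy y ^+ l = \sum_(z : T) Tv xi (psi z).
    rewrite /Tv exchange_big; apply: eq_bigr => y _; rewrite -big_distrr; congr (_ * _).
    rewrite -[l in LHS]card_ord -prodr_const bigA_distr_bigA; apply: eq_bigr => z _.
    rewrite -e1_sum; congr e1; rewrite exchange_big; apply: eq_bigr => j _.
    rewrite -big_distrr -mulrA -natrM /psi -natr_sum; congr (_ * _%:R).
    by rewrite big_distrl; apply: eq_bigr => i _; rewrite expnMn mulnC.
  exact: normc_sum.
have stepX : X ^+ l <= (P ^ l)%:R ^+ l.-1 * Y.
  have := power_mean (I := T) l.-1 (fun z => normc_ge0 (Tv xi (psi z))).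
  by rewrite prednK // card_ffun !card_ord.
(* Tuples are grouped by their power sum vector [v] with multiplicity [r v]; the squares of the
   multiplicities add up to [J], and the other Cauchy-Schwarz factor is extended to the whole
   box. *)
have stepY : Y ^+ 2 <= J%:R * ((\prod_j V j)%:R * ((\prod_j U j) * J)%:R).
  have psiW z j : (psi z j < W)%N := leq_trans (psi_lt z j) (VW j).
  pose vz (z : T) : {ffun 'I_k -> 'I_W} := [ffun j => Ordinal (psiW z j)].
  pose box := family (fun j => [pred w : 'I_W | (w < V j)%N]).
  have vbox z : vz z \in box by apply/familyP => j; rewrite inE ffunE /= psi_lt.
  pose r v : R := #|[set z | vz z == v]|%:R.
  have part (F : {ffun 'I_k -> 'I_W} -> R) : \sum_z F (vz z) = \sum_(v in box) r v * F v.
    rewrite (partition_big vz (mem box)) //=; apply: eq_bigr => v _.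
    rewrite (eq_bigr (fun=> F v)); last by move=> z /eqP ->.
    rewrite sumr_const -mulr_natl /r; congr (_%:R * _).
    by apply: eq_card => z; rewrite !inE.
  have TvE z : Tv xi (psi z) = Tv xi (fun j => vz z j).
    by apply: eq_bigr => y _; congr (_ * e1 _); apply: eq_bigr => j _; rewrite ffunE.
  have -> : Y = \sum_(v in box) r v * normc (Tv xi (fun j => v j)) ^+ l.
    by rewrite -part; apply: eq_bigr => z _; rewrite TvE.
  apply: le_trans (cauchy_schwarz_sum _ _ _) _.
  have -> : \sum_(v in box) r v ^+ 2 = J%:R.
    rewrite (eq_bigr (fun v => r v * r v)) // -part /r -natr_sum; congr _%:R.
    rewrite /J /vcount -sum1_card.
    under eq_bigr do rewrite -sum1_card.
    rewrite pair_big_dep; apply: eq_bigl => p; rewrite !inE /=.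
    apply/eqP/forallP => [/ffunP E j|E].
      by have := E j; rewrite !ffunE => /(congr1 val) /= e2; apply/eqP; rewrite /psi in e2.
    by apply/ffunP => j; rewrite !ffunE; apply/val_inj/esym/eqP/E.
  apply: ler_wpM2l => //; apply: le_trans (Tv_moment xi1).
  by rewrite le_eqVlt; apply/orP; left; apply/eqP; apply: eq_bigr => v _; rewrite -exprM mulnC.
have S0 : 0 <= normc (\sum_y Sy y) := normc_ge0 _.
have -> : (2 * l ^ 2 = l * (l * 2))%N by lia.
rewrite exprM; apply: le_trans (_ : (P%:R ^+ l.-1 * X) ^+ (l * 2) <= _).
  by rewrite lerXn2r ?nnegrE ?exprn_ge0 ?mulr_ge0 ?exprn_ge0.
rewrite exprMn [X ^+ _]exprM.
apply: le_trans (_ : (P%:R ^+ l.-1) ^+ (l * 2) * ((P ^ l)%:R ^+ l.-1 * Y) ^+ 2 <= _).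
  apply: ler_wpM2l; first by rewrite !exprn_ge0.
  by rewrite lerXn2r ?nnegrE ?exprn_ge0 ?mulr_ge0 ?exprn_ge0.
rewrite exprMn mulrA.
apply: le_trans (ler_wpM2l _ stepY) _; first by rewrite mulr_ge0 ?exprn_ge0.
rewrite natrX -!exprM -exprD natrM -/P.
have -> : (l.-1 * (l * 2) + l * l.-1 * 2 = 4 * (l * l.-1))%N by lia.
by rewrite le_eqVlt; apply/orP; left; apply/eqP; ring.
Qed.

End Bilinear.

Lemma bernoulli_ineq (R : realFieldType) (x : R) n : 0 <= x -> 1 + n%:R * x <= (1 + x) ^+ n.
Proof.
move=> x0; elim: n => [|n IH]; first by rewrite mul0r addr0 expr0.
rewrite exprS; apply: le_trans (_ : (1 + x) * (1 + n%:R * x) <= _).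
  rewrite -[n.+1]addn1 natrD.
  rewrite -subr_ge0.
  have -> : (1 + x) * (1 + n%:R * x) - (1 + (n%:R + 1) * x) = n%:R * x * x by ring.
  by rewrite !mulr_ge0 ?ler0n.
by apply: ler_wpM2l => //; lra.
Qed.

(** [(1 + 1/k)^k >= 2] by Bernoulli, and [(1 - 1/k) (1 + 1/k) <= 1]. *)
Lemma expr_1Binv_le (R : realFieldType) k : (0 < k)%N -> (1 - k%:R^-1) ^+ k <= 2^-1 :> R.
Proof.
move=> k0; have K0 : 0 < k%:R :> R by rewrite ltr0n.
have ki : 0 <= (k%:R^-1 : R) <= 1 by rewrite invr_ge0 ler0n invf_le1 // ler1n.
have h : 2 <= (1 + k%:R^-1) ^+ k :> R.
  have := @bernoulli_ineq R k%:R^-1 k; rewrite mulfV ?gt_eqF //; apply; lra.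
have h1 : (1 - k%:R^-1) ^+ k * (1 + k%:R^-1) ^+ k <= 1 :> R.
  rewrite -exprMn exprn_ile1 //.
    by rewrite mulr_ge0; lra.
  by rewrite -subr_sqr expr1n lerBlDr lerDl sqr_ge0.
have h2 : 0 <= (1 - k%:R^-1) ^+ k :> R by rewrite exprn_ge0; lra.
by nra.
Qed.

Lemma expn3_ge_sqr k : (4 <= k)%N -> (4 * k ^ 2 <= 3 ^ k)%N.
Proof.
elim: k => // k IH; rewrite leq_eqVlt => /orP[/eqP<- //|]; rewrite ltnS => k4.
have := IH k4; rewrite [(3 ^ k.+1)%N]expnS -!mulnn; nia.
Qed.

Section BilinearSaving.
Variables (R : realType) (q m b : nat).
Hypotheses (qp : prime q) (q3 : (3 <= q)%N) (m0 : (0 < m)%N).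
Let k := (8 * m)%N.
(* [8 * k] steps from [k ^ 2] variables, which makes [eta] negligible. *)
Let l := (9 * k ^ 2)%N.
Variables (alpha : 'I_k -> R) (e : 'I_k -> nat).
Hypothesis et : forall j : 'I_k, (e j <= b * j.+1)%N.
Hypothesis alphaE : forall j, (0 < e j)%N ->
  exists2 A : int, ~~ (q %| A)%Z & alpha j = A%:~R / (q ^ e j)%:R.
Hypothesis esum : (m ^ 2 * b <= \sum_j e j)%N.

Let B : R := q%:R.
Let B0 : 0 < B. Proof. by rewrite ltr0n prime_gt0. Qed.
Let B1 : 1 <= B. Proof. by rewrite ler1n prime_gt0. Qed.
Let powBn n : (q ^ n)%:R = B `^ n%:R.
Proof. by rewrite powR_mulrn ?natrX // ltW. Qed.
Let BD x y : B `^ x * B `^ y = B `^ (x + y).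
Proof. by rewrite powRD //; apply/implyP => _; rewrite gt_eqF. Qed.
Let BX x n : (B `^ x) ^+ n = B `^ (n%:R * x).
Proof. by rewrite -powR_mulrn ?powR_ge0 // -powRrM mulrC. Qed.

Let k8 : (8 <= k)%N. Proof. by rewrite /k; lia. Qed.
Let kq : (4 * k ^ 2 <= q ^ k)%N.
Proof.
apply: leq_trans (_ : (3 ^ k <= _)%N); first by apply: expn3_ge_sqr; have := k8; lia.
by rewrite leq_exp2r //; have := k8; lia.
Qed.

Let eta_small : eta R k (8 * k) <= (m ^ 2)%:R / 4.
Proof.
have k0 : (0 < k)%N by have := k8; lia.
rewrite /eta [(8 * k)%N]mulnC exprM.
have h := expr_1Binv_le R k0.
have kk : kap R k <= k%:R ^+ 2 by apply: kap_le; have := k8; lia.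
have kap0 := @kap_ge0 R k; have {}kap0 : 0 <= kap R k by apply: kap0; have := k8; lia.
have y0 : 0 <= (1 - k%:R^-1) ^+ k :> R.
  by rewrite exprn_ge0 // subr_ge0 invf_le1 ?ltr0n // ler1n.
apply: le_trans (_ : k%:R ^+ 2 * 2^-1 ^+ 8 <= _).
  apply: ler_pM => //; first by rewrite exprn_ge0.
  by rewrite lerXn2r // nnegrE //; lra.
rewrite /k natrM natrX le_eqVlt; apply/orP; left; apply/eqP; by field.
Qed.

Let sum_succ : (\sum_(j < k) j.+1)%:R = kap R k.
Proof.
have : (2 * \sum_(j < k) j.+1 = k * k.+1)%N.
  elim: (k) => [|n IH]; first by rewrite big_ord0.
  by rewrite big_ord_recr /= mulnDr IH; lia.
move/(congr1 (fun x => x%:R : R)); rewrite (natrM _ 2) (natrM _ k) -[k.+1]addn1 natrD /kap => h.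
by lra.
Qed.

(** In [J^2 \prod V \prod U] the contributions of [kap] cancel. There remain the saving [m^2 b] from
    [esum] and the loss [2 eta b <= m^2 b / 2]. The root of order [2 l^2 = 162 k^4] with [k = 8 m]
    turns the net [m^2 b / 2] into [b / (1152 m)^2], as [2 * 162 * 8^4 = 1152^2]. The [1] in the
    exponent absorbs the constants, which amount to [129 k^4]. *)
Theorem bilinear_saving :
  normc (\sum_(y < q ^ b) \sum_(z < q ^ b) e1 (\sum_j alpha j * ((y * z) ^ j.+1)%:R) : R[i])
  <= B `^ (2 * b%:R + 1 - b%:R / (1152 * m%:R) ^+ 2).
Proof.
set S := normc _.
have k0 : (0 < k)%N by have := k8; lia.
have l0 : (0 < l)%N by rewrite /l muln_gt0 expn_gt0 k0.
have l2 : (0 < 2 * l ^ 2)%N by rewrite muln_gt0 expn_gt0 l0.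
suff : S ^+ (2 * l ^ 2) <= (B `^ (2 * b%:R + 1 - b%:R / (1152 * m%:R) ^+ 2)) ^+ (2 * l ^ 2).
  by rewrite ler_pXn2r // nnegrE ?powR_ge0 ?normc_ge0.
apply: le_trans (bilinear_sum_bound qp k0 l0 et alphaE) _.
have VU : (\prod_(j < k) (l * q ^ (b * j.+1)))%:R * (\prod_(j < k) (2 * l * q ^ (b * j.+1 - e j)))%:R
   <= B `^ ((k ^ 4)%:R + 2 * b%:R * kap R k - (m ^ 2 * b)%:R) :> R.
  rewrite -natrM -big_split /=.
  have -> : (\prod_(j < k) (l * q ^ (b * j.+1) * (2 * l * q ^ (b * j.+1 - e j))) =
     (2 * l ^ 2) ^ k * q ^ (\sum_(j < k) (b * j.+1 + (b * j.+1 - e j))))%N.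
    rewrite expn_sum -[X in (_ ^ X * _)%N]card_ord -prod_nat_const -big_split.
    have X (u v w : nat) : (w * u * (2 * w * v) = 2 * w ^ 2 * (u * v))%N by rewrite -mulnn; ring.
    by apply: eq_bigr => j _; rewrite expnD X.
  have hk : ((2 * l ^ 2) ^ k <= q ^ (k ^ 4))%N.
    have h3 : (2 * l ^ 2 <= (q ^ k) ^ 3)%N.
      apply: leq_trans (_ : ((4 * k ^ 2) ^ 3 <= _)%N); last by rewrite leq_exp2r.
      have : (8 ^ 2 <= k ^ 2)%N by rewrite leq_exp2r.
      rewrite /l; move: (k ^ 2)%N => u u64.
      have -> : (2 * (9 * u) ^ 2 = 162 * u ^ 2)%N by rewrite expnMn mulnA.
      by rewrite expnMn [(u ^ 3)%N]expnS; move: (u ^ 2)%N => v; nia.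
    apply: leq_trans (_ : (((q ^ k) ^ 3) ^ k <= _)%N); first by rewrite leq_exp2r.
    rewrite -!expnM leq_exp2l ?prime_gt1 //.
    have := k8; move: (k) => n n8; nia.
  have eb : (\sum_(j < k) (b * j.+1 + (b * j.+1 - e j)) + \sum_j e j = 2 * b * \sum_(j < k) j.+1)%N.
    by rewrite -big_split big_distrr /=; apply: eq_bigr => j _; have := et j; lia.
  apply: le_trans (_ : (q ^ (k ^ 4))%:R * (q ^ \sum_(j < k) (b * j.+1 + (b * j.+1 - e j)))%:R <= _).
    by rewrite -natrM ler_nat leq_mul2r hk orbT.
  rewrite !powBn BD; apply: ler_powR => //.
  have := congr1 (fun x => x%:R : R) eb; rewrite /= natrD !natrM sum_succ.
  have : (m ^ 2 * b)%:R <= (\sum_j e j)%:R :> R by rewrite ler_nat.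
  by rewrite natrM; lra.
have k2 : (2 <= k)%N by have := k8; lia.
have Jb := @vcount_bound R q k qp k2 kq (8 * k) b.
have El : (k ^ 2 + 8 * k * k = l)%N by rewrite /l; lia.
rewrite El in Jb.
have J2 : (vcount q k l b)%:R ^+ 2 <= B `^ (8 * k%:R ^+ 3 * (8 * k)%:R +
    (2 * l%:R - kap R k + eta R k (8 * k)) * b%:R) ^+ 2.
  by rewrite lerXn2r ?nnegrE ?powR_ge0 ?ler0n.
rewrite -mulrA; apply: le_trans (ler_pM _ _ (ler_pM _ _ (lexx _) J2) VU) _;
  rewrite ?mulr_ge0 ?exprn_ge0 ?ler0n //.
rewrite powBn !BX !BD; apply: ler_powR => //.
have -> : 2%:R = 2 :> R by [].
have mb : eta R k (8 * k) * b%:R <= (m ^ 2)%:R / 4 * b%:R by rewrite ler_wpM2r.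
have lR : (2 * l ^ 2)%:R = 162 * (k ^ 4)%:R :> R.
  by rewrite /l -natrM; congr _%:R; rewrite expnMn -expnM; lia.
have -> : (2 * l ^ 2)%:R * (2 * b%:R + 1 - b%:R / (1152 * m%:R) ^+ 2) =
   (2 * l ^ 2)%:R * (2 * b%:R) + 162 * (k ^ 4)%:R - (m ^ 2 * b)%:R / 2 :> R.
  rewrite mulrBr mulrDr mulr1 lR; congr (_ - _).
  have mR : m%:R != 0 :> R by rewrite pnatr_eq0 -lt0n.
  by rewrite /k !(natrM, natrX); field.
have l1 : (l.-1)%:R = l%:R - 1 :> R by rewrite -subn1 natrB.
rewrite (natrM _ 4) (natrM _ l l.-1) (natrM _ 8 k) (natrM _ 2 (l ^ 2)) (natrX _ l 2) (natrX _ k 4).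
rewrite (natrM _ (m ^ 2) b) l1.
have l20 : 0 <= l%:R * l%:R * b%:R :> R by rewrite !mulr_ge0 ?ler0n.
have k4 : 0 <= k%:R ^+ 4 :> R by rewrite exprn_ge0 // ler0n.
have E : k%:R ^+ 3 * k%:R = k%:R ^+ 4 :> R by rewrite -exprSr.
move: mb k4 E; move: (eta R k (8 * k)) (kap R k) ((m ^ 2)%:R) (k%:R) (l%:R) (b%:R).
move=> y x u v w z mb v4 E; nra.
Qed.

End BilinearSaving.

(** * Exponential sums over intervals *)

Lemma shift_interval (R : realType) (F : nat -> R[i]) (a c s : nat) :
  (forall x, normc (F x) <= 1) ->
  normc (\sum_(a <= x < c) F x - \sum_(a <= x < c) F (x + s)%N) <= 2 * s%:R.
Proof.
move=> F1; have [ca|ac] := leqP c a.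
  by rewrite !big_geq // subr0 normc0 mulr_ge0 ?ler0n.
elim: s => [|s IH].
  under [X in _ - X]eq_bigr do rewrite addn0.
  by rewrite subrr normc0 mulr0.
have -> : \sum_(a <= x < c) F x - \sum_(a <= x < c) F (x + s.+1)%N =
  (\sum_(a <= x < c) F x - \sum_(a <= x < c) F (x + s)%N) + (F (a + s)%N - F (c + s)%N).
  rewrite -[LHS](subrKA (\sum_(a <= x < c) F (x + s)%N)); congr (_ + _).
  have := @telescope_sumr _ a c (fun x => - F (x + s)%N) (ltnW ac).
  rewrite opprK addrC => <-; rewrite -sumrB; apply: eq_bigr => x _.
  by rewrite addSnnS opprK addrC.
apply: le_trans (le_normcD _ _) _; rewrite -[s.+1]addn1 natrD mulrDr; apply: lerD => //.
apply: le_trans (le_normcD _ _) _; rewrite normcN.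
by have := F1 (a + s)%N; have := F1 (c + s)%N; lra.
Qed.

Lemma average_shift (R : realType) (F : nat -> R[i]) (a c h P : nat) (bd : R) :
  (0 < P)%N -> (forall x, normc (F x) <= 1) ->
  (forall x, normc (\sum_(y < P) \sum_(z < P) F (x + h * (y * z))%N) <= P%:R ^+ 2 * bd) ->
  normc (\sum_(a <= x < c) F x) <= (c - a)%:R * bd + 2 * (h * P ^ 2)%:R.
Proof.
move=> P0 F1 Hb; have PR : 0 < P%:R ^+ 2 :> R by rewrite exprn_gt0 // ltr0n.
rewrite -(ler_pM2l PR).
have -> : P%:R ^+ 2 * normc (\sum_(a <= x < c) F x) =
    normc (\sum_(y < P) \sum_(z < P) \sum_(a <= x < c) F x).
  rewrite !sumr_const card_ord -mulrnA -(mulr_natl (\sum_(a <= x < c) F x)) normcM; congr (_ * _).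
  by rewrite -(rmorph_nat (real_complex R)) normc_real natrM expr2 ger0_norm // mulr_ge0.
have -> : \sum_(y < P) \sum_(z < P) \sum_(a <= x < c) F x =
  \sum_(y < P) \sum_(z < P) (\sum_(a <= x < c) F x - \sum_(a <= x < c) F (x + h * (y * z))%N)
  + \sum_(a <= x < c) \sum_(y < P) \sum_(z < P) F (x + h * (y * z))%N.
  rewrite [X in _ + X]exchange_big -big_split; apply: eq_bigr => y _ /=.
  by rewrite [X in _ + X]exchange_big -big_split; apply: eq_bigr => z _ /=; rewrite subrK.
rewrite addrC; apply: le_trans (le_normcD _ _) _; rewrite mulrDr; apply: lerD.
  apply: le_trans (normc_sum _ _ _) _.
  apply: le_trans (ler_sum _ (fun x _ => Hb x)) _.
  by rewrite sumr_const_nat -[leLHS]mulr_natl mulrCA.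
apply: le_trans (normc_sum _ _ _) _.
have Hyz (y z : 'I_P) : normc (\sum_(a <= x < c) F x - \sum_(a <= x < c) F (x + h * (y * z))%N)
    <= 2 * (h * P ^ 2)%:R.
  apply: le_trans (shift_interval _ _ _ F1) _; rewrite ler_pM2l // ler_nat.
  by rewrite leq_mul2l -mulnn leq_mul ?orbT // ltnW.
apply: le_trans (_ : \sum_(y < P) \sum_(z < P) 2 * (h * P ^ 2)%:R <= _).
  by apply: ler_sum => y _; apply: le_trans (normc_sum _ _ _) _; apply: ler_sum => z _.
by rewrite !sumr_const card_ord -mulrnA -[leLHS]mulr_natl natrM expr2.
Qed.

Section IntervalSum.
Variables (R : realType) (q m b s u g gam : nat).
Hypotheses (qp : prime q) (q3 : (3 <= q)%N) (m0 : (0 < m)%N).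
Hypotheses (bm : (1000 * m ^ 2 <= b)%N) (s0 : (0 < s)%N) (sb : (s <= b)%N).
Hypotheses (gam_le : (gam <= 8 * m * b)%N) (gam_ge : (8 * m * b <= gam + 8 * m)%N).
Hypotheses (qu : ~~ (q %| u)%N) (gE : (g ^ (q.-1 * q ^ s) = 1 + q ^ b * u)%N).
Variables (A C : int) (n1 n2 e : nat).
Hypothesis eb : (4 * e <= b)%N.

(* Up to the factor coming from the expansion of the powers of [g], the
   coefficient of degree [i] in [h * (y * z)] of the phase at [x + h * (y * z)]. *)
Definition twist (i x : nat) : int :=
  A * (g ^ (n1 * x))%N%:Z * (n1 ^ i)%N%:Z + C * (g ^ (n2 * x))%N%:Z * (n2 ^ i)%N%:Z.

Hypothesis sep : forall i x, ~~ (((q ^ e)%N %| twist i x)%Z && ((q ^ e)%N %| twist i.+1 x)%Z).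

(** One family serves both types of sums: [C = 0] gives type I, [C = - A] type II. Shifts by
    multiples of [h] preserve divisibility by [q], so the zeros at multiples of [q] are compatible
    with the averaging. *)
Definition two_exp (x : nat) : R[i] :=
  if (q %| x)%N then 0 else e1 ((twist 0 x)%:~R / (q ^ gam)%:R).

Let k := (8 * m)%N.
Let h := (q.-1 * q ^ s * k`!)%N.
Let B : R := q%:R.

Lemma two_exp_le1 x : normc (two_exp x) <= 1.
Proof. by rewrite /two_exp; case: ifP; rewrite ?normc0 // normc_e1. Qed.

Let kb : (k ^ 2 < b)%N.
Proof. by rewrite /k expnMn; have : (0 < m ^ 2)%N by [rewrite expn_gt0 m0]; lia. Qed.

(* By [sep] at least every second index in [4 * m + 1 .. 6 * m] has a twist not
   divisible by [q ^ e], which gives [m] indices with [ee j >= m * b]. *)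
Lemma twist_index (D : nat -> int) (x : nat) :
  (forall i, (0 < i <= k)%N -> exists2 d, (i * b <= d <= i * b + i * k ^ 2)%N &
     exists2 E : int, ~~ (q %| E)%Z & D i = (q ^ d)%N%:Z * E) ->
  exists2 ee : 'I_k -> nat, (m ^ 2 * b <= \sum_j ee j)%N &
    forall j, (ee j <= b * j.+1)%N /\ ((0 < ee j)%N -> exists2 A' : int, ~~ (q %| A')%Z &
      (D j.+1 * twist j.+1 x)%:~R / (q ^ gam)%:R = A'%:~R / (q ^ ee j)%:R :> R).
Proof.
move=> HD.
pose good (j : nat) := (4 * m <= j < 6 * m)%N && ~~ ((q ^ e)%N %| twist j.+1 x)%Z.
have /boolp.choice[ee Hee] (j : 'I_k) : exists ej : nat, [/\ (ej <= b * j.+1)%N,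
   (0 < ej)%N -> exists2 A' : int, ~~ (q %| A')%Z &
      (D j.+1 * twist j.+1 x)%:~R / (q ^ gam)%:R = A'%:~R / (q ^ ej)%:R :> R &
   good j -> (m * b <= ej)%N].
  have [/andP[/andP[j4 j6] nZ]|ng] := boolP (good j); last by exists 0%N.
  have [d /andP[d1 d2] [E qE DE]] := HD j.+1 (ltn_ord j).
  have Z0 : (0 < `|twist j.+1 x|)%N.
    by rewrite lt0n; apply: contraNneq nZ => Z0; rewrite dvdzE Z0 dvdn0.
  have [Zm qZm EZ] := pfactor_coprime qp Z0.
  have ve : (logn q `|twist j.+1 x| < e)%N.
    by rewrite ltnNge -pfactor_dvdn //; move: nZ; rewrite dvdzE absz_nat.
  move: (logn q _) EZ ve => v EZ ve.
  (* With [j.+1 <= 6 m] the left side is at most [6 m b + 384 m^3 + b / 4 + m b]. Compared with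
     [8 m b - 8 m] this leaves [3 m b / 4], and [b >= 1000 m^2] makes it at least
     [384 m^3 + 8 m]. *)
  have bd : (d + v + m * b <= gam)%N.
    have k2 : (k ^ 2 = 64 * (m * m))%N by rewrite /k expnMn mulnn.
    rewrite k2 in d2.
    have h1 : (j.+1 * b + j.+1 * (64 * (m * m)) <= 6 * m * b + 6 * m * (64 * (m * m)))%N.
      by rewrite leq_add // leq_mul.
    have h2 : (1000 * (m * m) * m <= b * m)%N by rewrite leq_mul2r mulnn bm orbT.
    have h3 : (b <= b * m)%N by rewrite leq_pmulr.
    have h4 : (m <= m * m * m)%N by rewrite -mulnA leq_pmulr ?muln_gt0 ?m0.
    move: gam_ge; lia.
  exists (gam - (d + v))%N; split.
  - have : (4 * m * b <= j.+1 * b)%N by rewrite leq_mul2r (leqW j4) orbT.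
    by move: d1 gam_le; lia.
  - move=> _; exists (E * (-1) ^+ (twist j.+1 x < 0)%R * Zm%:Z).
      rewrite dvdzE !abszM absz_sign muln1 !absz_nat Euclid_dvdM // negb_or.
      by rewrite -(prime_coprime Zm qp) qZm andbT; move: qE; rewrite dvdzE absz_nat.
    rewrite DE {1}[twist j.+1 x]intEsign EZ.
    have qN l : (q ^ l)%:R != 0 :> R by rewrite pnatr_eq0 -lt0n expn_gt0 prime_gt0.
    have -> : (q ^ gam = q ^ d * q ^ v * q ^ (gam - (d + v)))%N.
      by rewrite -!expnD subnKC //; lia.
    rewrite PoszM !intrM !natrM -!pmulrn.
    by field; rewrite !qN.
  - by move=> _; lia.
exists ee; last by move=> j; case: (Hee j).
have pb (p : 'I_m) (c : bool) : (4 * m + 2 * p + c < k)%N.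
  by rewrite /k; have := ltn_ord p; case: c => /=; lia.
pose f (p : 'I_m) : 'I_k := Ordinal (pb p (~~ good (4 * m + 2 * p)%N)).
have fgood p : good (f p).
  rewrite /f /=; have [//|ng] := boolP (good (4 * m + 2 * p)%N).
    by rewrite addn0.
  have pr : (4 * m <= 4 * m + 2 * p < 6 * m)%N by have := ltn_ord p; lia.
  move: ng; rewrite /good pr /= negbK => dv; rewrite addn1.
  apply/andP; split; first by have := ltn_ord p; lia.
  by have := sep (4 * m + 2 * p).+1 x; rewrite dv.
have finj : injective f.
  move=> p1 p2 /(congr1 val) /= E; apply/val_inj => /=.
  by move: E; do 2 case: (~~ _) => /=; lia.
rewrite (bigID (mem (codom f))) /=; apply: leq_trans (leq_addr _ _).
rewrite -mulnn -mulnA.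
have -> : (m * (m * b) = \sum_(i in codom f) m * b)%N.
  by rewrite sum_nat_const card_codom // card_ord.
by apply: leq_sum => j /codomP[p ->]; case: (Hee (f p)) => _ _; apply.
Qed.

Lemma two_exp_bilinear x :
  normc (\sum_(y < q ^ b) \sum_(z < q ^ b) two_exp (x + h * (y * z))%N) <=
  (q ^ b)%:R ^+ 2 * B `^ (1 - b%:R / (1152 * m%:R) ^+ 2).
Proof.
have q0 := prime_gt0 qp.
have B0 : 0 < B by rewrite ltr0n.
have k0 : (0 < k)%N by rewrite /k; lia.
have -> : (q ^ b)%:R ^+ 2 * B `^ (1 - b%:R / (1152 * m%:R) ^+ 2) =
   B `^ (2 * b%:R + 1 - b%:R / (1152 * m%:R) ^+ 2).
  rewrite -[in RHS]addrA [RHS]powRD; last by apply/implyP => _; rewrite gt_eqF.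
  by congr (_ * _); rewrite -natrM powR_mulrn ?(ltW B0) // natrX -exprM mulnC.
have qh : (q %| h)%N by rewrite /h dvdn_mulr // dvdn_mull // dvdn_exp.
have dvx y : (q %| x + h * y)%N = (q %| x)%N by rewrite dvdn_addl // dvdn_mulr.
have [qx|qx] := boolP (q %| x)%N.
  rewrite big1 ?normc0 ?powR_ge0 // => y _; rewrite big1 // => z _.
  by rewrite /two_exp dvx qx.
have [D [HD Dexp]] := pow_expansion qp k0 kb qu.
have [ee esum Hee] := twist_index x HD.
pose alpha (j : 'I_k) : R := (D j.+1 * twist j.+1 x)%:~R / (q ^ gam)%:R.
have bs := bilinear_saving (alpha := alpha) qp q3 m0 (fun j => proj1 (Hee j)) (fun j => proj2 (Hee j)) esum.
apply: le_trans bs.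
suff E (y z : nat) : two_exp (x + h * (y * z))%N =
    e1 ((twist 0 x)%:~R / (q ^ gam)%:R) * e1 (\sum_j alpha j * ((y * z) ^ j.+1)%:R).
  under eq_bigr do under eq_bigr do rewrite E.
  under eq_bigr do rewrite -big_distrr.
  by rewrite -big_distrr normcM normc_e1 mul1r.
rewrite /two_exp dvx (negbTE qx) -e1D.
have qN : (q ^ gam)%:R != 0 :> R by rewrite pnatr_eq0 -lt0n expn_gt0 q0.
have qgam : (q ^ gam %| q ^ (b * k.+1))%N.
  by rewrite dvdn_exp2l // /k; move: gam_le; lia.
set v := (y * z)%N.
(* Because [h = (q - 1) q^s k!], the factor [g^(n h v)] is [(1 + q^b u)^(k! n v)], the power
   expanded by [pow_expansion]; its error vanishes modulo [q^gam] since [gam <= k b]. *)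
have Ex n : exists r : int, (g ^ (n * (x + h * v)))%N%:Z =
   (g ^ (n * x))%N%:Z * (1 + \sum_(i < k) D i.+1 * (n * v)%N%:Z ^+ i.+1 + r * (q ^ gam)%N%:Z).
  have /dvdzP[r Er] := Dexp (n * v)%N.
  have /dvdnP[r' Er'] := qgam.
  exists (r * r'%:Z); rewrite -mulrA -PoszM -Er' -Er addrC subrK.
  rewrite -gE -expnM mulnDr expnD PoszM; congr (_ * (_ ^ _)%N%:Z).
  by rewrite /h; lia.
have [r1 E1] := Ex n1; have [r2 E2] := Ex n2.
have -> : twist 0 (x + h * v) = twist 0 x + \sum_(j < k) (D j.+1 * twist j.+1 x) * (v%:Z) ^+ j.+1
   + (A * (g ^ (n1 * x))%N%:Z * r1 + C * (g ^ (n2 * x))%N%:Z * r2) * (q ^ gam)%N%:Z.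
  have S n : \sum_(i < k) D i.+1 * (n * v)%N%:Z ^+ i.+1 =
     \sum_(i < k) D i.+1 * (n ^ i.+1)%N%:Z * v%:Z ^+ i.+1.
    by apply: eq_bigr => i _; rewrite PoszM exprMn PoszX mulrA.
  have S3 : \sum_(j < k) (D j.+1 * twist j.+1 x) * (v%:Z) ^+ j.+1 =
     A * (g ^ (n1 * x))%N%:Z * (\sum_(i < k) D i.+1 * (n1 ^ i.+1)%N%:Z * v%:Z ^+ i.+1) +
     C * (g ^ (n2 * x))%N%:Z * (\sum_(i < k) D i.+1 * (n2 ^ i.+1)%N%:Z * v%:Z ^+ i.+1).
    by rewrite !big_distrr -big_split; apply: eq_bigr => i _ /=; rewrite /twist; ring.
  by rewrite S3 /twist E1 E2 !S !expn0; ring.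
move: (twist 0 x) (A * (g ^ (n1 * x))%N%:Z * r1 + C * (g ^ (n2 * x))%N%:Z * r2) => t0 r.
rewrite intrD (intrD _ t0) (intrM _ r) !mulrDl.
rewrite -pmulrn mulfK //. rewrite (e1D _ r%:~R) e1_int mulr1; congr (e1 (_ + _)).
rewrite rmorph_sum big_distrl; apply: eq_bigr => j _ /=.
rewrite intrM mulrAC /alpha; congr (_ * _).
by rewrite -PoszX -pmulrn.
Qed.

(** The second term is the boundary loss of the shifts: [q - 1 < q], [q^s <= q^b],
    [k! <= k^k <= q^(k^2) <= q^b] and [y z < q^(2 b)]. *)
Theorem interval_sum_bound a c :
  normc (\sum_(a <= x < c) two_exp x) <=
  (c - a)%:R * B `^ (1 - b%:R / (1152 * m%:R) ^+ 2) + 2 * (q ^ (4 * b).+1)%:R.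
Proof.
have P0 : (0 < q ^ b)%N by rewrite expn_gt0 prime_gt0.
apply: le_trans (average_shift a c P0 two_exp_le1 two_exp_bilinear) _.
rewrite lerD2l ler_pM2l // ler_nat /h.
have kf : (k`! <= q ^ b)%N.
  apply: leq_trans (_ : (q ^ (k * k) <= _)%N); last first.
    by rewrite leq_exp2l ?prime_gt1 // mulnn ltnW.
  rewrite expnM; apply: leq_trans (_ : (k ^ k <= _)%N); last first.
    have kq : (k <= q ^ k)%N by apply: ltnW; apply: ltn_expl; exact: prime_gt1.
    by rewrite leq_exp2r // /k; lia.
  have -> : (k ^ k = \prod_(i < k) k)%N by rewrite prod_nat_const card_ord.
  rewrite fact_prod big_add1 /= big_mkord; apply: leq_prod => i _; exact: ltn_ord.
rewrite -expnM.
apply: leq_trans (_ : (q * q ^ b * q ^ b * q ^ (b * 2) <= _)%N).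
  by rewrite !leq_mul ?leq_pred // leq_exp2l ?prime_gt1.
by rewrite -expnS -!expnD leq_exp2l ?prime_gt1 //; lia.
Qed.

End IntervalSum.

(** * Vaughan's identity and Chebyshev's bound *)

Lemma big_multiples (K : nmodType) (N M a : nat) (F : nat -> K) : (0 < a)%N -> (M <= N)%N ->
  \sum_(1 <= m < N.+1 | (a * m <= M)%N) F (a * m)%N =
  \sum_(1 <= k < N.+1 | (k <= M)%N && (a %| k)%N) F k.
Proof.
move=> a0 MN; rewrite -big_filter -[RHS]big_filter.
rewrite -(big_map (muln a) xpredT F); apply: perm_big; apply: uniq_perm.
- rewrite map_inj_uniq ?filter_uniq ?iota_uniq // => x y /eqP.
  by rewrite eqn_pmul2l // => /eqP.
- by rewrite filter_uniq ?iota_uniq.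
move=> k; rewrite mem_filter mem_index_iota; apply/mapP/idP => [[m]|].
  rewrite mem_filter mem_index_iota => /andP[h1 /andP[h2 h3]] ->.
  by rewrite h1 dvdn_mulr //= muln_gt0 a0 h2 ltnS (leq_trans h1).
case/andP=> /andP[kM /dvdnP[m E]] /andP[k0 kN]; exists m; last by rewrite E mulnC.
rewrite mem_filter mem_index_iota mulnC -E kM /=.
by apply/andP; split; nia.
Qed.

Lemma divisor_grouping (K : comNzRingType) (N M : nat) (A F : nat -> K) : (M <= N)%N ->
  \sum_(1 <= a < N.+1) \sum_(1 <= m < N.+1 | (a * m <= M)%N) A a * F (a * m)%N =
  \sum_(1 <= k < N.+1 | (k <= M)%N) (\sum_(1 <= a < N.+1 | (a %| k)%N) A a) * F k.
Proof.
move=> MN; under [RHS]eq_bigr do rewrite big_distrl /=.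
rewrite [RHS](exchange_big_dep xpredT) //= big_seq [RHS]big_seq.
apply: eq_bigr => a; rewrite mem_index_iota => /andP[a0 _].
exact: (big_multiples (fun k => A a * F k)).
Qed.

Section Vaughan.
Variables (K : comNzRingType) (N U V : nat) (Lam mu lg f : nat -> K).
Hypothesis Lam_sum : forall k, (0 < k <= N)%N -> \sum_(1 <= a < N.+1 | (a %| k)%N) Lam a = lg k.
Hypothesis mu_sum : forall k, (0 < k <= N)%N ->
  \sum_(1 <= d < N.+1 | (d %| k)%N) mu d = (k == 1%N)%:R.

(** The Dirichlet convolution of [A], [C] and the constant 1, summed against [f] up to [N]. *)
Let tri (A C : nat -> K) : K :=
  \sum_(1 <= a < N.+1) \sum_(1 <= d < N.+1) A a * C d *
    \sum_(1 <= m < N.+1 | (a * d * m <= N)%N) f (a * d * m)%N.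

Lemma tri_group_left A C : tri A C =
  \sum_(1 <= d < N.+1) C d * \sum_(1 <= k < N.+1 | (d * k <= N)%N)
     (\sum_(1 <= a < N.+1 | (a %| k)%N) A a) * f (d * k)%N.
Proof.
rewrite /tri exchange_big /= big_seq [RHS]big_seq; apply: eq_bigr => d.
rewrite mem_index_iota => /andP[d0 dN].
under eq_bigr do rewrite -mulrA mulrCA.
rewrite -big_distrr /=; congr (_ * _).
have dk k : (d * k <= N)%N = (k <= N %/ d)%N by rewrite leq_divRL // mulnC.
under [RHS]eq_bigl do rewrite dk.
rewrite -(divisor_grouping _ (fun k => f (d * k)%N)) ?leq_div //.
apply: eq_bigr => a _; rewrite big_distrr /=; apply: eq_big => [m|m _].
  by rewrite -dk [(a * d)%N]mulnC mulnA.
by rewrite [(a * d)%N]mulnC mulnA.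
Qed.

Lemma tri_mu A : tri A mu = \sum_(1 <= n < N.+1) A n * f n.
Proof.
have -> : tri A mu = tri mu A.
  rewrite /tri exchange_big /=; apply: eq_bigr => d _; apply: eq_bigr => a _.
  rewrite [mu d * _]mulrC; congr (_ * _); apply: eq_big => [m|m _]; by rewrite [(a * d)%N]mulnC.
rewrite tri_group_left big_seq [RHS]big_seq; apply: eq_bigr => a.
rewrite mem_index_iota => /andP[a0 aN]; congr (_ * _).
rewrite big_seq_cond (eq_bigr (fun k => (k == 1%N)%:R * f (a * k)%N)); last first.
  move=> k /andP[]; rewrite mem_index_iota => /andP[k0 kN] _.
  by rewrite mu_sum // k0.
rewrite -big_seq_cond big_mkcond /= big_ltn ?ltnS ?(leq_trans _ aN) //; last first.
  by move: a0 aN; case: (N) => //=; case: a.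
rewrite muln1 -ltnS aN eqxx mul1r big_nat_cond big1 ?addr0 // => k /andP[/andP[k1 _] _].
by case: ifP => //; rewrite (gtn_eqF k1) mul0r.
Qed.

(** Only the part of [Lam] above [V] is convolved with [mu] and 1, which changes nothing. Then [mu]
    is split at [U], and in its lower half the upper part of [Lam] is rewritten as [Lam] minus its
    lower part, so that [Lam] convolved with 1 becomes [lg]. *)
Theorem vaughan :
  \sum_(1 <= n < N.+1) Lam n * f n =
  \sum_(1 <= n < N.+1 | (n <= V)%N) Lam n * f n +
  \sum_(1 <= d < N.+1 | (d <= U)%N) mu d *
     \sum_(1 <= k < N.+1 | (d * k <= N)%N) lg k * f (d * k)%N -
  \sum_(1 <= c < N.+1 | (c <= V)%N) \sum_(1 <= d < N.+1 | (d <= U)%N) Lam c * mu d *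
     \sum_(1 <= m < N.+1 | (c * d * m <= N)%N) f (c * d * m)%N +
  \sum_(1 <= d < N.+1 | (U < d)%N) mu d *
     \sum_(1 <= k < N.+1 | (d * k <= N)%N)
        (\sum_(1 <= a < N.+1 | (a %| k)%N && (V < a)%N) Lam a) * f (d * k)%N.
Proof.
pose L1 n := if (n <= V)%N then Lam n else 0.
pose L2 n := if (V < n)%N then Lam n else 0.
pose m1 n := if (n <= U)%N then mu n else 0.
pose m2 n := if (U < n)%N then mu n else 0.
have EL n : Lam n = L1 n + L2 n by rewrite /L1 /L2 leqNgt; case: ltnP; rewrite ?addr0 ?add0r.
have Em n : mu n = m1 n + m2 n by rewrite /m1 /m2 leqNgt; case: ltnP; rewrite ?addr0 ?add0r.
have triDr A C C' : tri A (fun n => C n + C' n) = tri A C + tri A C'.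
  rewrite /tri -big_split; apply: eq_bigr => a _; rewrite -big_split; apply: eq_bigr => d _ /=.
  by rewrite mulrDr mulrDl.
have triDl A A' C : tri (fun n => A n + A' n) C = tri A C + tri A' C.
  rewrite /tri -big_split; apply: eq_bigr => a _; rewrite -big_split; apply: eq_bigr => d _ /=.
  by rewrite !mulrDl.
have tri_ext A A' C C' : A =1 A' -> C =1 C' -> tri A C = tri A' C'.
  by move=> hA hC; apply: eq_bigr => a _; apply: eq_bigr => d _; rewrite hA hC.
have E1 : \sum_(1 <= n < N.+1) Lam n * f n =
    \sum_(1 <= n < N.+1) L1 n * f n + \sum_(1 <= n < N.+1) L2 n * f n.
  by rewrite -big_split; apply: eq_bigr => n _; rewrite EL mulrDl.
rewrite E1 -(tri_mu L2) (tri_ext L2 L2 mu _ (frefl _) Em) triDr.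
have -> : tri L2 m1 = tri Lam m1 - tri L1 m1.
  by rewrite (tri_ext Lam _ m1 m1 EL (frefl _)) triDl addrC addKr.
rewrite !addrA; congr (_ + _ - _ + _).
- by rewrite [RHS]big_mkcond; apply: eq_bigr => n _; rewrite /L1; case: ifP; rewrite ?mul0r.
- rewrite tri_group_left [RHS]big_mkcond; apply: eq_bigr => d _.
  rewrite /m1; case: ifP; rewrite ?mul0r // => _; congr (_ * _).
  rewrite big_seq_cond [RHS]big_seq_cond; apply: eq_bigr => k /andP[].
  by rewrite mem_index_iota => /andP[k0 kN] _; rewrite Lam_sum ?k0.
- rewrite /tri [RHS]big_mkcond; apply: eq_bigr => c _.
  rewrite /L1; case: ifP => _; last by rewrite big1 // => d _; rewrite !mul0r.
  rewrite [RHS]big_mkcond; apply: eq_bigr => d _; rewrite /m1; case: ifP => // _.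
  by rewrite mulr0 mul0r.
rewrite tri_group_left [RHS]big_mkcond; apply: eq_bigr => d _.
rewrite /m2; case: ifP; rewrite ?mul0r // => _; congr (_ * _).
apply: eq_bigr => k _; congr (_ * _); rewrite [RHS]big_mkcondr.
by apply: eq_bigr => a _.
Qed.

End Vaughan.

(** * The Moebius function *)

Section Moebius.

Definition moebius (n : nat) : int :=
  if all (fun p => logn p n <= 1)%N (primes n) then (-1) ^+ size (primes n) else 0.

Lemma moebius_le1 n : `|moebius n| <= 1.
Proof. by rewrite /moebius; case: ifP => _; rewrite ?normr0 // normrX normrN1 expr1n. Qed.

Lemma moebius_mulp p c : prime p -> (0 < c)%N ->
  moebius (p * c) = if (p %| c)%N then 0 else - moebius c.
Proof.
move=> pp c0; have p0 := prime_gt0 pp.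
have lp r : logn r (p * c) = ((r == p) + logn r c)%N by rewrite lognM // logn_prime // eq_sym.
rewrite {1}/moebius; case: ifPn => [/allP H|].
  have pin : p \in primes (p * c) by rewrite mem_primes pp muln_gt0 p0 c0 dvdn_mulr.
  have := H p pin; rewrite lp eqxx add1n ltnS leqn0 => l0.
  have npc : ~~ (p %| c)%N.
    by rewrite -(expn1 p) pfactor_dvdn // (eqP l0).
  rewrite (negbTE npc).
  have pm : perm_eq (primes (p * c)) (p :: primes c).
    apply: uniq_perm; rewrite /= ?primes_uniq ?andbT //.
      by rewrite mem_primes pp c0 /=.
    by move=> r; rewrite primesM // inE primes_prime // inE.
  rewrite (perm_size pm) /= exprS mulN1r /moebius ifT //.
  apply/allP => r rc; have := H r; rewrite (perm_mem pm) inE rc orbT => /(_ isT).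
  by rewrite lp; case: (r == p); lia.
rewrite -has_predC => /hasP[r]; rewrite mem_primes => /and3P[rp _ _] /=.
rewrite -ltnNge lp => h; case: ifPn => // npc.
have lpc : logn p c = 0%N.
  by apply/eqP; rewrite -leqn0 leqNgt -pfactor_dvdn // expn1.
rewrite /moebius ifN ?oppr0 //; rewrite -has_predC; apply/hasP.
have rp' : r != p by apply/eqP => E; move: h; rewrite E eqxx lpc.
move: h; rewrite (negbTE rp') add0n => h; exists r; last by rewrite /= -ltnNge.
by rewrite mem_primes rp c0 /= -(expn1 r) pfactor_dvdn // ltnW.
Qed.

(** With [p] the least prime factor of [k], the divisors [m] prime to [p] cancel against [p m]; at
    multiples of [p^2] the function vanishes. *)
Lemma moebius_sum N k : (0 < k <= N)%N ->
  \sum_(1 <= d < N.+1 | (d %| k)%N) moebius d = (k == 1%N)%:R.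
Proof.
case/andP=> k0 kN; have [->|k1] := eqVneq k 1%N.
  rewrite big_ltn_cond ?ltnS ?(leq_trans k0) // dvd1n big_nat_cond big1 ?addr0.
    by rewrite /moebius.
  by move=> d /andP[/andP[d1 _]]; rewrite dvdn1 => /eqP E; rewrite E in d1.
have k2 : (1 < k)%N by lia.
pose p := pdiv k; have pp : prime p := pdiv_prime k2.
have p0 := prime_gt0 pp; have pk : (p %| k)%N := pdiv_dvd k.
rewrite (bigID (fun d => (p %| d)%N)) /=.
have -> : \sum_(1 <= d < N.+1 | (d %| k)%N && (p %| d)%N) moebius d =
    \sum_(1 <= d < N.+1 | (d <= N)%N && (p %| d)%N) (if (d %| k)%N then moebius d else 0).
  rewrite big_mkcond [RHS]big_mkcond; apply: eq_big_nat => d /andP[_ dN].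
  by rewrite -ltnS dN /=; case: (p %| d)%N; case: (d %| k)%N.
rewrite -(big_multiples (fun d => if (d %| k)%N then moebius d else 0) p0 (leqnn N)).
have -> : \sum_(1 <= m < N.+1 | (p * m <= N)%N) (if (p * m %| k)%N then moebius (p * m) else 0) =
   \sum_(1 <= m < N.+1 | (m %| k)%N && ~~ (p %| m)%N) - moebius m.
  rewrite big_nat_cond [RHS]big_nat_cond big_mkcond [RHS]big_mkcond /=.
  apply: eq_bigr => m _; case: ifP => [/andP[/andP[m1 mN] pmN]|].
    rewrite m1 mN /= moebius_mulp //.
    have [pm|npm] := boolP (p %| m)%N; first by rewrite andbF; case: ifP.
    rewrite andbT Gauss_dvd ?prime_coprime // pk /=.
    by case: ifP.
  case: ifP => // /andP[/andP[m1 mN] /andP[mk npm]].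
  rewrite m1 mN /= => /negP[]; apply: leq_trans kN.
  by apply: dvdn_leq => //; rewrite Gauss_dvd ?prime_coprime // pk mk.
by rewrite sumrN addNr.
Qed.

End Moebius.

(** * The von Mangoldt function and Chebyshev's upper bound *)

Section VonMangoldt.
Variable R : realType.
Local Notation Lam := (@vonMangoldt R).

Lemma vonMangoldt_case n : Lam n = 0 \/
  exists p k, [/\ prime p, (0 < k)%N, n = (p ^ k)%N & Lam n = ln p%:R].
Proof.
have [[p [k [pp k0 ->]]]|H] := pselect (exists p k, [/\ prime p, (0 < k)%N & n = (p ^ k)%N]).
  by right; exists p, k; rewrite vonMangoldt_pow.
left; apply: vonMangoldt_eq0 => p k pp k0 E; apply: H; by exists p, k.
Qed.

Lemma ln_nat_ge0 n : 0 <= ln n%:R :> R.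
Proof. by case: n => [|n]; [rewrite ln0 | rewrite ln_ge0 // ler1n]. Qed.

Lemma vonMangoldt_ge0 n : 0 <= Lam n.
Proof. by case: (vonMangoldt_case n) => [->//|[p [k [_ _ _ ->]]]]; exact: ln_nat_ge0. Qed.

(** Induction by removing the least prime factor [p]: if [k = p k'] and [v] is the valuation of [k']
    at [p], the only new divisor with nonzero weight is [p^(v+1)], of weight [ln p]. *)
Lemma vonMangoldt_sum N k : (0 < k <= N)%N ->
  \sum_(1 <= a < N.+1 | (a %| k)%N) Lam a = ln k%:R.
Proof.
case/andP; elim/ltn_ind: k => k IH k0 kN.
have [k1|k1] := leqP k 1.
  have -> : k = 1%N by lia.
  rewrite ln1 big_nat_cond big1 // => d /andP[_]; rewrite dvdn1 => /eqP ->.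
  apply: vonMangoldt_eq0 => p j pp j0 E.
  have : (1 < p ^ j)%N by rewrite -(exp1n j) ltn_exp2r ?prime_gt1.
  by rewrite -E.
pose p := pdiv k; have pp : prime p := pdiv_prime k1.
have p0 := prime_gt0 pp; have [k' Ek] := dvdnP (pdiv_dvd k); rewrite -/p in Ek.
have k'0 : (0 < k')%N by move: k0; rewrite Ek muln_gt0 => /andP[].
have k'k : (k' < k)%N by rewrite Ek ltn_Pmulr // prime_gt1.
have IH' := IH k' k'k k'0 (ltnW (leq_trans k'k kN)).
pose v := logn p k'.
rewrite (bigID (fun a => (a %| k')%N)) /=.
have -> : \sum_(1 <= a < N.+1 | (a %| k)%N && (a %| k')%N) Lam a = ln k'%:R.
  rewrite -IH'; apply: eq_bigl => a; apply/andP/idP => [[]//|ak'].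
  by split=> //; rewrite Ek dvdn_mulr.
have pvk : (p ^ v.+1 %| k)%N by rewrite Ek expnSr dvdn_mul // pfactor_dvdnn.
have npvk' : ~~ (p ^ v.+1 %| k')%N by rewrite pfactor_dvdn // ltnn.
rewrite big_mkcond (bigD1_seq (p ^ v.+1)%N) ?iota_uniq //=; last first.
  by rewrite mem_index_iota expn_gt0 p0 ltnS (leq_trans (dvdn_leq k0 pvk)).
rewrite pvk npvk' /= vonMangoldt_pow // big1 ?addr0.
  by rewrite addrC Ek natrM mulrC lnM ?posrE ?ltr0n.
move=> a ap; case: ifP => // /andP[ak nak'].
have [//|[r [j [rp j0 Ea _]]]] := vonMangoldt_case a.
have rE : r = p.
  apply/eqP/negPn/negP => rp'; move/negP: nak'; apply.
  move: ak; rewrite Ek Ea Gauss_dvdl // coprimeXl //.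
  by rewrite prime_coprime // dvdn_prime2.
move: ak nak' ap; rewrite Ea rE Ek !pfactor_dvdn ?muln_gt0 ?k'0 //.
rewrite lognM // (logn_prime p pp) eqxx -/v -ltnNge => h1 h2.
have -> : j = v.+1 by lia.
by rewrite eqxx.
Qed.

Lemma vonMangoldt_le_ln n : (0 < n)%N -> Lam n <= ln n%:R.
Proof.
move=> n0; have nn : (0 < n <= n)%N by rewrite n0 leqnn.
rewrite -(vonMangoldt_sum nn) big_mkcond (bigD1_seq n) ?iota_uniq //=; last first.
  by rewrite mem_index_iota n0 ltnSn.
rewrite dvdnn lerDl; apply: sumr_ge0 => a _.
by case: ifP => // _; exact: vonMangoldt_ge0.
Qed.

Lemma ln_fact_sum N n : (n <= N)%N ->
  ln (n`!)%:R = \sum_(1 <= a < N.+1) Lam a * (n %/ a)%:R.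
Proof.
elim: n => [|n IH] nN.
  by rewrite fact0 ln1 big1 // => a _; rewrite div0n mulr0.
have nn : (0 < n.+1 <= N)%N by rewrite nN.
rewrite factS natrM lnM ?posrE ?ltr0n ?fact_gt0 // IH ?(ltnW nN) //.
rewrite -(vonMangoldt_sum nn) big_mkcond -big_split big_seq [RHS]big_seq.
apply: eq_bigr => a; rewrite mem_index_iota => /andP[a0 _] /=.
rewrite divnS // natrD mulrDr addrC [_ * (a %| _)%:R]mulrC addrC; congr (_ + _).
by case: (a %| n.+1)%N; rewrite ?mul1r ?mul0r.
Qed.

Definition psi_sum (n : nat) : R := \sum_(1 <= a < n.+1) Lam a.

(** In [ln C(2n,n)] the weight of [Lam a] is [floor(2n/a) - 2 floor(n/a)], which is nonnegative and
    equals 1 for [n < a <= 2n]; moreover [C(2n,n) <= 2^(2n)] and [ln 2 <= 1]. *)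
Lemma psi_double n : psi_sum (2 * n) - psi_sum n <= (2 * n)%:R.
Proof.
have [->|n0] := posnP n; first by rewrite muln0 subrr.
have n2n : (n <= 2 * n)%N by lia.
have h : psi_sum (2 * n) - psi_sum n <= ln ((2 * n)`!)%:R - 2 * ln (n`!)%:R.
  rewrite (ln_fact_sum (leqnn _)) (ln_fact_sum n2n) big_distrr /= -sumrB.
  have -> : psi_sum (2 * n) - psi_sum n = \sum_(n.+1 <= a < (2 * n).+1) Lam a.
    by rewrite /psi_sum (big_cat_nat (n := n.+1)) //= addrAC subrr add0r.
  rewrite [leRHS](big_cat_nat (n := n.+1)) //= -[leLHS]add0r; apply: lerD.
    rewrite big_nat_cond; apply: sumr_ge0 => a /andP[/andP[a0 an] _].
    rewrite mulrCA -mulrBr mulr_ge0 ?vonMangoldt_ge0 // subr_ge0 -natrM ler_nat.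
    by rewrite leq_divRL // -mulnA leq_mul2l /= leq_divM.
  rewrite big_nat_cond [leRHS]big_nat_cond; apply: ler_sum => a /andP[/andP[na a2n] _].
  rewrite (divn_small na) mulr0 mulr0 subr0 -[leLHS]mulr1.
  rewrite ler_wpM2l ?vonMangoldt_ge0 // ler1n divn_gt0 //; lia.
apply: le_trans h _.
have E : ((2 * n)`! = 'C(2 * n, n) * (n`! * n`!))%N.
  by rewrite -{1}(bin_fact n2n); congr (_ * (_ * _`!))%N; lia.
have C0 : (0 < 'C(2 * n, n))%N by rewrite bin_gt0.
rewrite E !natrM !lnM ?posrE ?mulr_gt0 ?ltr0n ?fact_gt0 //.
have -> : ln 'C(2 * n, n)%:R + (ln n`!%:R + ln n`!%:R) - 2 * ln n`!%:R = ln 'C(2 * n, n)%:R :> R.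
  by ring.
have C2 : ('C(2 * n, n) <= 2 ^ (2 * n))%N.
  have -> : (2 ^ (2 * n) = (1 + 1) ^ (2 * n))%N by [].
  rewrite expnDn (bigD1 (inord n)) //= inordK ?ltnS //.
  by rewrite !exp1n !muln1 leq_addr.
apply: le_trans (_ : ln (2 ^+ (2 * n)) <= _).
  by rewrite ler_ln ?posrE ?ltr0n ?exprn_gt0 // -natrX ler_nat.
rewrite lnXn // -[leLHS]mulr_natl -natrM -[leRHS]mulr1 ler_wpM2l //.
by have := @le_ln1Dx R 1; apply; lra.
Qed.

Lemma psi_mono a b : (a <= b)%N -> psi_sum a <= psi_sum b.
Proof.
move=> ab; rewrite /psi_sum [leRHS](big_cat_nat (n := a.+1)) //= lerDl.
by apply: sumr_ge0 => i _; exact: vonMangoldt_ge0.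
Qed.

Theorem psi_bound n : psi_sum n <= 8 * n%:R.
Proof.
elim/ltn_ind: n => -[|[|n]] IH.
- by rewrite /psi_sum big_geq // mulr0.
- rewrite /psi_sum big_nat1 mulr1; have := @vonMangoldt_le_ln 1; rewrite ln1 => /(_ isT).
  by lra.
(* Half the argument, rounded up. Doubling and induction give [2 c + 8 c = 10 c], and from the
   argument 2 on [4 c] is at most three times it. *)
pose c := (n.+2 - n.+2 %/ 2)%N.
have c1 : (c < n.+2)%N by rewrite /c; lia.
have c2 : (n.+2 <= 2 * c)%N by rewrite /c; lia.
have c3 : (4 * c <= 3 * n.+2)%N by rewrite /c; lia.
have := IH c c1; have := psi_mono c2; have := psi_double c.
have : 4 * c%:R <= 3 * n.+2%:R :> R by rewrite -!natrM ler_nat.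
rewrite natrM => h1 h2 h3 h4; have := ler0n R n.+2; lra.
Qed.

End VonMangoldt.

(** * Sums over primes *)

Section Analytic.
Variable R : realType.

Lemma harmonic_le n : \sum_(1 <= d < n.+1) d%:R^-1 <= 1 + ln n%:R :> R.
Proof.
elim: n => [|n IH]; first by rewrite big_geq // ln0 // addr0.
case: n IH => [|n] IH; first by rewrite big_nat1 invr1 ln1 addr0.
rewrite big_nat_recr //=; apply: le_trans (lerD IH (lexx _)) _.
rewrite -addrA lerD2l.
have h : ln (1 + - n.+2%:R^-1) <= - n.+2%:R^-1 :> R.
  apply: le_ln1Dx; rewrite ltrN2 invf_lt1 ?ltr0n // ltr1n //.
have E : 1 + - n.+2%:R^-1 = n.+1%:R / n.+2%:R :> R.
  have n2 : n.+2%:R != 0 :> R by rewrite pnatr_eq0.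
  have -> : n.+1%:R = n.+2%:R - 1 :> R by rewrite -[in RHS]natr1 addrK.
  by field.
rewrite E ln_div ?posrE ?ltr0n // in h.
move: h; move: (ln n.+1%:R) (ln n.+2%:R) (n.+2%:R^-1) => x y z h; lra.
Qed.

(** Writing [ln k] as the sum of its increments puts nonnegative weights on the tails of the sum, so
    bounds for intervals ending at [D] suffice. *)
Lemma abel_ln (F : nat -> R[i]) (D : nat) (bd : R) : (0 < D)%N ->
  (forall x, (0 < x)%N -> normc (\sum_(x <= k < D.+1) F k) <= bd) ->
  normc (\sum_(1 <= k < D.+1) (ln k%:R)%:C * F k) <= ln D%:R * bd.
Proof.
move=> D0 Hbd; pose w i : R := ln i.+1%:R - ln i%:R.
have w0 i : (0 < i)%N -> 0 <= w i.
  by move=> i0; rewrite subr_ge0 ler_ln ?posrE ?ltr0n // ler_nat.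
have lnE k : (0 < k)%N -> ln k%:R = \sum_(1 <= i < k) w i.
  by move=> k0; rewrite telescope_sumr // ln1 subr0.
have -> : \sum_(1 <= k < D.+1) (ln k%:R)%:C * F k =
    \sum_(1 <= i < D) (w i)%:C * \sum_(i.+1 <= k < D.+1) F k.
  under [RHS]eq_bigr do rewrite big_distrr /=.
  have -> : \sum_(1 <= k < D.+1) (ln k%:R)%:C * F k =
      \sum_(1 <= k < D.+1) \sum_(1 <= i < k) (w i)%:C * F k.
    by apply: eq_big_nat => k /andP[k0 _]; rewrite lnE // rmorph_sum big_distrl.
  have e1 : \sum_(1 <= k < D.+1) \sum_(1 <= i < k) (w i)%:C * F k =
      \sum_(1 <= k < D.+1) \sum_(1 <= i < D | (i < k)%N) (w i)%:C * F k.
    apply: eq_big_nat => k /andP[k0 kD]; rewrite (big_nat_widen _ _ D) //.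
  rewrite e1 (exchange_big_dep xpredT) //=; apply: eq_big_nat => i /andP[i0 iD].
  by rewrite [RHS](big_nat_widenl _ 1).
rewrite (lnE D D0) big_distrl /=; apply: le_trans (normc_sum _ _ _) _.
rewrite [leLHS]big_nat_cond [leRHS]big_nat_cond; apply: ler_sum => i /andP[/andP[i0 _] _].
rewrite normcM normc_real ger0_norm ?w0 // ler_wpM2l ?w0 //.
exact: Hbd.
Qed.

Lemma count_residue (n Q k : nat) : (0 < Q)%N ->
  (\sum_(1 <= i < n.+1 | i == k %[mod Q]) 1 <= n %/ Q + 1)%N.
Proof.
move=> Q0; rewrite sum1_count -size_filter.
rewrite -(size_map (fun i => i %/ Q)%N) addn1 -(size_iota 0 (n %/ Q).+1).
apply: uniq_leq_size.
  rewrite map_inj_in_uniq ?filter_uniq ?iota_uniq // => x y.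
  rewrite !mem_filter => /andP[/eqP hx _] /andP[/eqP hy _] h.
  by rewrite (divn_eq x Q) (divn_eq y Q) h hx hy.
move=> j /mapP[m]; rewrite mem_filter mem_index_iota => /andP[_ /andP[_ mn]] ->.
by rewrite mem_iota add0n ltnS leq_div2r // -ltnS.
Qed.

Lemma big_nat_mul_le (K : nmodType) (N d : nat) (F : nat -> K) : (0 < d)%N ->
  \sum_(1 <= k < N.+1 | (d * k <= N)%N) F k = \sum_(1 <= k < (N %/ d).+1) F k.
Proof.
move=> d0; rewrite [RHS](big_nat_widen _ _ N.+1) ?ltnS ?leq_div //=.
by apply: eq_bigl => k; rewrite ltnS leq_divRL // mulnC.
Qed.

End Analytic.

(** * Vaughan's sums for a function with type I and type II estimates *)

Section TypeSums.
Variables (R : realType) (N U V Q : nat) (f : nat -> R[i]) (sig E : R).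
Hypotheses (N0 : (0 < N)%N) (U0 : (0 < U)%N) (Q0 : (0 < Q)%N) (QV : (Q <= V)%N).
Hypotheses (UN : (U <= N)%N) (VN : (V <= N)%N).
Hypotheses (sig0 : 0 <= sig) (E0 : 0 <= E).
Hypothesis f1 : forall n, normc (f n) <= 1.
Hypothesis H1 : forall d x1 x2, (0 < d)%N ->
  normc (\sum_(x1 <= x < x2) f (d * x)%N) <= (x2 - x1)%:R * sig + E.
Hypothesis H2 : forall n1 n2 x1 x2, n1 != n2 %[mod Q] ->
  normc (\sum_(x1 <= x < x2) f (x * n1)%N * (f (x * n2)%N)^*%C) <= (x2 - x1)%:R * sig + E.

Let L : R := 1 + ln N%:R.
Let Lam := @vonMangoldt R.
Let mu (d : nat) : R := (moebius d)%:~R.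
Let hh k : R := \sum_(1 <= a < N.+1 | (a %| k)%N && (V < a)%N) Lam a.

Let L1 : 1 <= L. Proof. by rewrite lerDl ln_nat_ge0. Qed.
Let mu1 d : `|mu d| <= 1. Proof. by rewrite /mu -intr_norm (ler_int R _ 1) moebius_le1. Qed.
Let lnL k : (k <= N)%N -> ln k%:R <= L.
Proof.
case: k => [|k] kN; first by rewrite ln0 // (le_trans ler01).
by apply: (@le_trans _ _ (ln N%:R)); rewrite ?lerDr // ler_ln ?posrE ?ltr0n // ler_nat.
Qed.

Let hh_bound k : (0 < k <= N)%N -> 0 <= hh k <= L.
Proof.
move=> kN; apply/andP; split; first by apply: sumr_ge0 => a _; exact: vonMangoldt_ge0.
have /andP[_ kN'] := kN; apply: le_trans (lnL kN').
rewrite -(vonMangoldt_sum R kN) [leLHS]big_mkcond [leRHS]big_mkcond; apply: ler_sum => a _ /=.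
by case: (a %| k)%N; case: (V < a)%N; rewrite ?vonMangoldt_ge0.
Qed.

Let hh0 k : (0 < k <= V)%N -> hh k = 0.
Proof.
move=> /andP[k0 kV]; rewrite /hh big1 // => a /andP[/(dvdn_leq k0) ak Va].
by move: (leq_trans Va (leq_trans ak kV)); rewrite ltnn.
Qed.

Let trunc_range (K : nmodType) W (F : nat -> K) : (W <= N)%N ->
  \sum_(1 <= d < N.+1 | (d <= W)%N) F d = \sum_(1 <= d < W.+1) F d.
Proof. by move=> WN; rewrite [RHS](big_nat_widen _ _ N.+1). Qed.

Let div_le d : (0 < d)%N -> (N %/ d)%:R <= N%:R * d%:R^-1 :> R.
Proof. by move=> d0; rewrite ler_pdivlMr ?ltr0n // -natrM ler_nat leq_divM. Qed.

Let harmL W : (W <= N)%N -> \sum_(1 <= d < W.+1) d%:R^-1 <= L.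
Proof.
move=> WN; apply: le_trans (harmonic_le R W) _; rewrite lerD2l.
case: W WN => [|W] WN; first by rewrite ln0 // ln_nat_ge0.
by rewrite ler_ln ?posrE ?ltr0n // ler_nat.
Qed.

Let inner_bound d x : (0 < d)%N -> (0 < x)%N ->
  normc (\sum_(x <= k < (N %/ d).+1) f (d * k)%N) <= N%:R * sig * d%:R^-1 + E.
Proof.
move=> d0 x0; apply: le_trans (H1 _ _ d0) _; rewrite lerD2r mulrAC ler_wpM2r //.
by apply: le_trans (div_le d0); rewrite ler_nat; case: x x0 => // x _; rewrite subSS leq_subr.
Qed.

Lemma typeI_log :
  normc (\sum_(1 <= d < N.+1 | (d <= U)%N) (mu d)%:C *
     \sum_(1 <= k < N.+1 | (d * k <= N)%N) (ln k%:R)%:C * f (d * k)%N)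
  <= L * (N%:R * sig * L + U%:R * E).
Proof.
have b1 d : (0 < d < U.+1)%N -> normc ((mu d)%:C *
     \sum_(1 <= k < N.+1 | (d * k <= N)%N) (ln k%:R)%:C * f (d * k)%N) <=
     L * (N%:R * sig * d%:R^-1 + E).
  case/andP=> d0 dU; have dN : (d <= N)%N by exact: leq_trans UN.
  rewrite normcM normc_real big_nat_mul_le //.
  have D0 : (0 < N %/ d)%N by rewrite divn_gt0.
  have X0 : 0 <= N%:R * sig * d%:R^-1 + E by rewrite addr_ge0 // !mulr_ge0 ?invr_ge0.
  apply: le_trans (_ : 1 * (ln (N %/ d)%:R * (N%:R * sig * d%:R^-1 + E)) <= _).
    apply: ler_pM; rewrite ?normc_ge0 //.
    by apply: abel_ln => // x x0; exact: inner_bound.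
  by rewrite mul1r ler_wpM2r // lnL // leq_div.
rewrite trunc_range //; apply: le_trans (normc_sum _ _ _) _.
rewrite big_nat_cond; apply: le_trans (ler_sum _ _) _.
  by move=> d; rewrite andbT => dU; exact: (b1 d dU).
rewrite -big_nat_cond -big_distrr /= big_split /= -big_distrr /=.
rewrite ler_wpM2l ?(le_trans ler01) // lerD //.
  by rewrite ler_wpM2l ?mulr_ge0 // harmL.
by rewrite sumr_const_nat subn1 mulr_natl.
Qed.

Lemma typeI_double :
  normc (\sum_(1 <= c < N.+1 | (c <= V)%N) \sum_(1 <= d < N.+1 | (d <= U)%N)
     (Lam c)%:C * (mu d)%:C * \sum_(1 <= m < N.+1 | (c * d * m <= N)%N) f (c * d * m)%N)
  <= L * (N%:R * sig * L ^+ 2 + U%:R * V%:R * E).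
Proof.
have b1 c d : (0 < c < V.+1)%N -> (0 < d < U.+1)%N -> normc ((Lam c)%:C * (mu d)%:C *
     \sum_(1 <= m < N.+1 | (c * d * m <= N)%N) f (c * d * m)%N) <=
     L * (N%:R * sig * (c%:R^-1 * d%:R^-1) + E).
  case/andP=> c0 cV /andP[d0 dU]; have cd0 : (0 < c * d)%N by rewrite muln_gt0 c0.
  rewrite !normcM !normc_real big_nat_mul_le // -invfM -natrM.
  apply: ler_pM; rewrite ?mulr_ge0 ?normc_ge0 //; last exact: inner_bound.
  rewrite -[leRHS]mulr1 ler_pM // ger0_norm ?vonMangoldt_ge0 //.
  by apply: le_trans (vonMangoldt_le_ln R c0) _; apply: lnL; exact: leq_trans VN.
rewrite trunc_range //; apply: le_trans (normc_sum _ _ _) _.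
apply: le_trans (_ : \sum_(1 <= c < V.+1) \sum_(1 <= d < U.+1)
    L * (N%:R * sig * (c%:R^-1 * d%:R^-1) + E) <= _).
  rewrite [leLHS]big_nat_cond [leRHS]big_nat_cond; apply: ler_sum => c; rewrite andbT => hc.
  rewrite trunc_range //; apply: le_trans (normc_sum _ _ _) _.
  rewrite [leLHS]big_nat_cond [leRHS]big_nat_cond; apply: ler_sum => d; rewrite andbT => hd.
  exact: b1.
under eq_bigr do rewrite -big_distrr big_split -big_distrr /= -big_distrr /=.
rewrite -big_distrr /= big_split /= -big_distrr /= -big_distrl /=.
rewrite ler_wpM2l ?(le_trans ler01) // lerD //.
  rewrite ler_wpM2l ?mulr_ge0 // expr2 ler_pM ?harmL //; apply: sumr_ge0 => i _; by rewrite invr_ge0.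
by rewrite !sumr_const_nat !subn1 /= -(mulr_natl (E *+ U)) -(mulr_natl E) mulrA [V%:R * _]mulrC.
Qed.

Let G d : R[i] := \sum_(1 <= k < N.+1 | (d * k <= N)%N) (hh k)%:C * f (d * k)%N.

Variable w : R.
Hypotheses (w0 : 0 <= w) (hw : sig + E / U%:R + 2 / Q%:R <= w ^+ 2).

Let cross M k1 k2 : R[i] :=
  \sum_(M.+1 <= d < (2 * M).+1 | (d * k1 <= N)%N && (d * k2 <= N)%N)
     f (d * k1)%N * (f (d * k2)%N)^*%C.

Lemma G_square_sum M : \sum_(M.+1 <= d < (2 * M).+1) normc (G d) ^+ 2 <=
  \sum_(1 <= k1 < N.+1) \sum_(1 <= k2 < N.+1) hh k1 * hh k2 * normc (cross M k1 k2).
Proof.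
have X0 : 0 <= \sum_(M.+1 <= d < (2 * M).+1) normc (G d) ^+ 2.
  by apply: sumr_ge0 => d _; rewrite exprn_ge0 ?normc_ge0.
rewrite -[leLHS]ger0_norm // -normc_real rmorph_sum /=.
have E1 d : (normc (G d) ^+ 2)%:C = \sum_(1 <= k1 < N.+1) \sum_(1 <= k2 < N.+1)
    (hh k1 * hh k2)%:C * (if (d * k1 <= N)%N && (d * k2 <= N)%N
       then f (d * k1)%N * (f (d * k2)%N)^*%C else 0).
  have cM (a b : R[i]) : (a * b)^*%C = a^*%C * b^*%C by exact: rmorphM.
  have cR (a : R) : (a%:C)^*%C = a%:C by rewrite /= oppr0.
  pose term k := if (d * k <= N)%N then (hh k)%:C * f (d * k)%N else 0.
  have GE : G d = \sum_(1 <= k < N.+1) term k by rewrite /G big_mkcond.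
  have GJ : (G d)^*%C = \sum_(1 <= k < N.+1) (term k)^*%C by rewrite GE rmorph_sum.
  rewrite normc_sqr GJ GE big_distrl; apply: eq_bigr => k1 _.
  rewrite big_distrr; apply: eq_bigr => k2 _; rewrite -[LHS]/(term k1 * (term k2)^*%C) /term.
  case: (d * k1 <= N)%N; last by rewrite mul0r mulr0.
  case: (d * k2 <= N)%N; last by rewrite conjc0 !mulr0.
  by rewrite cM cR rmorphM mulrACA.
under eq_bigr do rewrite E1.
rewrite exchange_big; apply: le_trans (normc_sum _ _ _) _.
rewrite [leLHS]big_nat_cond [leRHS]big_nat_cond; apply: ler_sum => k1; rewrite andbT => hk1.
rewrite exchange_big; apply: le_trans (normc_sum _ _ _) _.
rewrite [leLHS]big_nat_cond [leRHS]big_nat_cond; apply: ler_sum => k2; rewrite andbT => hk2.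
have /andP[h1 _] := hh_bound hk1; have /andP[h2 _] := hh_bound hk2.
rewrite -big_distrr normcM normc_real ger0_norm ?mulr_ge0 //.
by rewrite /cross [in leRHS]big_mkcond.
Qed.

Lemma cross_bound M k1 k2 : (0 < M)%N -> (0 < k1)%N -> (0 < k2)%N ->
  normc (cross M k1 k2) <= ((k1 <= N %/ M)%N && (k2 <= N %/ M)%N)%:R *
     (M%:R * sig + E + (k2 == k1 %[mod Q])%:R * M%:R).
Proof.
move=> M0 k10 k20.
have far k : ~~ (k <= N %/ M)%N -> forall d, (M.+1 <= d)%N -> (d * k <= N)%N = false.
  rewrite -ltnNge ltn_divLR // => h d Md; apply/negP => dk.
  have : (M * k <= d * k)%N by rewrite leq_mul2r (ltnW Md) orbT.
  by rewrite mulnC => h'; have := leq_trans h (leq_trans h' dk); rewrite ltnn.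
have [k1N|nk1] := boolP (k1 <= N %/ M)%N; last first.
  rewrite mul0r /cross big_nat_cond big_pred0 ?normc0 // => d.
  by case Md : (M < d)%N => //=; rewrite (far _ nk1) ?andbF.
have [k2N|nk2] := boolP (k2 <= N %/ M)%N; last first.
  rewrite mul0r /cross big_nat_cond big_pred0 ?normc0 // => d.
  by case Md : (M < d)%N => //=; rewrite (far _ nk2) ?andbF.
rewrite mul1r.
pose D := minn (2 * M) (minn (N %/ k1) (N %/ k2)).
have -> : cross M k1 k2 = \sum_(M.+1 <= d < D.+1) f (d * k1)%N * (f (d * k2)%N)^*%C.
  rewrite (big_nat_widen _ _ (2 * M).+1) ?ltnS ?geq_minl // /cross.
  rewrite [LHS]big_nat_cond [RHS]big_nat_cond; apply: eq_bigl => d.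
  rewrite ltnS /D !ltnS !leq_min !leq_divRL //.
  case: (M < d)%N => //=. by case: (d <= 2 * M)%N; rewrite ?andbT ?andbF //=.
have lenM : (D.+1 - M.+1 <= M)%N.
  by rewrite subSS leq_subLR addnn -mul2n geq_minl.
have [_|nm] := boolP (k2 == k1 %[mod Q]).
  rewrite mul1r; apply: le_trans (_ : M%:R <= _); last by rewrite lerDr addr_ge0 // mulr_ge0.
  apply: le_trans (normc_sum _ _ _) _.
  apply: le_trans (_ : \sum_(M.+1 <= d < D.+1) 1 <= _); last first.
    by rewrite sumr_const_nat ler_nat.
  apply: ler_sum => d _; rewrite normcM normcJ -[leRHS]mulr1.
  by rewrite ler_pM ?normc_ge0.
rewrite mul0r addr0; apply: le_trans (H2 _ _ _) _; first by rewrite eq_sym.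
by rewrite lerD2r ler_wpM2r // ler_nat.
Qed.

(** After Cauchy-Schwarz over [d], only [k1], [k2] up to [N1 = N / M] matter. Incongruent pairs
    modulo [Q] are estimated by [H2]; congruent ones, at most [N1 / Q + 1] for each [k1], trivially
    by [M]. This produces the three terms under [w ^+ 2]. *)
Lemma block_bound M : (U <= M)%N ->
  \sum_(M.+1 <= d < (2 * M).+1) normc (G d) <= L * N%:R * w.
Proof.
move=> UM; have M0 : (0 < M)%N by exact: leq_trans UM.
have L0 : 0 <= L by exact: le_trans L1.
have MR : 0 < M%:R :> R by rewrite ltr0n.
have QR : 0 < Q%:R :> R by rewrite ltr0n.
have UR : 0 < U%:R :> R by rewrite ltr0n.
have S0 : 0 <= \sum_(M.+1 <= d < (2 * M).+1) normc (G d).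
  by apply: sumr_ge0 => d _; exact: normc_ge0.
suff : (\sum_(M.+1 <= d < (2 * M).+1) normc (G d)) ^+ 2 <= (L * N%:R * w) ^+ 2.
  by rewrite ler_pXn2r // nnegrE !mulr_ge0.
have len : ((2 * M).+1 - M.+1 = M)%N by rewrite subSS mul2n -addnn addnK.
have cs : (\sum_(M.+1 <= d < (2 * M).+1) normc (G d)) ^+ 2 <=
    M%:R * \sum_(M.+1 <= d < (2 * M).+1) normc (G d) ^+ 2.
  have shiftE (g : nat -> R) : \sum_(M.+1 <= d < (2 * M).+1) g d = \sum_(i < M) g (i + M.+1)%N.
    by rewrite -{1}[M.+1]add0n big_addn len big_mkord.
  rewrite !shiftE.
  have := cauchy_schwarz_sum xpredT (fun _ : 'I_M => 1 : R) (fun i => normc (G (i + M.+1)%N)).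
  under eq_bigr do rewrite mul1r.
  by under [X in _ <= X * _]eq_bigr do rewrite expr1n; rewrite sumr_const card_ord.
apply: le_trans cs _.
pose N1 := (N %/ M)%N.
(* For [N1 < V] all coefficients [hh] in range vanish; otherwise [N1 >= V >= Q], which gives
   [N1 / Q + 1 <= 2 N1 / Q]. *)
have [N1V|VN1] := ltnP N1 V.
  apply: le_trans (ler_wpM2l (ltW MR) (G_square_sum M)) _.
  rewrite big_nat_cond big1 ?mulr0 ?exprn_ge0 ?mulr_ge0 // => k1 /andP[/andP[k10 k1N] _].
  rewrite big_nat_cond big1 // => k2 /andP[/andP[k20 k2N] _].
  have [kV|kV] := leqP k1 V; first by rewrite hh0 ?k10 // !mul0r.
  have := cross_bound M0 k10 k20; rewrite leqNgt (ltn_trans N1V kV) mul0r => h.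
  have -> : normc (cross M k1 k2) = 0 by apply/eqP; rewrite eq_le h normc_ge0.
  by rewrite mulr0.
pose c0 : R := M%:R * sig + E.
have c00 : 0 <= c0 by rewrite addr_ge0 ?mulr_ge0.
have N1N : (N1 <= N)%N by exact: leq_div.
have sq : \sum_(M.+1 <= d < (2 * M).+1) normc (G d) ^+ 2 <=
   L ^+ 2 * (N1%:R ^+ 2 * c0 + N1%:R * (N1 %/ Q + 1)%:R * M%:R).
  apply: le_trans (G_square_sum M) _.
  apply: le_trans (_ : \sum_(1 <= k1 < N.+1 | (k1 <= N1)%N) \sum_(1 <= k2 < N.+1 | (k2 <= N1)%N)
      L ^+ 2 * (c0 + (k2 == k1 %[mod Q])%:R * M%:R) <= _).
    rewrite [leRHS]big_mkcond [leLHS]big_nat_cond [leRHS]big_nat_cond; apply: ler_sum => k1.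
    rewrite andbT => hk1; have /andP[a0 aL] := hh_bound hk1; have /andP[k10 _] := hk1.
    apply: le_trans (_ : \sum_(1 <= k2 < N.+1) L ^+ 2 *
        (((k1 <= N1)%N && (k2 <= N1)%N)%:R * (c0 + (k2 == k1 %[mod Q])%:R * M%:R)) <= _).
      rewrite [leLHS]big_nat_cond [leRHS]big_nat_cond; apply: ler_sum => k2.
      rewrite andbT => hk2; have /andP[b0 bL] := hh_bound hk2; have /andP[k20 _] := hk2.
      apply: ler_pM; rewrite ?mulr_ge0 ?normc_ge0 //.
        by rewrite expr2 ler_pM.
      exact: cross_bound.
    case: ifP => _; last by rewrite big1 // => k2 _; rewrite mul0r mulr0.
    rewrite [leRHS]big_mkcond; apply: ler_sum => k2 _ /=.
    by case: ifP => _; rewrite ?mul1r // mul0r mulr0.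
  rewrite trunc_range //.
  under eq_bigr do rewrite trunc_range // -big_distrr /= big_split -big_distrl /=.
  rewrite -big_distrr ler_wpM2l ?exprn_ge0 //= big_split /=; apply: lerD.
    by rewrite !sumr_const_nat !subn1 /= -(mulr_natl (c0 *+ N1)) -(mulr_natl c0) mulrA expr2.
  apply: le_trans (_ : \sum_(1 <= k1 < N1.+1) (N1 %/ Q + 1)%:R * M%:R <= _); last first.
    by rewrite sumr_const_nat subn1 /= -[leLHS]mulr_natl mulrA.
  apply: ler_sum => k1 _; rewrite ler_wpM2r // -natr_sum ler_nat.
  by apply: leq_trans (count_residue N1 k1 Q0); rewrite [X in (_ <= X)%N]big_mkcond.
apply: le_trans (ler_wpM2l (ltW MR) sq) _.
have QN1 : (N1 %/ Q + 1)%:R <= 2 * (N1%:R / Q%:R) :> R.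
  have h1 : 1 <= N1%:R / Q%:R :> R.
    by rewrite ler_pdivlMr // mul1r ler_nat (leq_trans QV).
  have h2 : (N1 %/ Q)%:R <= N1%:R / Q%:R :> R.
    by rewrite ler_pdivlMr // -natrM ler_nat leq_divM.
  by rewrite natrD; lra.
have NM : N1%:R * M%:R <= N%:R :> R by rewrite -natrM ler_nat leq_divM.
apply: le_trans (_ : L ^+ 2 * (N1%:R * M%:R) ^+ 2 * (sig + E / M%:R + 2 / Q%:R) <= _).
  rewrite mulrCA -[leRHS]mulrA ler_wpM2l ?exprn_ge0 //.
  apply: le_trans (_ : M%:R * (N1%:R ^+ 2 * c0 + N1%:R * (2 * (N1%:R / Q%:R)) * M%:R) <= _).
    apply: ler_wpM2l; rewrite ?(ltW MR) // lerD2l; apply: ler_wpM2r; rewrite ?(ltW MR) //.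
    by apply: ler_wpM2l.
  rewrite le_eqVlt; apply/orP; left; apply/eqP; rewrite /c0; field.
  by rewrite !gt_eqF.
have -> : (L * N%:R * w) ^+ 2 = L ^+ 2 * (N%:R ^+ 2 * w ^+ 2) by ring.
rewrite -mulrA; apply: ler_wpM2l; first exact: exprn_ge0.
apply: ler_pM; rewrite ?exprn_ge0 ?mulr_ge0 //.
- by rewrite !addr_ge0 // divr_ge0.
- by rewrite lerXn2r // nnegrE ?mulr_ge0.
apply: le_trans hw; rewrite lerD2r lerD2l ler_wpM2l // lef_pV2 ?posrE //.
by rewrite ler_nat.
Qed.

Lemma typeII :
  normc (\sum_(1 <= d < N.+1 | (U < d)%N) (mu d)%:C * G d) <=
  (trunc_log 2 N).+1%:R * (L * N%:R * w).
Proof.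
set I := (trunc_log 2 N).+1.
have NI : (N < U * 2 ^ I)%N.
  by apply: (leq_trans (trunc_log_ltn N (isT : (1 < 2)%N))); rewrite leq_pmull.
have blocks I' : \sum_(U.+1 <= d < (U * 2 ^ I').+1) normc (G d) <= I'%:R * (L * N%:R * w).
  elim: I' => [|i IH]; first by rewrite expn0 muln1 big_geq // mul0r.
  have h1 : (U <= U * 2 ^ i)%N by rewrite leq_pmulr // expn_gt0.
  rewrite (big_cat_nat (n := (U * 2 ^ i).+1)) //=; last by rewrite ltnS leq_mul2l leq_exp2l // leqnSn orbT.
  rewrite -[i.+1]addn1 natrD mulrDl mul1r lerD // addn1 expnS mulnCA.
  exact: block_bound.
apply: le_trans (blocks I); apply: le_trans (normc_sum _ _ _) _.
apply: le_trans (_ : \sum_(1 <= d < N.+1 | (U < d)%N) normc (G d) <= _).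
  by apply: ler_sum => d _; rewrite normcM normc_real ler_piMl ?normc_ge0.
have -> : \sum_(1 <= d < N.+1 | (U < d)%N) normc (G d) = \sum_(U.+1 <= d < N.+1) normc (G d).
  by rewrite [RHS](big_nat_widenl _ 1).
rewrite [leRHS](big_cat_nat (n := N.+1)) //=.
  by rewrite lerDl; apply: sumr_ge0 => d _; exact: normc_ge0.
by rewrite ltnS ltnW.
Qed.

Theorem prime_sum_bound :
  normc (\sum_(1 <= n < N.+1) (Lam n)%:C * f n) <=
  8 * V%:R + L * (N%:R * sig * L + U%:R * E) + L * (N%:R * sig * L ^+ 2 + U%:R * V%:R * E) +
  (trunc_log 2 N).+1%:R * (L * N%:R * w).
Proof.
rewrite (@vaughan _ N U V (fun n => (Lam n)%:C) (fun n => (mu n)%:C) (fun n => (ln n%:R)%:C)).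
- have eE d : \sum_(1 <= k < N.+1 | (d * k <= N)%N)
      (\sum_(1 <= a < N.+1 | (a %| k)%N && (V < a)%N) (Lam a)%:C) * f (d * k)%N = G d.
    by apply: eq_bigr => k _; congr (_ * _); rewrite /hh rmorph_sum.
  under [X in normc (_ + X)]eq_bigr do rewrite eE.
  apply: le_trans (le_normcD _ _) _; apply: lerD; last exact: typeII.
  apply: le_trans (le_normcD _ _) _; rewrite normcN; apply: lerD; last exact: typeI_double.
  apply: le_trans (le_normcD _ _) _; apply: lerD; last exact: typeI_log.
  apply: le_trans (psi_bound R V); rewrite trunc_range //.
  apply: le_trans (normc_sum _ _ _) _; apply: ler_sum => n _.
  rewrite normcM normc_real ger0_norm ?vonMangoldt_ge0 //.
  by rewrite -[leRHS]mulr1 ler_wpM2l ?vonMangoldt_ge0.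
- move=> k kN; rewrite -(vonMangoldt_sum R kN) rmorph_sum; by [].
- move=> k kN; have := moebius_sum kN => /(congr1 (fun z => (z%:~R : R)%:C)).
  rewrite rmorph_sum rmorph_sum /= => ->.
  by case: (k == 1%N).
Qed.

End TypeSums.

(** * Prime sums with phase [a g^n / q^gam] *)

Section PrimeSumModPower.
Variables (R : realType) (q m b s u g gam N : nat) (a : int).
Hypotheses (qp : prime q) (q3 : (3 <= q)%N) (m0 : (0 < m)%N).
Hypotheses (bm : (1000 * m ^ 2 <= b)%N) (s0 : (0 < s)%N) (sb : (s <= b)%N).
Hypotheses (gam_le : (gam <= 8 * m * b)%N) (gam_ge : (8 * m * b <= gam + 8 * m)%N).
Hypotheses (qu : ~~ (q %| u)%N) (gE : (g ^ (q.-1 * q ^ s) = 1 + q ^ b * u)%N).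
Hypotheses (qg : ~~ (q %| g)%N) (qa : ~~ (q %| a)%Z) (Nb : (q ^ (15 * b) <= N)%N).

(** Zero at multiples of [q], so that only multipliers [n1], [n2] prime to [q] survive in the
    bilinear sums. *)
Definition coprime_phase (n : nat) : R[i] :=
  if (q %| n)%N then 0 else e1 ((a * (g ^ n)%N%:Z)%:~R / (q ^ gam)%:R).

Let B : R := q%:R.
Let e := (b %/ 4)%N.
Let sig : R := B `^ (1 - b%:R / (1152 * m%:R) ^+ 2).
Let E : R := 2 * (q ^ (4 * b).+1)%:R.

Let b1000 : (1000 <= b)%N.
Proof. by apply: leq_trans bm; rewrite leq_pmulr // expn_gt0 m0. Qed.
Let eb : (4 * e <= b)%N. Proof. by rewrite mulnC leq_divM. Qed.
Let e0 : (0 < e)%N. Proof. by rewrite divn_gt0 //; apply: leq_trans b1000. Qed.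
Let q0 : (0 < q)%N. Proof. exact: prime_gt0. Qed.

Let coprime_qe z : ~~ (q %| z)%Z -> coprimez (q ^ e)%N%:Z z.
Proof.
by rewrite dvdzE absz_nat => h; rewrite coprimezE absz_nat coprimeXl // prime_coprime.
Qed.

Let phase_ndvd n1 x i : ~~ (q %| n1)%N ->
  ~~ (q %| a * (g ^ (n1 * x))%N%:Z * (n1 ^ i)%N%:Z)%Z.
Proof.
move=> qn; rewrite dvdzE !abszM !absz_nat !Euclid_dvdM // !negb_or.
rewrite !Euclid_dvdX // (negbTE qg) (negbTE qn) /= !andbT.
by move: qa; rewrite dvdzE absz_nat.
Qed.

Let sig0 : 0 <= sig. Proof. exact: powR_ge0. Qed.
Let E0 : 0 <= E. Proof. by rewrite mulr_ge0. Qed.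

Lemma phase_type1 d x1 x2 : (0 < d)%N ->
  normc (\sum_(x1 <= x < x2) coprime_phase (d * x)%N) <= (x2 - x1)%:R * sig + E.
Proof.
move=> d0; have [qd|qd] := boolP (q %| d)%N.
  rewrite big1 ?normc0 ?addr_ge0 ?mulr_ge0 // => x _.
  by rewrite /coprime_phase dvdn_mulr.
have sep i x : ~~ (((q ^ e)%N %| twist g a 0 d 1 i x)%Z && ((q ^ e)%N %| twist g a 0 d 1 i.+1 x)%Z).
  rewrite negb_and; apply/orP; left.
  rewrite /twist !mul0r addr0; apply: contra (phase_ndvd x i qd).
  by apply: dvdz_trans; rewrite dvdzE !absz_nat dvdn_exp.
have := interval_sum_bound R qp q3 m0 bm s0 sb gam_le gam_ge qu gE eb sep x1 x2.
congr (normc _ <= _); apply: eq_bigr => x _.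
rewrite /two_exp /coprime_phase Euclid_dvdM // (negbTE qd) /=; case: ifP => // _.
by rewrite /twist !mul0r addr0 expn0 mulr1.
Qed.

Lemma phase_type2 n1 n2 x1 x2 : n1 != n2 %[mod q ^ e] ->
  normc (\sum_(x1 <= x < x2) coprime_phase (x * n1)%N * (coprime_phase (x * n2)%N)^*%C) <=
  (x2 - x1)%:R * sig + E.
Proof.
move=> n12; have [qn1|qn1] := boolP (q %| n1)%N.
  rewrite big1 ?normc0 ?addr_ge0 ?mulr_ge0 // => x _.
  by rewrite /coprime_phase dvdn_mull // mul0r.
have [qn2|qn2] := boolP (q %| n2)%N.
  rewrite big1 ?normc0 ?addr_ge0 ?mulr_ge0 // => x _.
  by rewrite /coprime_phase (dvdn_mull x qn2) conjc0 mulr0.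
(* [twist i.+1 - n2 * twist i] equals [a g^(n1 x) n1^i (n1 - n2)], in which only [n1 - n2] can be
   divisible by [q], and not by [q^e]. *)
have sep i x : ~~ (((q ^ e)%N %| twist g a (- a) n1 n2 i x)%Z &&
                   ((q ^ e)%N %| twist g a (- a) n1 n2 i.+1 x)%Z).
  apply/negP => /andP[h1 h2].
  have : ((q ^ e)%N %| a * (g ^ (n1 * x))%N%:Z * (n1 ^ i)%N%:Z * (n1%:Z - n2%:Z))%Z.
    have -> : a * (g ^ (n1 * x))%N%:Z * (n1 ^ i)%N%:Z * (n1%:Z - n2%:Z) =
       twist g a (- a) n1 n2 i.+1 x - n2%:Z * twist g a (- a) n1 n2 i x.
      by rewrite /twist !expnS !PoszM; ring.
    by apply: rpredB => //; apply: dvdz_mull.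
  rewrite (Gauss_dvdzr _ (coprime_qe (phase_ndvd x i qn1))) => h.
  move/negP: n12; apply; move: h; rewrite -eqz_mod_dvd => /eqP.
  by rewrite !modz_nat => -[->].
have := interval_sum_bound R qp q3 m0 bm s0 sb gam_le gam_ge qu gE eb sep x1 x2.
congr (normc _ <= _); apply: eq_bigr => x _.
rewrite /two_exp /coprime_phase !Euclid_dvdM // (negbTE qn1) (negbTE qn2) !orbF.
case: ifP => // _; first by rewrite mul0r.
rewrite -e1N -e1D; congr e1; rewrite /twist !expn0 !mulr1 !intrD mulNr rmorphN /=.
by rewrite mulrDl mulNr [(n1 * x)%N]mulnC [(n2 * x)%N]mulnC.
Qed.

Lemma ln2_ge : 2^-1 <= ln 2 :> R.
Proof.
have := @le_ln1Dx R (- 2^-1); rewrite ltrN2 invf_lt1 ?ltr1n // => /(_ isT).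
have -> : 1 + - 2^-1 = 2^-1 :> R by field.
rewrite lnV ?posrE // => h; by lra.
Qed.

Lemma trunc_log_ln n : (0 < n)%N -> (trunc_log 2 n).+1%:R <= 2 * (1 + ln n%:R) :> R.
Proof.
move=> n0; have h := trunc_logP (isT : (1 < 2)%N) n0.
have : ln (2 ^+ trunc_log 2 n) <= ln n%:R :> R.
  by rewrite ler_ln ?posrE ?ltr0n ?exprn_gt0 // -natrX ler_nat.
rewrite lnXn // -(mulr_natl (ln 2)) -natr1 => h1.
have : (trunc_log 2 n)%:R * 2^-1 <= (trunc_log 2 n)%:R * ln 2 :> R.
  by rewrite ler_wpM2l // ln2_ge.
move: h1; move: (_ * ln 2) (ln n%:R) => y z h1 h2; lra.
Qed.

(** The choice is [U = V = q^(5 b)] and [Q = q^e] with [e] about [b / 4]. As [E = 2 q^(4 b + 1)],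
    the quotient [E / U] is small, while [U V E] is about [q^(14 b)] and below [N >= q^(15 b)] with
    room for the saving. Type II costs a square root: [sig = B tau^2] leaves [tau]. The constant is
    [24 = 8 + 3 + 3 + 10]. *)
Theorem prime_phase_bound :
  normc (\sum_(1 <= n < N.+1) (vonMangoldt R n)%:C * coprime_phase n) <=
  24 * N%:R * B * (1 + ln N%:R) ^+ 3 * B `^ (- (b%:R / (2 * (1152 * m%:R) ^+ 2))).
Proof.
set c := (1152 * m%:R) ^+ 2.
have sigc : sig = B `^ (1 - b%:R / c) by [].
have c16 : 16 <= c.
  have mR : 1 <= m%:R ^+ 2 :> R by rewrite exprn_ege1 // ler1n.
  by rewrite /c exprMn; lra.
clearbody c.
set x := b%:R / (2 * c); set tau := B `^ (- x); set L := 1 + ln N%:R.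
have B0 : 0 < B by rewrite ltr0n.
have B1 : 1 <= B by rewrite ler1n.
have bR : 0 <= b%:R :> R by exact: ler0n.
have D0 : 0 < 2 * c by lra.
have x0 : 0 <= x by apply: divr_ge0 => //; exact: ltW.
have xb : 8 * x <= b%:R.
  rewrite /x mulrA ler_pdivrMr // mulrC ler_wpM2l //; lra.
have N0 : (0 < N)%N by apply: leq_trans Nb; rewrite expn_gt0 q0.
have powBn n : (q ^ n)%:R = B `^ n%:R by rewrite powR_mulrn ?natrX // ltW.
have BD y z : B `^ y * B `^ z = B `^ (y + z).
  by rewrite powRD //; apply/implyP => _; rewrite gt_eqF.
have powB y z : y <= z -> B `^ y <= B `^ z by apply: ler_powR.
have BE : B = B `^ 1 by rewrite powRr1 // ltW.
have tau0 : 0 < tau by exact: powR_gt0.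
have tau1 : tau <= 1 by rewrite -[leRHS](powRr0 B); apply: powB; lra.
have L1 : 1 <= L by rewrite lerDl ln_nat_ge0.
have tau2 : B * tau ^+ 2 = B `^ (1 - 2 * x).
  by rewrite expr2 {1}BE !BD; congr (_ `^ _); ring.
have sigE : sig = B * tau ^+ 2.
  rewrite tau2 sigc; congr (_ `^ (1 - _)); rewrite /x; field.
  by rewrite gt_eqF //; lra.
have Nlow y : y <= 15 * b%:R -> B `^ y <= N%:R.
  move=> h; apply: le_trans (powB _ _ h) _.
  by rewrite -natrM -powBn ler_nat.
have NT y : y + x <= 15 * b%:R + 1 -> B `^ y <= N%:R * B * tau.
  move=> h; have -> : B `^ y = B `^ (y + x - 1) * B * tau.
    by rewrite /tau {3}BE !BD; congr (_ `^ _); ring.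
  by rewrite ler_wpM2r ?(ltW tau0) // ler_wpM2r ?(ltW B0) // Nlow; lra.
set W := N%:R * B * tau.
have W0 : 0 <= W by rewrite !mulr_ge0 // ltW.
have U0 : (0 < q ^ (5 * b))%N by rewrite expn_gt0 q0.
have UN : (q ^ (5 * b) <= N)%N.
  by apply: leq_trans Nb; apply: leq_pexp2l; rewrite ?leq_mul2r ?orbT ?q0.
have QV : (q ^ e <= q ^ (5 * b))%N.
  by apply: leq_pexp2l; rewrite ?q0 // (leq_trans (leq_div _ _)) // leq_pmull.
have Q0 : (0 < q ^ e)%N by rewrite expn_gt0 q0.
have f1 n : normc (coprime_phase n) <= 1.
  by rewrite /coprime_phase; case: ifP; rewrite ?normc0 // normc_e1.
have w0 : 0 <= 5 * B * tau by rewrite !mulr_ge0 // ltW.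
have tt : 0 <= B * tau ^+ 2 by rewrite mulr_ge0 ?exprn_ge0 // ltW.
have hw : sig + E / (q ^ (5 * b))%:R + 2 / (q ^ e)%:R <= (5 * B * tau) ^+ 2.
  have h1 : E / (q ^ (5 * b))%:R <= 2 * (B * tau ^+ 2).
    rewrite /E !powBn -powRN -mulrA BD ler_pM2l // tau2; apply: powB.
    by rewrite -natr1 !natrM; lra.
  have h2 : 2 / (q ^ e)%:R <= 2 * (B * tau ^+ 2).
    rewrite powBn -powRN ler_pM2l // tau2; apply: powB.
    have : (b <= 4 * e + 3)%N.
      by rewrite {1}(divn_eq b 4) mulnC leq_add2l -ltnS ltn_pmod.
    by rewrite -(ler_nat R) natrD natrM; lra.
  rewrite sigE; apply: le_trans (lerD (lerD (lexx _) h1) h2) _.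
  have -> : (5 * B * tau) ^+ 2 = 25 * B * (B * tau ^+ 2) by ring.
  by nra.
apply: le_trans (prime_sum_bound N0 U0 Q0 QV UN UN sig0 E0 f1 phase_type1 phase_type2 w0 hw) _.
rewrite -/L.
have hV : (q ^ (5 * b))%:R <= W.
  by rewrite powBn; apply: NT; rewrite natrM; lra.
have hUE : (q ^ (5 * b))%:R * E <= 2 * W.
  rewrite /E mulrCA ler_pM2l // !powBn BD; apply: NT; rewrite -natr1 !natrM; lra.
have hUVE : (q ^ (5 * b))%:R * (q ^ (5 * b))%:R * E <= 2 * W.
  rewrite /E mulrCA ler_pM2l // !powBn !BD; apply: NT; rewrite -natr1 !natrM; lra.
have hS : N%:R * sig <= W.
  have -> : N%:R * sig = W * tau by rewrite sigE /W; ring.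
  by rewrite -[leRHS]mulr1 ler_wpM2l.
have hI := trunc_log_ln N0; rewrite -/L in hI.
have L0 : 0 <= L by lra.
have L2 : 1 <= L ^+ 2 by rewrite exprn_ege1.
have L23 : L ^+ 2 <= L ^+ 3 by rewrite [leRHS]exprS ler_peMl //; lra.
have LL3 : L <= L ^+ 3 by rewrite exprS ler_peMr.
have L3 : 1 <= L ^+ 3 by rewrite exprn_ege1.
have b0 : 8 * (q ^ (5 * b))%:R <= 8 * W * L ^+ 3.
  by rewrite -[leLHS]mulr1; apply: ler_pM => //; rewrite ?mulr_ge0 // ler_pM2l.
have b1 : L * (N%:R * sig * L + (q ^ (5 * b))%:R * E) <= 3 * W * L ^+ 3.
  have h : N%:R * sig * L + (q ^ (5 * b))%:R * E <= 3 * W * L.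
    have h1 : N%:R * sig * L <= W * L by rewrite ler_wpM2r.
    have h2 : W <= W * L by rewrite ler_peMr.
    by lra.
  apply: le_trans (ler_wpM2l L0 h) _.
  have -> : L * (3 * W * L) = 3 * W * L ^+ 2 by ring.
  apply: ler_wpM2l => //. by apply: mulr_ge0.
have b2 : L * (N%:R * sig * L ^+ 2 + (q ^ (5 * b))%:R * (q ^ (5 * b))%:R * E) <= 3 * W * L ^+ 3.
  have h : N%:R * sig * L ^+ 2 + (q ^ (5 * b))%:R * (q ^ (5 * b))%:R * E <= 3 * W * L ^+ 2.
    have h1 : N%:R * sig * L ^+ 2 <= W * L ^+ 2 by rewrite ler_wpM2r ?exprn_ge0.
    have h2 : W <= W * L ^+ 2 by rewrite ler_peMr.
    by lra.
  apply: le_trans (ler_wpM2l L0 h) _.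
  by rewrite le_eqVlt; apply/orP; left; apply/eqP; ring.
have b3 : (trunc_log 2 N).+1%:R * (L * N%:R * (5 * B * tau)) <= 10 * W * L ^+ 3.
  have -> : L * N%:R * (5 * B * tau) = L * (5 * W) by rewrite /W; ring.
  apply: le_trans (ler_wpM2r _ hI) _; first by apply: mulr_ge0 => //; apply: mulr_ge0.
  have -> : 2 * L * (L * (5 * W)) = 10 * W * L ^+ 2 by ring.
  by apply: ler_wpM2l => //; apply: mulr_ge0.
have -> : 24 * N%:R * B * L ^+ 3 * tau = 24 * W * L ^+ 3 by rewrite /W; ring.
by lra.
Qed.

End PrimeSumModPower.

(** * Choice of the parameters *)

Lemma ler_pM3 (K : realFieldType) (x x' y y' z z' : K) : 0 <= x -> 0 <= y -> 0 <= z ->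
  x <= x' -> y <= y' -> z <= z' -> x * y * z <= x' * y' * z'.
Proof. by move=> x0 y0 z0 xx yy zz; rewrite !ler_pM // mulr_ge0. Qed.

Section UniformBound.
Variable R : realType.

(** [saving_const * m^2] is the denominator of the saving in [prime_phase_bound]. *)
Definition saving_const : R := 2 * 1152 ^+ 2.

Lemma saving_const_ge : 1000 <= saving_const.
Proof. by rewrite /saving_const; lra. Qed.

Lemma expsum_trivial g M a (X : R) : 0 <= X -> normc (expsum g M a X) <= 8 * X.
Proof.
move=> X0; apply: le_trans (normc_sum _ _ _) _.
apply: le_trans (_ : 8 * (Num.truncn X)%:R <= _); last by rewrite ler_pM2l // truncn_le.
apply: le_trans (psi_bound R _); apply: ler_sum => n _.
by rewrite normcM normc_real ger0_norm ?vonMangoldt_ge0 // em_e1 normc_e1 mulr1.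
Qed.

(** Only powers of [q] contribute, and those up to [N] divide [q^J], the largest of them. *)
Lemma vonMangoldt_multiples q N : prime q -> (0 < N)%N ->
  \sum_(1 <= n < N.+1 | (q %| n)%N) vonMangoldt R n <= ln N%:R.
Proof.
move=> qp N0; pose J := trunc_log q N.
have JN : (q ^ J <= N)%N := trunc_logP (prime_gt1 qp) N0.
have J0 : (0 < q ^ J)%N by rewrite expn_gt0 prime_gt0.
apply: le_trans (_ : ln (q ^ J)%:R <= _); last first.
  by rewrite ler_ln ?posrE ?ltr0n // ler_nat.
have hJ : (0 < q ^ J <= N)%N by rewrite J0.
rewrite -(vonMangoldt_sum R hJ) [leLHS]big_mkcond [leRHS]big_mkcond.
rewrite [leLHS]big_nat_cond [leRHS]big_nat_cond; apply: ler_sum => n.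
rewrite andbT => /andP[n0 nN]; case: ifP => qn; last by case: ifP; rewrite ?vonMangoldt_ge0.
have [->|[p [j [pp j0 En ->]]]] := vonMangoldt_case R n.
  by case: ifP.
have pq : q = p.
  by apply/eqP; move: qn; rewrite En Euclid_dvdX // j0 andbT dvdn_prime2.
rewrite ifT //; rewrite En -pq dvdn_exp2l //.
by apply: trunc_log_max; rewrite ?prime_gt1 // pq -En -ltnS.
Qed.

Lemma expsum_split q g gam a (X : R) : prime q -> 1 <= X ->
  normc (expsum g (q ^ gam) a X) <=
  normc (\sum_(1 <= n < (Num.truncn X).+1) (vonMangoldt R n)%:C * coprime_phase R q g gam a n)
  + ln (Num.truncn X)%:R.
Proof.
move=> qp X1; have N0 : (0 < Num.truncn X)%N by rewrite truncn_gt0.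
rewrite /expsum.
have -> : \sum_(1 <= n < (Num.truncn X).+1) (vonMangoldt R n)%:C *
      em (q ^ gam) (a%:~R * g%:R ^+ n) =
    \sum_(1 <= n < (Num.truncn X).+1) (vonMangoldt R n)%:C * coprime_phase R q g gam a n +
    \sum_(1 <= n < (Num.truncn X).+1 | (q %| n)%N) (vonMangoldt R n)%:C *
      em (q ^ gam) (a%:~R * g%:R ^+ n).
  rewrite [X in _ + X]big_mkcond -big_split; apply: eq_bigr => n _ /=.
  rewrite /coprime_phase; case: ifP => _; first by rewrite mulr0 add0r.
  by rewrite addr0 em_e1 intrM -pmulrn -(natrX _ g n).
apply: le_trans (le_normcD _ _) _; rewrite lerD2l.
apply: le_trans (vonMangoldt_multiples qp N0).
apply: le_trans (normc_sum _ _ _) _; apply: ler_sum => n _.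
by rewrite normcM normc_real ger0_norm ?vonMangoldt_ge0 // em_e1 normc_e1 mulr1.
Qed.

Lemma expsum_uniform (q g : nat) : prime q -> (3 <= q)%N -> (2 <= g)%N -> ~~ (q %| g)%N ->
  exists2 C : R, 0 <= C & forall (gam m : nat) (X : R) (a : int),
    (0 < gam)%N -> (0 < m)%N -> 2 <= X -> gcdz a q%:Z = 1 ->
    2 * (gam%:R * ln q%:R) <= m%:R * ln X ->
    normc (expsum g (q ^ gam) a X) <=
      C * (X * (1 + ln X) ^+ 3 * q%:R `^ (- (gam%:R / (8 * saving_const * m%:R ^+ 3)))).
Proof.
move=> qp q3 g2 qg.
have fin (y z : R) : 0 <= y -> 24 * z + z <= 25 * z + 8 * y by move=> y0; lra.
have [beta beta0 Hbeta] := lte_unit qp q3 g2 qg.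
pose B : R := q%:R.
have q0 := prime_gt0 qp.
have B0 : 0 < B by rewrite ltr0n.
have B1 : 1 <= B by rewrite ler1n.
exists (25 * B + 8 * B `^ (beta%:R + 1)); first by rewrite addr_ge0 ?mulr_ge0 ?powR_ge0 // ltW.
move=> gam m X a gam0 m0 X2 aq hm.
have X0 : 0 < X by lra.
have lnX0 : 0 <= ln X by rewrite ln_ge0; lra.
have L3 : 1 <= (1 + ln X) ^+ 3 by rewrite exprn_ege1 // lerDl.
have D1000 := saving_const_ge; set D := saving_const in D1000 *.
have DE (x : R) : 2 * (1152 * x) ^+ 2 = D * x ^+ 2 by rewrite exprMn mulrA.
clearbody D.
have mR : 1 <= m%:R :> R by rewrite ler1n.
have mR0 : 0 < m%:R :> R by exact: lt_le_trans mR.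
have D0 : 0 < D by apply: lt_le_trans D1000; rewrite ltr0n.
have Den : 0 < 8 * D * m%:R ^+ 3 by rewrite !mulr_gt0 ?exprn_gt0 // ltr0n.
pose b := ((gam + (8 * m).-1) %/ (8 * m))%N.
have m8 : (0 < 8 * m)%N by rewrite muln_gt0.
have /andP[gam_le gam_ge] := ceil_div_bounds gam m8; rewrite -/b in gam_le gam_ge.
set T := gam%:R / (8 * D * m%:R ^+ 3).
have Tb : T <= b%:R / (D * m%:R ^+ 2).
  have gR : gam%:R <= 8 * m%:R * b%:R :> R by rewrite -!natrM ler_nat.
  rewrite /T ler_pdivrMr //.
  have -> : b%:R / (D * m%:R ^+ 2) * (8 * D * m%:R ^+ 3) = 8 * m%:R * b%:R.
    by field; rewrite !gt_eqF //; lra.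
  exact: gR.
have Bpos y : 0 <= B `^ y := powR_ge0 B y.
have XL : 0 <= X * (1 + ln X) ^+ 3 by rewrite mulr_ge0 ?exprn_ge0 ?addr_ge0 // ltW.
(* If [b] is too small for the method, the claimed saving [B^T] is at most [B^(beta + 1)]; the
   second summand of the constant absorbs it. *)
have [small|/negP big] := boolP ((b < 1000 * m ^ 2)%N || (b <= beta)%N).
  have T1 : T <= beta%:R + 1.
    apply: le_trans Tb _; rewrite ler_pdivrMr; last by rewrite mulr_gt0 ?exprn_gt0 //; lra.
    have Dm : 1000 * m%:R ^+ 2 <= D * m%:R ^+ 2 by rewrite ler_wpM2r ?exprn_ge0.
    have m2 : 1 <= m%:R ^+ 2 :> R by rewrite exprn_ege1.
    have bR : 0 <= beta%:R :> R by [].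
    case/orP: small => h.
      have h' : b%:R <= 1000 * m%:R ^+ 2 :> R by rewrite -natrX -natrM ler_nat ltnW.
      by clear -h' Dm m2 bR; nra.
    have h' : b%:R <= beta%:R :> R by rewrite ler_nat.
    by clear -h' Dm m2 bR; nra.
  have BT : 1 <= B `^ (beta%:R + 1) * B `^ (- T).
    rewrite -powRD; last by apply/implyP => _; rewrite gt_eqF.
    by rewrite -[leLHS](powRr0 B); apply: ler_powR => //; rewrite subr_ge0.
  apply: le_trans (expsum_trivial _ _ _ (ltW X0)) _.
  rewrite [leRHS]mulrDl; apply: le_trans (_ : 8 * B `^ (beta%:R + 1) * (X * (1 + ln X) ^+ 3 * B `^ (- T)) <= _).
    have -> : 8 * B `^ (beta%:R + 1) * (X * (1 + ln X) ^+ 3 * B `^ (- T)) =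
       8 * X * ((1 + ln X) ^+ 3 * (B `^ (beta%:R + 1) * B `^ (- T))) by ring.
    rewrite -[leLHS]mulr1; apply: ler_wpM2l; first by apply: mulr_ge0 => //; exact: ltW.
    by rewrite -[leLHS]mulr1; apply: ler_pM.
  by rewrite lerDr; apply: mulr_ge0; [apply: mulr_ge0 (ltW B0); exact: ler0n | exact: mulr_ge0].
have bm : (1000 * m ^ 2 <= b)%N by rewrite leqNgt; apply/negP => h; apply: big; rewrite h.
have betab : (beta < b)%N by rewrite ltnNge; apply/negP => h; apply: big; rewrite h orbT.
have [u qu gE] := Hbeta (b - beta)%N.
rewrite subnKC ?(ltnW betab) // in gE.
have s0 : (0 < b - beta)%N by rewrite subn_gt0.
have sb : (b - beta <= b)%N by rewrite leq_subr.
have qa : ~~ (q %| a)%Z.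
  apply/negP => h; have : (q%:Z %| gcdz a q)%Z by rewrite dvdz_gcd h dvdzz.
  rewrite aq dvdz1 absz_nat => /eqP E1; by rewrite E1 in qp.
set N := Num.truncn X.
have NX : N%:R <= X by rewrite truncn_le ltW.
have b1000 : 1000 <= b%:R :> R.
  have : (1000 <= b)%N by apply: leq_trans bm; rewrite leq_pmulr // expn_gt0 m0.
  by rewrite -(ler_nat R).
have lnq0 : 0 < ln B by rewrite ln_gt0 // ltr1n prime_gt1.
(* [hm] gives [m ln X >= 2 gam ln q], and [gam] is at least [8 m b] up to a thousandth, so [ln X] is
   nearly [16 b ln q] or more. *)
have Nb : (q ^ (15 * b) <= N)%N.
  rewrite /N truncn_ge_nat ?(ltW X0) // natrX -ler_ln ?posrE ?exprn_gt0 // lnXn // -(mulr_natl (ln q%:R)) natrM -/B.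
  have gR : 8 * m%:R * b%:R <= gam%:R + 8 * m%:R :> R by rewrite -!natrM -natrD ler_nat.
  have g1 : 8 * m%:R * b%:R * (999 / 1000) <= gam%:R :> R.
    by clear -gR b1000 mR0; nra.
  have : 2 * (8 * m%:R * b%:R * (999 / 1000) * ln B) <= m%:R * ln X.
    apply: le_trans hm; rewrite ler_pM2l // ler_wpM2r //; exact: ltW.
  have bl : 0 <= b%:R * ln B by rewrite mulr_ge0 // ltW.
  move=> h; rewrite -(ler_pM2l mR0); apply: le_trans h.
  have : 0 <= m%:R * (b%:R * ln B) by rewrite mulr_ge0.
  by clear; nra.
have N0 : (0 < N)%N by apply: leq_trans Nb; rewrite expn_gt0 q0.
have LN : ln N%:R <= ln X by rewrite ler_ln ?posrE ?ltr0n.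
have LN0 : 0 <= ln N%:R :> R by exact: ln_nat_ge0.
have X1 : 1 <= X by clear -X2; lra.
apply: le_trans (expsum_split g gam a qp X1) _; rewrite -/N.
have P := prime_phase_bound R qp q3 m0 bm s0 sb gam_le gam_ge qu gE qg qa Nb.
rewrite DE -/B in P; set tau := B `^ (- (b%:R / (D * m%:R ^+ 2))) in P.
have tauT : tau <= B `^ (- T) by apply: ler_powR => //; rewrite lerN2.
have tau0 : 0 <= tau := Bpos _.
have Ntau : 1 <= N%:R * tau.
  apply: le_trans (_ : B `^ (15 * b%:R) * tau <= _).
    rewrite /tau -powRD; last by apply/implyP => _; rewrite gt_eqF.
    rewrite -[leLHS](powRr0 B); apply: ler_powR => //; rewrite subr_ge0.
    rewrite ler_pdivrMr; last by rewrite mulr_gt0 ?exprn_gt0 //; lra.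
    have m2 : 1 <= m%:R ^+ 2 :> R by rewrite exprn_ege1.
    have Dm : 1 <= D * m%:R ^+ 2 by clear -m2 D1000; nra.
    by clear -Dm b1000; nra.
  rewrite ler_wpM2r // -natrM powR_mulrn ?(ltW B0) // -natrX ler_nat //.
have LL : (1 + ln N%:R) ^+ 3 <= (1 + ln X) ^+ 3.
  by rewrite lerXn2r ?nnegrE ?addr_ge0 // lerD2l.
have P1 : 24 * N%:R * B * (1 + ln N%:R) ^+ 3 * tau <= 24 * B * (X * (1 + ln X) ^+ 3 * B `^ (- T)).
  have -> : 24 * N%:R * B * (1 + ln N%:R) ^+ 3 * tau = 24 * B * (N%:R * (1 + ln N%:R) ^+ 3 * tau) by ring.
  have N00 : 0 <= N%:R :> R by exact: ler0n.
  have l0 : 0 <= (1 + ln N%:R) ^+ 3 :> R by apply: exprn_ge0; apply: addr_ge0.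
  have B24 : 0 <= 24 * B by apply: mulr_ge0; [exact: ler0n | exact: ltW].
  exact: ler_wpM2l B24 _ _ (ler_pM3 N00 l0 tau0 NX LL tauT).
have XT : 1 <= X * B `^ (- T).
  exact: le_trans Ntau (ler_pM (ler0n _ _) tau0 NX tauT).
have P2 : ln N%:R <= B * (X * (1 + ln X) ^+ 3 * B `^ (- T)).
  have h1 : ln N%:R <= (1 + ln X) ^+ 3.
    have L1 : 1 <= 1 + ln X by rewrite lerDl.
    apply: le_trans LN _; apply: le_trans (_ : 1 + ln X <= _); first by rewrite lerDr.
    by rewrite exprS; apply: ler_peMr; [exact: le_trans L1 | exact: exprn_ege1].
  apply: le_trans h1 _.
  have -> : B * (X * (1 + ln X) ^+ 3 * B `^ (- T)) = (1 + ln X) ^+ 3 * (B * (X * B `^ (- T))) by ring.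
  apply: ler_peMr; first by exact: le_trans ler01 L3.
  exact: le_trans XT (ler_peMl (le_trans ler01 XT) B1).
apply: le_trans (lerD (le_trans P P1) P2) _.
have XLT : 0 <= X * (1 + ln X) ^+ 3 * B `^ (- T) := mulr_ge0 XL (Bpos _).
rewrite -mulrDl; apply: (ler_wpM2r XLT).
exact: fin (Bpos _).
Qed.

End UniformBound.

(** * Trading logarithms for part of the saving *)

Lemma cubic_le_exp (R : realType) (A d y : R) : 0 <= A -> 0 < d -> 0 <= y ->
  (1 + A * y) ^+ 3 <= (1 + 3 * A / d) ^+ 3 * expR (d * y).
Proof.
move=> A0 d0 y0; pose z := d * y / 3.
have z0 : 0 <= z by rewrite divr_ge0 // mulr_ge0 // ltW.
have -> : expR (d * y) = expR z ^+ 3.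
  by rewrite -expRM_natl /z; congr expR; field.
have K0 : 0 <= 3 * A / d by rewrite divr_ge0 ?mulr_ge0 // ltW.
have h : 1 + A * y <= (1 + 3 * A / d) * (1 + z).
  have E : 3 * A / d * z = A * y by rewrite /z; field; rewrite gt_eqF.
  by rewrite mulrDl mul1r mulrDr mulr1 E; lra.
rewrite -exprMn lerXn2r ?nnegrE ?mulr_ge0 ?addr_ge0 ?expR_ge0 // ?mulr_ge0 //.
by apply: le_trans h _; rewrite ler_wpM2l ?addr_ge0 // expR_ge1Dx.
Qed.

(* Below the threshold [Y <= L] the trivial bound suffices; above it the
   surplus saving [Y ^- 3] pays for the factor [L ^ 3]. *)
Lemma log_power_tradeoff (R : realFieldType) (S C X L Y l : R) :
  0 <= C -> 0 <= X -> 0 < Y -> 0 <= L -> L <= 3 * l -> 1 <= 2 * l ->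
  S <= 8 * X -> S <= C * (X * L ^+ 3 * Y^-1 ^+ 4) ->
  S <= (24 + 2 * C) * (X * Y^-1 * l).
Proof.
move=> C0 X0 Y0 L0 Ll l1 S8 SC.
have l0 : 0 <= l by lra.
have XY : 0 <= X * Y^-1 by rewrite mulr_ge0 // invr_ge0 ltW.
have XYl : 0 <= X * Y^-1 * l by exact: mulr_ge0.
have h24 : 0 <= 24 * (X * Y^-1 * l) by apply: mulr_ge0; first exact: ler0n.
have hC : 0 <= 2 * C * (X * Y^-1 * l).
  by apply: mulr_ge0 => //; apply: mulr_ge0; first exact: ler0n.
rewrite mulrDl; have [YL|LY] := lerP Y L.
  apply: le_trans S8 _; rewrite -[leLHS]addr0; apply: lerD => //.
  have -> : 8 * X = 8 * (X * Y^-1 * Y) by rewrite mulfVK ?gt_eqF.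
  have : X * Y^-1 * Y <= X * Y^-1 * (3 * l) by rewrite ler_wpM2l // (le_trans YL).
  by move: (X * Y^-1) => x h; lra.
apply: le_trans SC _; rewrite -[leLHS]add0r; apply: lerD => //.
have -> : 2 * C * (X * Y^-1 * l) = C * (X * Y^-1 * (2 * l)) by ring.
apply: ler_wpM2l => //.
have -> : X * L ^+ 3 * Y^-1 ^+ 4 = X * Y^-1 * (L * Y^-1) ^+ 3 by rewrite exprMn; ring.
apply: ler_wpM2l => //; apply: le_trans l1.
apply: exprn_ile1; first by rewrite mulr_ge0 // invr_ge0 ltW.
by rewrite ler_pdivrMr // mul1r ltW.
Qed.

(** The condition on [k] comes from [216 = 8 * 3^3], with [m r <= 3] bounding [m] by [3 / r]. *)
Lemma inv_bound (R : realFieldType) (D g r m k : R) : 0 < D -> 0 <= g -> 0 < m ->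
  m * r <= 3 -> 0 < r -> k * 216 <= 1000 ->
  k * (1000 * D)^-1 * g * r ^+ 3 <= g / (8 * D * m ^+ 3).
Proof.
move=> D0 g0 m0 mr r0 k0.
rewrite ler_pdivlMr; last by rewrite !mulr_gt0 ?exprn_gt0.
have -> : k * (1000 * D)^-1 * g * r ^+ 3 * (8 * D * m ^+ 3) = k * 8 / 1000 * (m * r) ^+ 3 * g.
  by rewrite exprMn; field; rewrite gt_eqF.
rewrite -[leRHS]mul1r; apply: ler_wpM2r; first exact: g0.
have mr0 : 0 <= m * r by apply: mulr_ge0; exact: ltW.
have h27 : (m * r) ^+ 3 <= 27.
  have -> : 27 = 3 ^+ 3 :> R by ring.
  by rewrite lerXn2r // nnegrE.
have h0 : 0 <= (m * r) ^+ 3 by rewrite exprn_ge0.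
have h1 : k * 8 / 1000 <= 27^-1 by lra.
apply: le_trans (_ : 27^-1 * (m * r) ^+ 3 <= _); first exact: ler_wpM2r.
by lra.
Qed.

Lemma powR_inv_bound (R : realType) (B D g r m k : R) : 1 <= B -> 0 < D -> 0 <= g ->
  0 < m -> m * r <= 3 -> 0 < r -> k * 216 <= 1000 ->
  B `^ (- (g / (8 * D * m ^+ 3))) <= B `^ (- (k * (1000 * D)^-1 * g * r ^+ 3)).
Proof. by move=> *; apply: ler_powR => //; rewrite lerN2; exact: inv_bound. Qed.

Lemma powRE (R : realType) (B x : R) : 0 < B -> B `^ x = expR (x * ln B).
Proof. by move=> B0; rewrite /powR gt_eqF. Qed.

(** Half of the saving pays for the logarithms: [ln X <= A g ln B] bounds them by a cubic in
    [g ln B], which [cubic_le_exp] dominates. *)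
Lemma large_X_bound (R : realType) (A C S X B g d : R) :
  0 <= A -> 0 < d -> 0 <= C -> 0 < X -> 1 <= B -> 0 <= g -> 0 <= ln X ->
  X <= B `^ (A * g) ->
  S <= C * (X * (1 + ln X) ^+ 3 * B `^ (- (2 * d * g))) ->
  S <= C * (1 + 3 * A / d) ^+ 3 * (X * B `^ (- (d * g))).
Proof.
move=> A0 d0 C0 X0 B1 g0 lX XA /le_trans; apply.
have B0 : 0 < B by exact: lt_le_trans B1.
have lB : 0 <= ln B by exact: ln_ge0.
have lXA : ln X <= A * (g * ln B).
  by rewrite mulrA -ln_powR ler_ln ?posrE // powR_gt0.
rewrite -(mulrA C); apply: ler_wpM2l => //.
rewrite [leRHS]mulrCA -(mulrA X); apply: ler_wpM2l; first exact: ltW.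
have E : - (2 * d * g) * ln B = - (d * (g * ln B)) + - (d * g) * ln B by ring.
rewrite !powRE // E expRD mulrA expRN; apply: ler_wpM2r; first exact: expR_ge0.
rewrite ler_pdivrMr ?expR_gt0 //.
apply: le_trans (cubic_le_exp A0 d0 (mulr_ge0 g0 lB)).
by apply: lerXn2r; rewrite ?nnegrE ?addr_ge0 ?mulr_ge0 ?lerD2l.
Qed.

(** With [Y = X^(d r^2)], the relation [r g ln B = ln X] turns [B^(4 d g r^3)] into [Y^4]: one
    factor [Y] is the saving claimed, the other three remove logarithms. *)
Lemma small_X_bound (R : realType) (C S X B g d r : R) :
  0 <= C -> 0 < X -> 0 < B -> 2^-1 <= ln X -> r * (g * ln B) = ln X ->
  S <= 8 * X ->
  S <= C * (X * (1 + ln X) ^+ 3 * B `^ (- (4 * d * g * r ^+ 3))) ->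
  S <= (24 + 2 * C) * (X `^ (1 - d * r ^+ 2) * ln X).
Proof.
move=> C0 X0 B0 lX rE S8 SC; pose Y := expR (d * r ^+ 2 * ln X).
have -> : X `^ (1 - d * r ^+ 2) = X * Y^-1.
  by rewrite powRE // mulrBl mul1r expRD expRN lnK.
apply: (@log_power_tradeoff _ S C X (1 + ln X)) => //.
- exact: ltW.
- exact: expR_gt0.
- by lra.
- by lra.
- by lra.
apply: le_trans SC _; rewrite powRE // -expRN -expRM_natl.
have -> // : - (4 * d * g * r ^+ 3) * ln B = 4%:R * - (d * r ^+ 2 * ln X).
by rewrite -rE; ring.
Qed.

Theorem theorem1p1 (R : realType) (A : R) (A_gt0 : 0 < A) :
  exists delta : R, 0 < delta /\
  forall q g : nat, prime q -> (3 <= q)%N -> (2 <= g)%N -> ~~ (q %| g)%N ->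
  exists c : R,
  forall (gamma : nat) (X : R) (a : int),
    (0 < gamma)%N -> 2 <= X -> X <= q%:R `^ (A * gamma%:R) ->
    gcdz a q%:Z = 1 ->
    let rho := ln X / ln (q%:R ^+ gamma) in
    normc (expsum g (q ^ gamma) a X) <=
      c * (X `^ (1 - delta * rho ^+ 2) * ln X
           + X * q%:R `^ (- (delta * gamma%:R))).
Proof.
have D0 : 0 < saving_const R by apply: lt_le_trans (saving_const_ge R); rewrite ltr0n.
have D10 : 0 < 1000 * saving_const R by apply: mulr_gt0; [rewrite ltr0n|exact: D0].
(* The factor 1000 leaves room for four times the saving: [4 * 216 <= 1000] in [inv_bound]. *)
set D := saving_const R in D0 D10; pose d := (1000 * D)^-1.
have d0 : 0 < d by rewrite invr_gt0.
exists d; split=> // q g qp q3 g2 qg.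
have [C C0 HC] := expsum_uniform R qp q3 g2 qg.
pose K := (1 + 3 * A / d) ^+ 3.
have K0 : 0 <= K.
  by apply: exprn_ge0; apply: addr_ge0 => //; apply: divr_ge0; [apply: mulr_ge0; [exact: ler0n|exact: ltW]|exact: ltW].
exists (24 + 2 * C + C * K) => gamma X a gam0 X2 XA aq /=; set rho := ln X / _.
set S := normc _.
have X0 : 0 < X by exact: lt_le_trans X2.
have B0 : 0 < q%:R :> R by rewrite ltr0n prime_gt0.
have B1 : 1 <= q%:R :> R by rewrite ler1n prime_gt0.
have lnB : 0 < ln q%:R :> R by rewrite ln_gt0 // ltr1n prime_gt1.
have GR : 0 < gamma%:R :> R by rewrite ltr0n.
have lnG : ln (q%:R ^+ gamma) = gamma%:R * ln q%:R :> R by rewrite lnXn // -[LHS]mulr_natl.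
have G0 : 0 < gamma%:R * ln q%:R :> R by rewrite mulr_gt0.
have lnX2 : 2^-1 <= ln X.
  by apply: le_trans (ln2_ge R) _; rewrite ler_ln ?posrE.
have lnX0 : 0 < ln X by apply: lt_le_trans lnX2; rewrite invr_gt0.
have rhoE : rho * (gamma%:R * ln q%:R) = ln X by rewrite /rho lnG divfK // gt_eqF.
have rho0 : 0 < rho by rewrite /rho lnG divr_gt0.
clearbody rho.
(* [m rho >= 2] provides the hypothesis of [expsum_uniform], while [m rho <= 2 + rho] keeps [m] of
   order [1 / rho]. *)
pose m := (Num.truncn (2 / rho)).+1.
have m2 : 2 <= m%:R * rho.
  by rewrite -ler_pdivrMr // ltW // truncnS_gt // divr_ge0 // ltW.
have m3 : m%:R * rho <= 2 + rho.
  rewrite /m -natr1 mulrDl mul1r lerD2r -ler_pdivlMr //.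
  by rewrite truncn_le divr_ge0 // ltW.
have m0 : 0 < m%:R :> R by rewrite ltr0n.
have hm : 2 * (gamma%:R * ln q%:R) <= m%:R * ln X.
  by rewrite -rhoE [leRHS]mulrA ler_pM2r.
have bnd : S <= C * (X * (1 + ln X) ^+ 3 * q%:R `^ (- (gamma%:R / (8 * D * m%:R ^+ 3)))).
  exact: HC.
have coef k r : m%:R * r <= 3 -> 0 < r -> k * 216 <= 1000 ->
    S <= C * (X * (1 + ln X) ^+ 3 * q%:R `^ (- (k * d * gamma%:R * r ^+ 3))).
  move=> mr r0 k0; apply: le_trans bnd _; apply: ler_wpM2l => //.
  apply: ler_wpM2l; last by apply: powR_inv_bound => //; exact: ltW.
  by apply: mulr_ge0; [exact: ltW|apply: exprn_ge0; apply: addr_ge0 => //; exact: ltW].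
have S8 : S <= 8 * X by apply: expsum_trivial; exact: ltW.
have A0 := ltW A_gt0; have C24 : 0 <= 24 + 2 * C by lra.
clearbody S d D m; clear HC bnd m2 hm D10.
have F0 : 0 <= X `^ (1 - d * rho ^+ 2) * ln X by rewrite mulr_ge0 ?powR_ge0 // ltW.
have G1 : 0 <= X * q%:R `^ (- (d * gamma%:R)) by rewrite mulr_ge0 ?powR_ge0 // ltW.
have CK : 0 <= C * K by exact: mulr_ge0.
(* For [rho >= 1] the bound [m rho <= 3 rho] gives [m <= 3], so [r = 1] serves in [coef] and the
   saving is a power of [q^gamma]; otherwise [m rho <= 3] and [r = rho]. *)
have [r1|r1] := leP 1 rho.
  have c1 : m%:R * 1 <= 3 :> R.
    rewrite mulr1; have : m%:R * rho <= 3 * rho by lra.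
    by rewrite ler_pM2r.
  have h : S <= C * K * (X * q%:R `^ (- (d * gamma%:R))).
    apply: (@large_X_bound _ A) => //; try exact: ltW.
    by have := coef 2 1 c1 ltr01; rewrite expr1n mulr1; apply; lra.
  apply: le_trans h _; rewrite mulrDr; apply: ler_wpDl.
    by apply: mulr_ge0 => //; exact: addr_ge0.
  by apply: ler_wpM2r => //; rewrite lerDr.
have h : S <= (24 + 2 * C) * (X `^ (1 - d * rho ^+ 2) * ln X).
  apply: (@small_X_bound _ C S X q%:R gamma%:R) => //.
  by apply: coef => //; lra.
apply: le_trans h _; rewrite mulrDr; apply: ler_wpDr.
  by apply: mulr_ge0 => //; exact: addr_ge0.
by apply: ler_wpM2r => //; rewrite lerDl.
Qed.
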